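(* Let $d\geq 1$ be an integer and adopt the setting described in the context (discrete tori $G_n$ with unitary line bundle, limits $\alpha_i$ and $\lambda_i$). Suppose that $\lambda_i\in[0,1]$ for each $i\in\{1,\ldots,d\}$ and that $\lambda_i\notin\{0,1\}$ for some index $i$. Let $$c_d=-\int_0^\infty\Big(e^{-2dt}I_0(2t)^d-e^{-t}\Big)\frac{dt}{t}.$$ Then, as $n\to\infty$, $$\log\det\Delta=\Big(\prod_{i=1}^{d}a_i(n)\Big)c_d-\zeta_{EH}'(0;\alpha_1,\ldots,\alpha_d;\lambda_1,\ldots,\lambda_d)+o(1),$$ where $\Delta$ is the bundle Laplacian on $G_n$ and $\zeta_{EH}'(0;\ldots)$ denotes the derivative at $s=0$ of the meromorphic continuation of $\zeta_{EH}$.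
   Context: Setting. Fix an integer $d\ge1$. For each $i\in\{1,\ldots,d\}$ let $(a_i(n))_{n\ge1}$ be a sequence of positive integers with $\lim_{n\to\infty}a_i(n)/n=\alpha_i>0$. For every $n$, every $i$ and every $0\le j\le a_i(n)-1$ let $w_{i,j}(n)\in\mathbb{C}$ with $|w_{i,j}(n)|=1$. Let $G_n$ be the Cayley graph of $\prod_{i=1}^d\mathbb{Z}/a_i(n)\mathbb{Z}$ with generators $\pm e_i$ (the vectors $(0,\ldots,0,\pm1,0,\ldots,0)$), with vertex set $V$. Each oriented edge carries a weight: the oriented edge from $x$ to $x+e_i$ carries the weight $w_{i,x_i}(n)$, where $x_i\in\{0,\ldots,a_i(n)-1\}$ is the $i$-th coordinate of $x$, and the oppositely oriented edge from $x+e_i$ to $x$ carries the inverse weight $w_{i,x_i}(n)^{-1}$. The bundle Laplacian $\Delta$ acts on functions $f:V\to\mathbb{C}$ by $\Delta f(v)=\sum_{u\sim v}(f(v)-\phi_{u,v}f(u))$, the sum over neighbours $u$ of $v$, where $\phi_{u,v}$ is the weight of the oriented edge from $u$ to $v$. Let $\lambda_i(n)\in[0,1)$ be defined by $\prod_{j=0}^{a_i(n)-1}w_{i,j}(n)=e^{2\pi i\lambda_i(n)}$, and assume that $\lambda_i(n)$ converges as $n\to\infty$ for each $i$, with limit $\lambda_i:=\lim_{n\to\infty}\lambda_i(n)\in[0,1]$. For the index $i$ with $\lambda_i\notin\{0,1\}$ it is assumed that $\lambda_i(n)\ne0$ for all $n$ (so $\Delta$ is invertible). $I_\nu$ denotes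 the modified Bessel function of the first kind of order $\nu$. Epstein–Hurwitz zeta function: for $\Re(s)>d/2$, $$\zeta_{EH}(s;\alpha_1,\ldots,\alpha_d;\lambda_1,\ldots,\lambda_d)=(2\pi)^{-2s}\sum_{K=(k_1,\ldots,k_d)\in\mathbb{Z}^d}\Big(\Big(\frac{k_1+\lambda_1}{\alpha_1}\Big)^2+\cdots+\Big(\frac{k_d+\lambda_d}{\alpha_d}\Big)^2\Big)^{-s},$$ which extends meromorphically to $\mathbb{C}$ with only a simple pole at $s=d/2$. *)

(* Defs.v *)
From HB Require Import structures.
From mathcomp Require Import all_boot all_order all_algebra finmap.
From mathcomp Require Import complex.
From mathcomp Require Import all_classical all_reals all_analysis.
From mathcomp Require Import showcase.summability.

Set Implicit Arguments.
Unset Strict Implicit.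
Unset Printing Implicit Defensive.

Import Order.TTheory GRing.Theory Num.Theory.
Import numFieldNormedType.Exports.

Local Open Scope classical_set_scope.
Local Open Scope ring_scope.
Local Open Scope complex_scope.

(* Throughout, R[i]^o is the field R[i] seen as a normed module over itself:
   this is where the library puts the topology of R[i]. *)

Section ComplexFunctions.
Variable R : realType.
Implicit Types (z s : R[i]) (f : R[i]^o -> R[i]^o).

Definition cexp z : R[i] :=
  (expR (complex.Re z))%:C * (cos (complex.Im z) +i* sin (complex.Im z)).

(* x ^ s for a real base 0 < x *)
Definition cpow (x : R) s : R[i] := cexp (s * (ln x)%:C).

Definition cnorm z : R := complex.Re `|z|.

(* principal argument, with values in ]-pi, pi] for z != 0 *)
Definition carg z : R :=
  let th := acos (complex.Re z / cnorm z) in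
  if 0 <= complex.Im z then th else - th.

(* principal logarithm: clog x%:C = (ln x)%:C for 0 < x *)
Definition clog z : R[i] := ln (cnorm z) +i* carg z.

Definition analytic_at f z := exists c : nat -> R[i],
  \forall w \near (z : R[i]^o),
    (series (fun k => c k * (w - z) ^+ k) : nat -> R[i]^o) @ \oo --> f w.

(* The value of f at z itself is irrelevant. *)
Definition simple_pole_at f z := exists h : R[i]^o -> R[i]^o,
  [/\ analytic_at h z, h z != 0 &
      \forall w \near (z : R[i]^o), w != z -> f w = h w / (w - z)].

End ComplexFunctions.

Section BundleLaplacian.
Variables (R : realType) (d : nat) (a : 'I_d -> nat) (w : 'I_d -> nat -> R[i]).

Definition torus := {dffun forall i : 'I_d, 'I_(a i)}.

(* (i, true) stands for e_i and (i, false) for - e_i.  Neighbours are indexed by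
   generators, so that they are counted with multiplicity if some a i <= 2. *)
Definition generator := ('I_d * bool)%type.

Definition opp_gen (g : generator) : generator := (g.1, ~~ g.2).

Definition step (x : torus) (g : generator) : torus :=
  [ffun j => if j == g.1 then if g.2 then ordS (x j) else ord_pred (x j)
             else x j].

(* weight of the oriented edge from x to step x g *)
Definition weight (x : torus) (g : generator) : R[i] :=
  if g.2 then w g.1 (x g.1) else (w g.1 (step x g g.1))^-1.

(* With u = step v g, the oriented edge from u to v is the one leaving u in the
   direction opp_gen g. *)
Definition bundle_laplacian (f : torus -> R[i]) (v : torus) : R[i] :=
  \sum_(g : generator) (f v - weight (step v g) (opp_gen g) * f (step v g)).

Definition bundle_laplacian_mx : 'M[R[i]]_#|{: torus}| :=
  \matrix_(k, l) bundle_laplacian (fun x => (x == enum_val l)%:R) (enum_val k).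

Definition det_bundle_laplacian : R[i] := \det bundle_laplacian_mx.

End BundleLaplacian.

Section Constants.
Variable R : realType.

(* modified Bessel function of the first kind, of integral order nu *)
Definition besselI (nu : nat) (x : R) : R :=
  limn (series (fun m => (x / 2) ^+ (m.*2 + nu) / (m`! * (m + nu)`!)%:R)).

Definition lattice_constant (d : nat) : R :=
  - \int[lebesgue_measure]_(t in `]0, +oo[)
      ((expR (- (2 * d%:R * t)) * besselI 0 (2 * t) ^+ d - expR (- t)) / t).

End Constants.

Section EpsteinHurwitz.
Variables (R : realType) (d : nat) (alpha lambda : 'I_d -> R).

(* Meaningful only for d / 2 < Re s; summability.sum is the unconditional sum,
   i.e., the limit of the finite partial sums along the filter totally. *)
Definition zetaEH_series (s : R[i]) : R[i] :=
  cpow (2 * pi) (- (2 * s)) *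
  @summability.sum _ _ R[i]^o (fun K : {ffun 'I_d -> int} =>
    cpow (\sum_i (((K i)%:~R + lambda i) / alpha i) ^+ 2) (- s)).

(* Z is the meromorphic continuation of the series to the whole plane, with a
   simple pole at d / 2 as its only singularity. *)
Definition is_zetaEH (Z : R[i]^o -> R[i]^o) :=
  [/\ forall s : R[i], d%:R / 2 < complex.Re s -> Z s = zetaEH_series s,
      forall s : R[i], s != d%:R / 2 -> analytic_at Z s &
      simple_pole_at Z (d%:R / 2)].

End EpsteinHurwitz.

(* Main.v *)
Require Import Defs.
From HB Require Import structures.
From mathcomp Require Import all_boot all_order all_algebra finmap.
From mathcomp Require Import complex.
From mathcomp Require Import all_classical all_reals all_analysis.
From mathcomp Require Import measurable_realfun showcase.summability.
From mathcomp Require Import ring lra zify.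

Set Implicit Arguments.
Unset Strict Implicit.
Unset Printing Implicit Defensive.

Import Order.TTheory GRing.Theory Num.Theory.
Import numFieldNormedType.Exports.

Local Open Scope classical_set_scope.
Local Open Scope ring_scope.
Local Open Scope complex_scope.

(** Gauge modes prod_i (prod_(m < x_i) w_i m) e^(-2 pi i x_i (K_i + lambda_i(n)) / a_i)
    diagonalize the bundle Laplacian, with eigenvalues
    mu_K = sum_i (2 - 2 cos (2 pi (K_i + lambda_i(n)) / a_i)).  The Frullani integral
    ln x = int_0^oo (e^-t - e^(-x t)) dt / t, summed over K, gives
      log det - (prod_i a_i) c_d
        = int_0^oo ((prod_i a_i) (e^(-2t) I_0(2t))^d - sum_K e^(-t mu_K)) dt / t,
    where a e^(-2t) I_0(2t) is the mean value term of the one-dimensional heat trace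
    sum_(k < a) e^(-t (2 - 2 cos (2 pi (k + l) / a))).  After the substitution t = n^2 u
    the integrand converges pointwise to (V u^(-d/2) - Theta(u)) / u, where
    Theta(u) = sum_(K in Z^d) e^(-4 pi^2 u sum_i ((K_i + lambda_i) / alpha_i)^2).
    It is dominated by C u^(-3/2) for u >= 1, since lambda_i is not in {0, 1} for some i,
    and by C for u <= 1, since the one-dimensional heat trace and its mean value term
    differ only by the Fourier modes divisible by a, which a Chebyshev bound on the
    tail of a simple walk shows to be small.

    On the zeta side, zeta_EH is the Mellin transform of Theta divided by Gamma.
    Removing V u^(-d/2) on ]0, 1] from Theta continues the product of this identity with
    (1 - 2^-s) (s - d/2) to Re s > -1 by the identity theorem, and reading off the first
    order at 0 gives zeta_EH'(0) = - int_0^oo (V u^(-d/2) - Theta(u)) du / u.  The constant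
    V comes from the existence of lim sqrt(t) e^(-2t) I_0(2t); its value is immaterial. *)

(** * Integrals over the half-line *)

(** Three obstacles shape the details. Near u = 0 the factors of the torus heat trace may be as
    large as a negative power of u, so comparing products of d of them needs a one-dimensional error
    of order u^d. The function in the Chebyshev bound therefore grows exponentially, which beats
    every power, and its tilt x stays free until t is known. The asymptotics of I_0 come from a
    Cauchy argument: for a close to sqrt(t/u) with u small, the heat trace of the circle with a
    points is close both to a e^(-2t) I_0(2t) and to a theta value that depends on u alone. On the
    zeta side Gamma has a pole at 0; the factor 1 - 2^-s turns it into the Mellin transform of e^-u
    - e^(-2u), which is analytic at 0 with the Frullani value ln 2. The zero of 1 - 2^-s then forces
    zeta_EH(0) = 0, and its slope ln 2 cancels that value in the derivative. The continuation is
    followed along the real axis only, through its real and imaginary parts; there a real identity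
    theorem applies, and the complex derivative at 0 can be read off. *)

Section HalfLineIntegrals.
Variable R : realType.
Local Notation mu := (@lebesgue_measure R).
Local Notation pos := (`]0, +oo[%classic : set R).
Implicit Types (f g : R -> R) (b c e s t u x y : R).

Lemma continuous_powR b x : 0 < x -> u `^ b @[u --> x] --> x `^ b.
Proof.
move=> x0.
have d : derivable (fun u => u `^ b) x 1.
  by apply: derivable_powR; rewrite in_itv/= andbT.
by move: d => /derivable1_diffP/differentiable_continuous.
Qed.

Lemma integral_powR_1y b : 0 < b ->
  (\int[mu]_(u in `[1%R, +oo[) (u `^ (- b - 1))%:E = (b^-1)%:E)%E.
Proof.
move=> b0; rewrite (@ge0_continuous_FTC2y _ _ (fun u => - b^-1 * u `^ (- b)) _ 0).
- by rewrite powR1 mulr1 EFinN oppeK add0e.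
- by move=> x _; exact: powR_ge0.
- apply: (@derivable_within_continuous _ _ _ _) => x; rewrite in_itv/= andbT => x1.
  by apply: derivable_powR; rewrite in_itv/= andbT (lt_le_trans ltr01).
- rewrite -(mulr0 (- b^-1)); apply: cvgMr.
  apply: (@cvg_trans _ ((expR (- (b * ln u))) @[u --> +oo%R])).
    apply: near_eq_cvg; apply: filterS (nbhs_pinfty_gt (num_real 0)) => u u0.
    by rewrite /powR gt_eqF// mulNr.
  apply: (@cvg_comp _ _ _ (fun u => b * ln u) (fun u => expR (- u)) _ +oo%R); last exact: cvgr_expR.
  apply: gt0_cvgMry => //.
  apply/cvgryPge => A; apply: filterS (nbhs_pinfty_ge (num_real (expR A))) => u Au.
  by rewrite -[A]expRK ler_ln ?posrE ?expR_gt0// (lt_le_trans _ Au)// expR_gt0.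
- move=> x x1; apply: derivableM => //; apply: derivable_powR.
  by rewrite in_itv/= andbT (lt_trans ltr01).
- by apply/cvg_at_right_filter; apply: cvgMr; exact: continuous_powR.
- move=> x; rewrite in_itv/= andbT => x1.
  have x0 : 0 < x by exact: lt_trans x1.
  rewrite derive1E deriveZ/=; last by apply: derivable_powR; rewrite in_itv/= andbT.
  rewrite -derive1E powR_derive1 ?in_itv/= ?x0// /GRing.scale/= mulrA mulrNN mulVf ?mul1r//.
  by rewrite gt_eqF.
Qed.

Lemma integral_powR_01 b : 0 < b ->
  (\int[mu]_(u in `]0%R, 1%R]) (u `^ (b - 1))%:E = (b^-1)%:E)%E.
Proof.
move=> b0.
have mf : measurable_fun [set: R] (EFin \o (fun u => u `^ (b - 1))).
  by apply/measurable_EFinP; exact: measurable_powR.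
pose F n : set R := `[n.+2%:R^-1, 1]%classic.
have -> : `]0%R, 1%R]%classic = \bigcup_n F n.
  apply/seteqP; split => x /=; rewrite ?in_itv/=.
    move=> /andP[x0 x1]; have xV : 0 < x^-1 by rewrite invr_gt0.
    exists (Num.truncn x^-1) => //; rewrite /F/= in_itv/= x1 andbT.
    rewrite invf_ple ?posrE// ltW// (lt_trans (truncnS_gt _))//.
    by rewrite ltr_nat.
  move=> [n _]; rewrite /F/= in_itv/= => /andP[nx ->]; rewrite andbT.
  by rewrite (lt_le_trans _ nx)// invr_gt0.
have ndF : nondecreasing_seq F.
  move=> m n mn; apply/subsetPset => x; rewrite /F/= !in_itv/= => /andP[mx ->].
  by rewrite andbT (le_trans _ mx)// lef_pV2 ?posrE// ler_nat !ltnS.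
have mF n : measurable (F n) by exact: measurable_itv.
have h : (\int[mu]_(x in F n) (x `^ (b - 1))%:E @[n --> \oo] -->
    \int[mu]_(x in \bigcup_n F n) (x `^ (b - 1))%:E)%E.
  apply: ge0_nondecreasing_set_cvg_integral => //.
  - by move=> n; exact: measurable_funTS.
  - by move=> n x _; rewrite lee_fin powR_ge0.
rewrite -(cvg_lim _ h)//; apply/cvg_lim => //.
have E n : (\int[mu]_(x in F n) (x `^ (b - 1))%:E = (b^-1 - b^-1 * n.+2%:R^-1 `^ b)%:E)%E.
  rewrite (@continuous_FTC2 _ _ (fun u => b^-1 * u `^ b)).
  - by rewrite powR1 mulr1.
  - by rewrite invf_lt1// ltr1n.
  - apply: (@derivable_within_continuous _ _ _ _) => x; rewrite in_itv/= => /andP[x1 _].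
    by apply: derivable_powR; rewrite in_itv/= andbT (lt_le_trans _ x1)// invr_gt0.
  - have c x : 0 < x -> {for x, continuous (fun u => b^-1 * u `^ b)}.
      by move=> x0; apply: cvgMr; exact: continuous_powR.
    split.
    + move=> x; rewrite in_itv/= => /andP[x1 _]; apply: derivableM => //.
      by apply: derivable_powR; rewrite in_itv/= andbT (lt_trans _ x1)// invr_gt0.
    + by apply/cvg_at_right_filter; apply: c; rewrite invr_gt0.
    + by apply/cvg_at_left_filter; apply: c.
  - move=> x; rewrite in_itv/= => /andP[x1 _].
    have x0 : 0 < x by rewrite (lt_trans _ x1)// invr_gt0.
    rewrite derive1E deriveZ/=; last by apply: derivable_powR; rewrite in_itv/= andbT.
    rewrite -derive1E powR_derive1 ?in_itv/= ?x0// /GRing.scale/= mulrA mulVf ?mul1r//.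
    by rewrite gt_eqF.
rewrite (eq_cvg _ _ E); apply: cvg_EFin; first exact: nearW.
rewrite -[X in _ --> X]subr0; apply: cvgB; first exact: cvg_cst.
rewrite -(mulr0 b^-1); apply: cvgMr.
apply: (@cvg_comp _ _ _ (fun n : nat => n.+2%:R^-1 : R) (fun x => x `^ b) _ 0^'+);
  last exact: powR_cvg0.
move=> P [e /= e0 eP]; near=> n; apply: eP => /=; last by rewrite invr_gt0.
rewrite sub0r normrN ger0_norm// invf_plt ?posrE//.
near: n; exists (Num.truncn e^-1) => // n /= en.
by rewrite (lt_le_trans (truncnS_gt _))// ler_nat ltnS leqW.
Unshelve. all: by end_near. Qed.

End HalfLineIntegrals.

(** * Change of scale in integrals over the half-line *)

Section Scaling.
Variable R : realType.
Local Notation mu := (@lebesgue_measure R).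
Local Notation pos := (`]0, +oo[%classic : set R).
Implicit Types (b c e s t u x y : R).

Lemma preimage_mulr_pos c : 0 < c -> ( *%R c) @^-1` pos = pos.
Proof.
by move=> c0; apply/seteqP; split => x /=; rewrite !in_itv/= !andbT pmulr_rgt0.
Qed.

Lemma measurable_mulr c : measurable_fun [set: R] ( *%R c).
Proof. exact: measurable_funM. Qed.

(** By uniqueness of the Lebesgue measure: c times the image measure has the right value on
    half-open intervals. *)
Lemma lebesgue_measure_scale c (A : set R) : 0 < c -> measurable A ->
  mu A = (c%:E * mu (( *%R c) @^-1` A))%E.
Proof.
move=> c0; set f : measurableTypeR R -> measurableTypeR R := *%R c.
have mf : measurable_fun setT f by exact: measurable_mulr.
pose m0 : {measure set (measurableTypeR R) -> \bar R} := pushforward mu f.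
pose m := mscale (NngNum (ltW c0)) (m0 mf).
apply: (@lebesgue_measure_unique R m) => X.
move=> -[[a b] ab <-].
have -> : (mu `]a, b]%classic = c%:E * mu (f @^-1` `]a, b]%classic))%E; last by [].
have -> : f @^-1` `]a, b] = `]c^-1 * a, c^-1 * b]%classic.
  apply/seteqP; split => x /=; rewrite /f !in_itv/= ![c^-1 * _]mulrC.
    by rewrite ltr_pdivrMr// ler_pdivlMr// ![x * _]mulrC.
  by rewrite ltr_pdivrMr// ler_pdivlMr// ![x * _]mulrC.
rewrite !lebesgue_measure_itv/= !lte_fin ltr_pM2l ?invr_gt0//.
case: ifPn => _; last by rewrite mule0.
by rewrite -!EFinD -EFinM mulrBr !mulVKf// gt_eqF.
Qed.

Lemma ge0_integral_scale c (f : R -> \bar R) : 0 < c ->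
  measurable_fun pos f -> (forall u, 0 < u -> (0 <= f u)%E) ->
  (\int[mu]_(u in pos) f (c * u)%R = (c^-1)%:E * \int[mu]_(u in pos) f u)%E.
Proof.
move=> c0 mf f0.
have mc : measurable_fun setT ( *%R c : measurableTypeR R -> measurableTypeR R).
  exact: measurable_mulr.
rewrite -[in LHS](preimage_mulr_pos c0).
have -> : (\int[mu]_(u in ( *%R c) @^-1` pos) f (c * u)%R =
    \int[mu]_(u in ( *%R c : measurableTypeR R -> measurableTypeR R) @^-1` pos) (f \o *%R c) u)%E.
  by [].
rewrite -ge0_integral_pushforward//; last first.
  by move=> x; rewrite inE/= in_itv/= andbT => /f0.
have ciV : 0 <= c^-1 by rewrite invr_ge0 ltW.
pose m := mscale (NngNum ciV) mu.
rewrite (@eq_measure_integral _ _ _ _ m); last first.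
  move=> A mA _; have h := lebesgue_measure_scale c0 mA.
  transitivity ((c^-1)%:E * mu A)%E; last by [].
  by rewrite h muleA -EFinM mulVf ?gt_eqF// mul1e.
by rewrite ge0_integral_mscale// => x; rewrite /= in_itv/= andbT => /f0.
Qed.

Lemma integrable_scale c (f : R -> \bar R) : 0 < c ->
  mu.-integrable pos f -> mu.-integrable pos (fun u => f (c * u)).
Proof.
move=> c0 /integrableP[mf fi]; apply/integrableP; split.
  apply: (@measurable_comp _ _ _ _ _ _ pos) => //.
    by move=> _ /= [u + <-]; rewrite !in_itv/= !andbT pmulr_rgt0.
rewrite (@ge0_integral_scale c (fun u => `|f u|%E))//.
  by rewrite lte_mul_pinfty// ?lee_fin ?invr_ge0 ?ltW.
exact: measurableT_comp.
Qed.

Lemma Rintegral_scale c (f : R -> R) : 0 < c ->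
  mu.-integrable pos (EFin \o f) ->
  \int[mu]_(u in pos) f (c * u) = c^-1 * \int[mu]_(u in pos) f u.
Proof.
move=> c0 fi; rewrite /Rintegral.
have ci : (c^-1%:E \is a fin_num)%E by [].
rewrite -[c^-1]/(fine c^-1%:E) -fineM//; last exact: integrable_fin_num.
congr fine; rewrite integralE [in RHS]integralE.
have mf := measurable_int _ fi.
rewrite muleBr//; last exact: integrable_add_def.
rewrite -!ge0_integral_scale//; [|exact: measurable_funeneg|exact: measurable_funepos].
congr (_ - _)%E; apply: eq_integral => u _.
  by rewrite !unlock.
by rewrite !unlock.
Qed.

End Scaling.

(** * The Frullani integral *)

Section Frullani.
Variable R : realType.
Local Notation mu := (@lebesgue_measure R).
Local Notation pos := (`]0, +oo[%classic : set R).
Implicit Types (b c e s t u x y : R).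

Lemma measurable_expRM c : measurable_fun [set: R] (fun t => expR (c * t)).
Proof. by apply: measurableT_comp => //; exact: measurable_funM. Qed.

Lemma continuous_expRM c : continuous (fun t : R => expR (c * t)).
Proof.
move=> t; apply: (@continuous_comp _ _ _ ( *%R c) (@expR R)).
  exact: mulrl_continuous.
exact: continuous_expR.
Qed.

Lemma is_derive_expRM c x :
  is_derive x 1 (fun y : R => expR (c * y)) (c * expR (c * x)).
Proof.
have h : derivable ( *%R c : R -> R) x 1.
  by apply: derivableM; [exact: derivable_cst|exact: derivable_id].
apply: DeriveDef.
  apply/derivable1_diffP; apply: (@differentiable_comp _ _ _ _ ( *%R c) (@expR R)).
    by apply/derivable1_diffP.
  by apply/derivable1_diffP; exact: derivable_expR.
rewrite -derive1E (@derive1_comp _ ( *%R c) (@expR R) _ h (@derivable_expR R (c * x))).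
rewrite (_ : (@expR R)^`()%classic = @expR R); last first.
  by apply/funext => y; rewrite derive1E derive_val.
have hc : (fun y : R => c * id y)^`()%classic x = c.
  rewrite derive1Ml; last exact: derivable_id.
  by rewrite derive1_id mulr1.
by rewrite mulrC; congr (_ * _); exact: hc.
Qed.

Lemma integral_expR_pos y : 0 < y ->
  (\int[mu]_(t in pos) (expR (- y * t))%:E = (y^-1)%:E)%E.
Proof.
move=> y0; rewrite integral_itv_obnd_cbnd; last first.
  by apply/measurable_EFinP/measurable_funTS; exact: measurable_expRM.
rewrite (@ge0_continuous_FTC2y _ _ (fun t => - y^-1 * expR (- y * t)) _ 0).
- by rewrite mulr0 expR0 mulr1 EFinN oppeK add0e.
- by move=> t _; exact: expR_ge0.
- by apply: continuous_subspaceT; exact: continuous_expRM.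
- rewrite -(mulr0 (- y^-1)); apply: cvgMr.
  rewrite [X in X @ _ --> _](_ : _ = (fun t => expR (- (y * t)))); last first.
    by apply/funext => t; rewrite mulNr.
  apply: (@cvg_comp _ _ _ ( *%R y) (fun u => expR (- u)) _ +oo%R); last exact: cvgr_expR.
  exact: gt0_cvgMry.
- move=> t _; apply: derivableM; first exact: derivable_cst.
  by have [] := is_derive_expRM (- y) t.
- apply/cvg_at_right_filter; apply: cvgMr; exact: continuous_expRM.
- move=> t _; have [? dv] := is_derive_expRM (- y) t.
  rewrite derive1E deriveZ//= dv /GRing.scale/= mulrA mulrNN mulVf ?mul1r//.
  by rewrite gt_eqF.
Qed.

(** Tonelli for e^(-y t) on t > 0, 1 <= y <= x: integrating in y first gives the Frullani integrand,
    integrating in t first gives 1/y. *)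
Lemma frullani_gt1 x : 1 < x ->
  (\int[mu]_(t in pos) ((expR (- t) - expR (- x * t)) / t)%:E = (ln x)%:E)%E.
Proof.
move=> x1.
pose F (z : measurableTypeR R * measurableTypeR R) : \bar R :=
  (expR (- (z.2 * z.1)) * \1_pos z.1 * \1_(`[1, x]%classic : set R) z.2)%:E.
have F0 z : (0 <= F z)%E by rewrite lee_fin !mulr_ge0 ?expR_ge0.
have m1 : measurable_fun setT (fst : measurableTypeR R * measurableTypeR R -> measurableTypeR R).
  exact: measurable_fst.
have m2 : measurable_fun setT (snd : measurableTypeR R * measurableTypeR R -> measurableTypeR R).
  exact: measurable_snd.
have mF : measurable_fun setT F.
  apply/measurable_EFinP; apply: measurable_funM.
    apply: measurable_funM; last first.
      apply: (@measurableT_comp _ _ _ _ _ _ (\1_pos : measurableTypeR R -> R) _ fst) => //.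
    apply: measurableT_comp; first exact: measurable_expR.
    by apply: measurableT_comp => //; exact: measurable_funM.
  apply: (@measurableT_comp _ _ _ _ _ _ (\1_(`[1, x]%classic) : measurableTypeR R -> R) _ snd) => //.
have := @fubini_tonelli _ _ _ _ _ mu mu F mF F0.
rewrite [X in X = _ -> _](_ : _ =
  (\int[mu]_(t in pos) ((expR (- t) - expR (- x * t)) / t)%:E)%E); last first.
  rewrite [in RHS]integral_mkcond; apply: eq_integral => t _.
  rewrite epatch_indic /F/=.
  have [t0|t0] := boolP (t \in pos); last first.
    rewrite indicE (negbTE t0) mule0.
    by apply: integral0_eq => y _; rewrite mulr0 mul0r.
  rewrite indicE t0 mule1.
  under eq_integral do rewrite mulr1.
  have tp : 0 < t by move: t0; rewrite inE/= in_itv/= andbT.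
  transitivity (\int[mu]_(y in `[1%R, x]) (expR (- t * y))%:E)%E.
    rewrite [in RHS]integral_mkcond; apply: eq_integral => y _.
    by rewrite epatch_indic/= EFinM mulNr mulrC.
  rewrite (@continuous_FTC2 _ _ (fun y => - t^-1 * expR (- t * y))) //.
  - rewrite -EFinB; congr EFin; rewrite mulr1 (_ : - x * t = - t * x); last by ring.
    by field; rewrite gt_eqF.
  - by apply: continuous_subspaceT; exact: continuous_expRM.
  - split.
    + move=> y _; apply: derivableM; first exact: derivable_cst. by have [] := is_derive_expRM (- t) y.
    + by apply/cvg_at_right_filter; apply: cvgMr; exact: continuous_expRM.
    + by apply/cvg_at_left_filter; apply: cvgMr; exact: continuous_expRM.
  - move=> y _; have [? dv] := is_derive_expRM (- t) y.
    rewrite derive1E deriveZ//= dv /GRing.scale/= mulrA mulrNN mulVf ?mul1r//.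
    by rewrite gt_eqF.
move=> ->.
transitivity (\int[mu]_(y in `[1%R, x]) (y^-1)%:E)%E.
  rewrite [in RHS]integral_mkcond; apply: eq_integral => y _.
  rewrite epatch_indic /F/=.
  have [y0|y0] := boolP (y \in `[1, x]%classic); last first.
    rewrite indicE (negbTE y0) mule0.
    by apply: integral0_eq => t _; rewrite mulr0.
  rewrite indicE y0 mule1.
  under eq_integral do rewrite mulr1.
  have yp : 0 < y.
    by move: y0; rewrite inE/= in_itv/= => /andP[/(lt_le_trans _)-> ].
  rewrite -(integral_expR_pos yp) [in RHS]integral_mkcond; apply: eq_integral => t _.
  by rewrite epatch_indic/= EFinM mulNr.
rewrite (@continuous_FTC2 _ _ (@ln R)) //.
- by rewrite ln1 sube0.
- apply: continuous_in_subspaceT => y; rewrite inE/= in_itv/= => /andP[y1 _].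
  by apply: inv_continuous; rewrite gt_eqF// (lt_le_trans _ y1).
- split.
  + move=> y; rewrite in_itv/= => /andP[y1 _].
    by apply: ex_derive; apply: is_derive1_ln; exact: lt_trans y1.
  + by apply/cvg_at_right_filter/continuous_ln.
  + by apply/cvg_at_left_filter/continuous_ln; exact: lt_trans x1.
- move=> y; rewrite in_itv/= => /andP[y1 _]; rewrite derive1E.
  by have [] := is_derive1_ln (lt_trans ltr01 y1).
Qed.

End Frullani.

(** * Analytic functions *)

Section PowerSeriesTail.
Variable K : numFieldType.
Implicit Types (c : nat -> K) (h l : K).

Lemma pseries_terms_bounded c h l :
  (series (fun k => c k * h ^+ k) : nat -> K^o) @ \oo --> (l : K^o) ->
  exists2 B : K, 0 <= B & forall k, `|c k| * `|h| ^+ k <= B.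
Proof.
move=> cl.
have /cvgrPdist_lt/(_ 1 ltr01)[N _ NP] :
    ((fun k => c k * h ^+ k) : nat -> K^o) @ \oo --> (0 : K^o).
  have := cl; rewrite -cvg_shiftS => cl1.
  rewrite -(subrr l) (_ : (fun k => _) = (fun n => series (fun k => c k * h ^+ k) n.+1
      - series (fun k => c k * h ^+ k) n)); first exact: cvgB.
  apply/funext => k; rewrite !seriesEord/= big_ord_recr/=.
  by rewrite addrAC subrr add0r.
exists (1 + \sum_(k < N) `|c k * h ^+ k|).
  by rewrite addr_ge0 ?ler01// sumr_ge0.
move=> k; rewrite -normrX -normrM; have [Nk|kN] := leqP N k.
  have := NP k Nk; rewrite sub0r normrN => /ltW/le_trans; apply.
  by rewrite lerDl sumr_ge0.
rewrite (bigD1 (Ordinal kN))//= addrA addrAC lerDr addr_ge0 ?ler01//.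
by rewrite sumr_ge0.
Qed.

Lemma geometric_partial_le (q : K) m n : 0 <= q -> q <= 2^-1 ->
  \sum_(m <= k < n) q ^+ k <= 2 * q ^+ m.
Proof.
move=> q0 q2; have [nm|mn] := leqP n m.
  by rewrite big_geq// mulr_ge0// exprn_ge0.
suff H : \sum_(m <= k < n) q ^+ k <= 2 * q ^+ m - 2 * q ^+ n.
  by rewrite (le_trans H)// gerBl mulr_ge0// exprn_ge0.
rewrite -(subnKC (ltnW mn)); elim: (n - m)%N => [|j IH].
  by rewrite addn0 big_geq// subrr.
rewrite addnS big_nat_recr ?leq_addr//=; apply: le_trans (lerD IH (lexx _)) _.
rewrite -addrA lerD2l exprS -lerBrDl opprK -subr_ge0.
rewrite (_ : _ - _ = q ^+ (m + j) * (1 - 2 * q)); last by ring.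
by rewrite mulr_ge0 ?exprn_ge0// subr_ge0 -ler_pdivlMl// mulr1.
Qed.

(** Comparison with a geometric series of ratio |h| / rho <= 1/2, whose tails are at most twice
    their first term. *)
Lemma pseries_tail c (rho B : K) h l m : 0 < rho ->
  (forall k, `|c k| * rho ^+ k <= B) -> `|h| <= rho / 2 ->
  (series (fun k => c k * h ^+ k) : nat -> K^o) @ \oo --> (l : K^o) ->
  `|l - \sum_(k < m) c k * h ^+ k| <= 2 * B * (`|h| / rho) ^+ m.
Proof.
move=> rho0 cB hr cl.
have q2 : `|h| / rho <= 2^-1 by rewrite ler_pdivrMr// mulrC.
have q0 : 0 <= `|h| / rho by rewrite divr_ge0// ltW.
have B0 : 0 <= B by rewrite (le_trans _ (cB 0%N))// expr0 mulr1.
apply/ler_addgt0Pr => e e0.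
have /cvgrPdist_lt/(_ e e0)[N _ NP] := cl.
pose n := maxn N m.
have /ltW ln := NP n (leq_maxl _ _).
rewrite -(subrK (series (fun k => c k * h ^+ k) n) l) -addrA addrC.
apply: le_trans (ler_normD _ _) _; apply: lerD => //.
rewrite seriesEnat/= -(big_mkord xpredT (fun k => c k * h ^+ k)).
rewrite (big_cat_nat (n := m))//= ?leq_maxr// addrAC subrr add0r.
apply: le_trans (ler_norm_sum _ _ _) _.
apply: (@le_trans _ _ (\sum_(m <= k < n) B * (`|h| / rho) ^+ k)).
  apply: ler_sum => k _; rewrite normrM normrX expr_div_n mulrA.
  rewrite ler_pdivlMr ?exprn_gt0// mulrAC ler_wpM2r ?exprn_ge0//.
rewrite -mulr_sumr -mulrA [2 * _]mulrC -mulrA ler_wpM2l//.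
by rewrite mulrC geometric_partial_le.
Qed.

End PowerSeriesTail.

(** * Real-analytic functions and the identity theorem *)

Section RealAnalytic.
Variable R : realType.
Implicit Types (f g : R -> R) (s h r : R).

Definition real_analytic_at f s := exists2 r : R, 0 < r & exists c : nat -> R,
  forall h, `|h| < r -> series (fun k => c k * h ^+ k) @ \oo --> f (s + h).

Lemma near_real_analytic_at f g s : {near s, f =1 g} ->
  real_analytic_at f s -> real_analytic_at g s.
Proof.
move=> /nbhs_ballP[e /= e0 fg] [r r0 [c fc]].
exists (Num.min r e); first by rewrite lt_min r0.
exists c => h; rewrite lt_min => /andP[hr he]; rewrite -fg; first exact: fc.
by rewrite /ball/= opprD addNKr normrN.
Qed.

Lemma real_analytic_cst a s : real_analytic_at (fun=> a) s.
Proof.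
exists 1 => //; exists (fun k => if k == 0%N then a else 0) => h _.
apply: cvg_near_cst; exists 1%N => // -[//|n] _ /=.
rewrite seriesEord/= big_ord_recl/= expr0 mulr1 big1 ?addr0// => i _.
by rewrite mul0r.
Qed.

Lemma real_analytic_id s : real_analytic_at id s.
Proof.
exists 1 => //; exists (fun k => if k == 0%N then s else if k == 1%N then 1 else 0) => h _.
apply: cvg_near_cst; exists 2%N => // -[|[|n]]// _ /=.
rewrite seriesEord/= 2!big_ord_recl/= expr0 mulr1 mul1r expr1 big1 ?addr0// => i _.
by rewrite mul0r.
Qed.

Lemma real_analyticD f g s : real_analytic_at f s -> real_analytic_at g s ->
  real_analytic_at (fun x => f x + g x) s.
Proof.
move=> [r r0 [c fc]] [q q0 [e ge]].
exists (Num.min r q); first by rewrite lt_min r0.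
exists (fun k => c k + e k) => h; rewrite lt_min => /andP[hr hq].
rewrite (_ : series _ = series (fun k => c k * h ^+ k) \+ series (fun k => e k * h ^+ k)).
  by apply: cvgD; [exact: fc|exact: ge].
by apply/funext => n; rewrite !seriesEord/= -big_split/=; apply: eq_bigr => k _; rewrite mulrDl.
Qed.

Lemma cauchy_product_remainder (a b : nat -> R) n :
  (\sum_(i < n) a i) * (\sum_(j < n) b j) -
    \sum_(m < n) \sum_(i < m.+1) a i * b (m - i)%N =
  \sum_(i < n) a i * \sum_(n - i <= j < n) b j.
Proof.
have -> : \sum_(m < n) \sum_(i < m.+1) a i * b (m - i)%N =
    \sum_(i < n) a i * \sum_(0 <= j < n - i) b j.
  transitivity (\sum_(m < n) \sum_(i < n | (i <= m)%N) a i * b (m - i)%N).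
    apply: eq_bigr => m _.
    by rewrite (big_ord_widen _ (fun i => a i * b (m - i)%N) (ltn_ord m)).
  rewrite (exchange_big_dep xpredT)//=; apply: eq_bigr => i _.
  rewrite mulr_sumr -(big_mkord (fun m => (i <= m)%N) (fun m => a i * b (m - i)%N)).
  transitivity (\sum_(i <= m < n) a i * b (m - i)%N).
    by rewrite [RHS](big_nat_widenl _ 0%N).
  rewrite -{1}(add0n (nat_of_ord i)) big_addn.
  by apply: eq_bigr => j _; rewrite addnK.
rewrite mulr_suml -sumrB; apply: eq_bigr => i _; rewrite -mulrBr; congr (_ * _).
by rewrite -(big_mkord xpredT b) (big_cat_nat (n := (n - i)%N))//= ?leq_subr// addrAC subrr add0r.
Qed.

(** The remainder only involves pairs of indices with i + j >= n. Of the two factors p^k in the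
    hypotheses, one makes these pairs as small as p^n and the other one sums to 1/(1 - p). *)
Lemma cauchy_product (a b : nat -> R) (B p la lb : R) : 0 <= p < 1 ->
  (forall k, `|a k| <= B * (p ^+ k) ^+ 2) -> (forall k, `|b k| <= B * (p ^+ k) ^+ 2) ->
  series a @ \oo --> la -> series b @ \oo --> lb ->
  series (fun m => \sum_(i < m.+1) a i * b (m - i)%N) @ \oo --> la * lb.
Proof.
move=> /andP[p0 p1] aB bB ala blb.
have B0 : 0 <= B by have := aB 0%N; rewrite expr0 expr1n mulr1; apply: le_trans.
have geo m n : \sum_(m <= k < n) p ^+ k <= p ^+ m / (1 - p).
  have [nm|mn] := leqP n m.
    by rewrite big_geq// divr_ge0 ?exprn_ge0// subr_ge0 ltW.
  rewrite ler_pdivlMr ?subr_gt0//.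
  suff -> : (\sum_(m <= k < n) p ^+ k) * (1 - p) = p ^+ m - p ^+ n.
    by rewrite gerBl exprn_ge0.
  rewrite -(subnKC (ltnW mn)); elim: (n - m)%N => [|j IH].
    by rewrite addn0 big_geq// mul0r subrr.
  rewrite addnS big_nat_recr ?leq_addr//= mulrDl IH exprS; ring.
rewrite (_ : series _ = (series a * series b) -
   (fun n => \sum_(i < n) a i * \sum_(n - i <= j < n) b j)); last first.
  by apply/funext => n; rewrite !fctE -cauchy_product_remainder !seriesEord/= opprB subrKC.
rewrite -[X in _ --> X]subr0; apply: cvgB; first exact: cvgM.
apply: (@squeeze_cvgr _ _ _ _ (fun n => - (B ^+ 2 / (1 - p) ^+ 2 * p ^+ n))
  (fun n => B ^+ 2 / (1 - p) ^+ 2 * p ^+ n)).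
- apply: nearW => n; rewrite -ler_norml; apply: le_trans (ler_norm_sum _ _ _) _.
  apply: (@le_trans _ _ (\sum_(i < n) B ^+ 2 / (1 - p) * p ^+ n * p ^+ i)).
    apply: ler_sum => i _; rewrite normrM.
    apply: (@le_trans _ _ (B * (p ^+ i) ^+ 2 * (B * p ^+ (n - i) * ((1 - p)^-1)))).
      apply: ler_pM => //; apply: le_trans (ler_norm_sum _ _ _) _.
      apply: (@le_trans _ _ (\sum_(n - i <= j < n) B * p ^+ (n - i) * p ^+ j)).
        rewrite !big_nat; apply: ler_sum => j /andP[jn _].
        apply: le_trans (bB j) _; rewrite -mulrA ler_wpM2l// expr2 ler_wpM2r ?exprn_ge0//.
        by rewrite ler_wiXn2l// ltW.
      rewrite -mulr_sumr ler_wpM2l ?mulr_ge0 ?exprn_ge0//.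
      apply: le_trans (geo _ _) _; rewrite ler_pdivrMr ?subr_gt0// mulVf ?exprn_ile1//.
        by rewrite ltW.
      by rewrite gt_eqF// subr_gt0.
    rewrite -{4}(subnK (ltnW (ltn_ord i))) exprD.
    by rewrite le_eqVlt; apply/orP; left; apply/eqP; ring.
  rewrite -mulr_sumr -(big_mkord xpredT (fun i => p ^+ i)).
  apply: le_trans (ler_wpM2l _ (geo _ _)) _.
    by rewrite !mulr_ge0 ?exprn_ge0// invr_ge0 subr_ge0 ltW.
  rewrite expr0 le_eqVlt; apply/orP; left; apply/eqP; field.
  by rewrite gt_eqF// subr_gt0.
- rewrite -oppr0; apply: cvgN; rewrite -(mulr0 (B ^+ 2 / (1 - p) ^+ 2)).
  by apply: cvgMr; apply: cvg_expr; rewrite ger0_norm.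
- rewrite -(mulr0 (B ^+ 2 / (1 - p) ^+ 2)).
  by apply: cvgMr; apply: cvg_expr; rewrite ger0_norm.
Qed.

Lemma real_analyticM f g s : real_analytic_at f s -> real_analytic_at g s ->
  real_analytic_at (fun x => f x * g x) s.
Proof.
move=> [r r0 [c fc]] [q q0 [e ge]].
exists (Num.min r q); first by rewrite lt_min r0.
exists (fun m => \sum_(i < m.+1) c i * e (m - i)%N) => h hrq.
rewrite (_ : (fun k => _) = (fun m => \sum_(i < m.+1) (c i * h ^+ i) * (e (m - i)%N * h ^+ (m - i)))); last first.
  apply/funext => m; rewrite mulr_suml; apply: eq_bigr => i _.
  have -> : h ^+ m = h ^+ i * h ^+ (m - i) by rewrite -exprD subnKC// -ltnS.
  ring.
(* A radius strictly between |h| and the radius of convergence: the coefficients are controlled at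
   [rho], which leaves the ratio |h| / rho < 1 for convergence at h. *)
pose rho : R := (`|h| + Num.min r q) / 2.
have hrho : `|h| < rho by rewrite midf_lt.
have rho0 : 0 < rho by exact: le_lt_trans hrho.
have /andP[rr rq] : (rho < r) && (rho < q) by rewrite -lt_min midf_lt.
have nrho : `|rho| = rho by rewrite gtr0_norm.
have [B1 B10 cB] : exists2 B, 0 <= B & forall k, `|c k| * `|rho| ^+ k <= B.
  by apply: (@pseries_terms_bounded R _ _ (f (s + rho))); apply: fc; rewrite nrho.
have [B2 B20 eB] : exists2 B, 0 <= B & forall k, `|e k| * `|rho| ^+ k <= B.
  by apply: (@pseries_terms_bounded R _ _ (g (s + rho))); apply: ge; rewrite nrho.
rewrite nrho in cB eB.
(* The square root splits (|h| / rho)^k into the two factors p^k that [cauchy_product] asks for. *)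
pose p : R := Num.sqrt (`|h| / rho).
have hp k : `|h| ^+ k = rho ^+ k * (p ^+ k) ^+ 2.
  rewrite exprAC sqr_sqrtr; last by rewrite divr_ge0// ltW.
  by rewrite -exprMn mulrC divfK ?gt_eqF.
move: hrq; rewrite lt_min => /andP[hr hq].
apply: (@cauchy_product (fun i => c i * h ^+ i) (fun j => e j * h ^+ j) (B1 + B2) p).
- rewrite sqrtr_ge0/= -[ltRHS]sqrtr1 ltr_sqrt// ltr_pdivrMr ?mul1r//.
- move=> k; rewrite normrM normrX hp mulrA ler_wpM2r ?sqr_ge0//.
  by rewrite (le_trans (cB k))// lerDl.
- move=> k; rewrite normrM normrX hp mulrA ler_wpM2r ?sqr_ge0//.
  by rewrite (le_trans (eB k))// lerDr.
- exact: fc.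
- exact: ge.
Qed.

Lemma real_analytic_near f s : real_analytic_at f s ->
  exists c : nat -> R, [/\ f s = c 0%N & forall m, exists C, exists2 r, 0 < r & forall h, `|h| < r ->
    `|f (s + h) - \sum_(k < m) c k * h ^+ k| <= C * `|h| ^+ m].
Proof.
move=> [r r0 [c fc]].
have rr : `|r / 2| < r by rewrite gtr0_norm ?divr_gt0// ltr_pdivrMr// ltr_pMr// ltr1n.
have [B B0 cB] := @pseries_terms_bounded R _ _ _ (fc _ rr).
have tail m h : `|h| < r / 2 / 2 -> `|f (s + h) - \sum_(k < m) c k * h ^+ k| <= (2 * B / (r / 2) ^+ m) * `|h| ^+ m.
  move=> hr; rewrite mulrAC -mulrA -expr_div_n.
  apply: pseries_tail; rewrite ?divr_gt0//.
  - by move=> k; have := cB k; rewrite [X in _ * X ^+ _]gtr0_norm// divr_gt0.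
  - exact: ltW.
  - apply: fc; apply: lt_trans hr _; lra.
exists c; split.
  have := tail 1%N 0; rewrite normr0 divr_gt0 ?divr_gt0// => /(_ isT).
  rewrite big_ord1 expr0 mulr1 expr1 mulr0 addr0 normr_le0 subr_eq0.
  by move=> /eqP.
by move=> m; exists (2 * B / (r / 2) ^+ m), (r / 2 / 2); rewrite ?divr_gt0//; exact: tail.
Qed.

Lemma real_analytic_continuous f s : real_analytic_at f s -> {for s, continuous f}.
Proof.
move=> /real_analytic_near[c [fs /(_ 1%N)[C [r r0 fC]]]].
apply/cvgrPdist_le => /= e e0.
have C0 : 0 < `|C| + 1 by rewrite ltr_pwDr.
near=> x; rewrite distrC.
have xr : `|x - s| < r by near: x; apply: cvgr_distC_lt.
have := fC _ xr; rewrite subrKC big_ord1 expr0 mulr1 expr1 -fs => /le_trans; apply.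
apply: (@le_trans _ _ ((`|C| + 1) * `|x - s|)).
  by rewrite ler_wpM2r// (le_trans (ler_norm _))// lerDl.
rewrite -ler_pdivlMl//; near: x; apply: cvgr_distC_le => //.
by rewrite mulr_gt0 ?invr_gt0.
Unshelve. all: by end_near. Qed.

(** By strong induction: once the lower coefficients vanish, dividing the tail bound by h^k leaves
    |c k| <= M h for all small h > 0. Only positive h are assumed, to match the one-sided
    information available in [real_analytic_identity]. *)
Lemma pseries_eq0 (c : nat -> R) r : 0 < r ->
  (forall h, 0 < h < r -> series (fun k => c k * h ^+ k) @ \oo --> (0 : R)) ->
  forall k, c k = 0.
Proof.
move=> r0 c0; have rr : 0 < r / 2 < r.
  by rewrite divr_gt0//= ltr_pdivrMr// ltr_pMr// ltr1n.
have [B B0 cB] := @pseries_terms_bounded R _ _ _ (c0 _ rr).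
have [rho0 _] := andP rr.
rewrite [X in forall k, _ * X ^+ _ <= _]gtr0_norm// in cB.
elim/ltn_ind => k IH; apply/eqP; rewrite -normr_le0; apply/ler_addgt0Pr => e e0.
rewrite add0r.
pose M := 2 * B / (r / 2) ^+ k.+1 + 1.
have M0 : 0 < M by rewrite ltr_wpDl// divr_ge0 ?mulr_ge0// exprn_ge0// ltW.
pose h := Num.min (r / 2 / 2) (e / M).
have h0 : 0 < h by rewrite lt_min !divr_gt0.
have hr : h <= r / 2 / 2 by rewrite ge_min lexx.
have : `|0 - \sum_(i < k.+1) c i * h ^+ i| <= 2 * B * (`|h| / (r / 2)) ^+ k.+1.
  apply: pseries_tail => //; first by rewrite gtr0_norm.
  by apply: c0; rewrite h0/=; lra.
rewrite sub0r normrN big_ord_recr/= big1 ?add0r; last first.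
  by move=> i _; rewrite IH ?mul0r.
rewrite normrM normrX (gtr0_norm h0).
have -> : 2 * B * (h / (r / 2)) ^+ k.+1 = (2 * B / (r / 2) ^+ k.+1 * h) * h ^+ k.
  by rewrite expr_div_n [h ^+ k.+1]exprS; ring.
rewrite ler_pM2r ?exprn_gt0// => /le_trans; apply.
apply: (@le_trans _ _ (M * h)); first by rewrite ler_wpM2r ?lerDl// ltW.
by rewrite -ler_pdivlMl// mulrC ge_min lexx orbT.
Qed.

(** At the supremum of the points where f does not vanish, f is zero on the right, hence so are all
    its coefficients there, and then f is zero on the left as well, where that supremum is
    approached. *)
Lemma real_analytic_identity f p b : (forall s, p < s -> real_analytic_at f s) ->
  (forall s, b < s -> f s = 0) -> forall s, p < s -> f s = 0.
Proof.
move=> fa fb s1 ps1; apply/eqP/negPn/negP => fs1.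
pose S := [set s | p < s /\ f s != 0].
have Sub s : S s -> s <= b.
  by move=> [_ fs]; rewrite leNgt; apply/negP => /fb f0; rewrite f0 eqxx in fs.
have S0 : S s1 by [].
have hS : has_sup S by split; [exists s1|exists b => s /Sub].
have s1T : s1 <= sup S by exact: ub_le_sup hS.2 _ S0.
have pT : p < sup S by exact: lt_le_trans s1T.
have fT s : sup S < s -> f s = 0.
  move=> Ts; apply/eqP/negPn/negP => fs.
  have : s <= sup S by apply: (ub_le_sup hS.2); split => //; exact: lt_trans Ts.
  by rewrite leNgt Ts.
have [r r0 [c fc]] := fa _ pT.
have c0 : forall k, c k = 0.
  apply: (pseries_eq0 r0) => h /andP[h0 hr].
  by rewrite -(fT (sup S + h)) ?ltrDl//; apply: fc; rewrite gtr0_norm.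
have [s [ps fs] rs] := sup_adherent r0 hS.
have sT : s <= sup S by exact: (ub_le_sup hS.2).
have : series (fun k => c k * (s - sup S) ^+ k) @ \oo --> f (sup S + (s - sup S)).
  by apply: fc; rewrite ler0_norm ?subr_le0// opprB ltrBlDr -ltrBlDl.
rewrite subrKC (_ : series _ = fun=> 0); last first.
  by apply/funext => n; rewrite seriesEord/= big1// => k _; rewrite c0 mul0r.
move=> /cvg_lim; rewrite lim_cst// => /(_ (@Rhausdorff R))/esym/eqP.
exact/negP.
Qed.

End RealAnalytic.

(** * Complex analytic functions along the real axis *)

Section ComplexAnalytic.
Variable R : realType.
Implicit Types (z w : R[i]) (s h r : R).

Lemma normc_Re_le z : `|complex.Re z|%:C <= `|z|.
Proof. exact: normc_ge_Re. Qed.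

Lemma normc_Im_le z : `|complex.Im z|%:C <= `|z|.
Proof.
by rewrite normc_def lecR -sqrtr_sqr ler_sqrt ?addr_ge0 ?sqr_ge0// lerDr sqr_ge0.
Qed.

Lemma normc_real (r : R) : `|r%:C| = `|r|%:C :> R[i].
Proof. by rewrite normc_def/= expr0n/= addr0 sqrtr_sqr. Qed.

Lemma cvg_Re (u : nat -> R[i]) (l : R[i]) :
  (u : nat -> R[i]^o) @ \oo --> (l : R[i]^o) ->
  (fun n => complex.Re (u n)) @ \oo --> complex.Re l.
Proof.
move=> ul; apply/cvgrPdist_lt => e e0.
have eC : 0 < e%:C :> R[i] by rewrite ltcR.
have /cvgrPdist_lt/(_ _ eC) := ul; apply: filterS => n.
by move=> /(le_lt_trans (normc_Re_le _)); rewrite ltcR raddfB.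
Qed.

Lemma cvg_Im (u : nat -> R[i]) (l : R[i]) :
  (u : nat -> R[i]^o) @ \oo --> (l : R[i]^o) ->
  (fun n => complex.Im (u n)) @ \oo --> complex.Im l.
Proof.
move=> ul; apply/cvgrPdist_lt => e e0.
have eC : 0 < e%:C :> R[i] by rewrite ltcR.
have /cvgrPdist_lt/(_ _ eC) := ul; apply: filterS => n.
by move=> /(le_lt_trans (normc_Im_le _)); rewrite ltcR raddfB.
Qed.

Lemma cvg_real_complex (T : Type) (F : set_system T) {FF : Filter F} (u : T -> R) (l : R) :
  u @ F --> l -> ((fun n => (u n)%:C) : T -> R[i]^o) @ F --> (l%:C : R[i]^o).
Proof.
move=> ul; apply/cvgrPdist_lt => e; rewrite ltcE/= => /andP[/eqP eI e0].
have /cvgrPdist_lt/(_ _ e0) := ul; apply: filterS => n.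
rewrite -rmorphB/= normc_real => h.
by rewrite ltcE/= eI eqxx.
Qed.

(** Balls of R[i] have their radius in R[i]; a positive one has zero imaginary part, which yields a
    radius in R. *)
Lemma near_complex (P : set R[i]) z : (\forall w \near (z : R[i]^o), P w) ->
  exists2 r, 0 < r & forall w, `|w - z| < r%:C -> P w.
Proof.
move=> /nbhs_ballP[e /=]; rewrite ltcE/= => /andP[/eqP eI e0] eP.
exists (complex.Re e) => // w wz; apply: eP.
rewrite -ball_normE/= distrC; apply: lt_le_trans wz _.
by rewrite lecE/= eI eqxx/=.
Qed.

Lemma analytic_at_Re (Z : R[i]^o -> R[i]^o) s : analytic_at Z s%:C ->
  real_analytic_at (fun x => complex.Re (Z x%:C)) s.
Proof.
move=> [c /near_complex[r r0 cP]]; exists r => //; exists (fun k => complex.Re (c k)) => h hr.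
have /cP/cvg_Re : `|(s + h)%:C - s%:C| < r%:C :> R[i].
  by rewrite -rmorphB/= addrAC subrr add0r normc_real ltcR.
rewrite (_ : (fun n => _) = series (fun k => complex.Re (c k) * h ^+ k))//.
apply/funext => n; rewrite !seriesEord/= raddf_sum/=; apply: eq_bigr => k _.
rewrite -rmorphB/= addrAC subrr add0r -rmorphXn/=.
by case: (c k) => a b; simpc.
Qed.

Lemma analytic_at_Im (Z : R[i]^o -> R[i]^o) s : analytic_at Z s%:C ->
  real_analytic_at (fun x => complex.Im (Z x%:C)) s.
Proof.
move=> [c /near_complex[r r0 cP]]; exists r => //; exists (fun k => complex.Im (c k)) => h hr.
have /cP/cvg_Im : `|(s + h)%:C - s%:C| < r%:C :> R[i].
  by rewrite -rmorphB/= addrAC subrr add0r normc_real ltcR.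
rewrite (_ : (fun n => _) = series (fun k => complex.Im (c k) * h ^+ k))//.
apply/funext => n; rewrite !seriesEord/= raddf_sum/=; apply: eq_bigr => k _.
rewrite -rmorphB/= addrAC subrr add0r -rmorphXn/=.
by case: (c k) => a b; simpc.
Qed.

(* An analytic function has a complex derivative, so that it can be computed
   along the real axis. *)
Lemma analytic_at_derive1 (Z : R[i]^o -> R[i]^o) (D r : R) : analytic_at Z 0 ->
  0 < r -> (forall h, 0 <= h < r -> complex.Im (Z h%:C) = 0) ->
  (fun h => (complex.Re (Z h%:C) - complex.Re (Z 0)) / h) @ 0^'+ --> D ->
  derive1 Z 0 = D%:C.
Proof.
move=> [c /near_complex[q q0 cP]] r0 ZI ZD.
have cP0 w : `|w| < q%:C ->
    (series (fun k => c k * w ^+ k) : nat -> R[i]^o) @ \oo --> Z w.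
  by move=> wq; have := cP w; rewrite subr0; apply.
have q2 : `|(q / 2)%:C| < q%:C :> R[i].
  by rewrite normc_real ltcR gtr0_norm ?divr_gt0// ltr_pdivrMr// ltr_pMr// ltr1n.
have [B B0 cB] := @pseries_terms_bounded _ _ _ _ (cP0 _ q2).
have q20 : 0 < (q / 2)%:C :> R[i] by rewrite ltcR divr_gt0.
have h2 : (q / 2 / 2)%:C = (q / 2)%:C / 2 :> R[i].
  by rewrite rmorphM/= fmorphV rmorph_nat.
(* Second-order Taylor bound at 0; the value of Z at 0, the complex derivative and its two parts are
   all extracted from it. *)
have tail w : `|w| <= (q / 2 / 2)%:C ->
    `|Z w - (c 0%N + c 1%N * w)| <= 2 * B / ((q / 2)%:C) ^+ 2 * `|w| ^+ 2.
  move=> wq; rewrite mulrAC -mulrA -expr_div_n.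
  have -> : c 0%N + c 1%N * w = \sum_(k < 2) c k * w ^+ k.
    by rewrite big_ord_recr big_ord1/= expr0 mulr1 expr1.
  apply: pseries_tail; [exact: q20| |by rewrite -h2|].
    by move=> k; have := cB k; rewrite [X in _ * X ^+ _ <= _ -> _](gtr0_norm q20).
  by apply: cP0; apply: le_lt_trans wq _; rewrite ltcR; lra.
have Z0 : Z 0 = c 0%N.
  have := tail 0; rewrite normr0 lecR divr_ge0 ?divr_ge0 ?(ltW q0)// => /(_ isT).
  by rewrite expr0n/= !mulr0 addr0 normr_le0 subr_eq0 => /eqP.
set M := 2 * B / ((q / 2)%:C) ^+ 2 in tail.
have M0 : 0 <= M.
  by apply: divr_ge0; [exact: mulr_ge0|apply: exprn_ge0; exact: ltW q20].
clearbody M.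
have quo w : w != 0 -> `|w| <= (q / 2 / 2)%:C -> `|c 1%N - w^-1 * (Z w - Z 0)| <= M * `|w|.
  move=> w0 /tail; rewrite -Z0 opprD addrA => h.
  rewrite -(ler_pM2r (x := `|w|)) ?normr_gt0// -normrM mulrBl mulrAC mulVf// mul1r.
  by rewrite distrC -mulrA -expr2.
have dZ : derive1 Z 0 = c 1%N.
  rewrite /derive1; apply/cvg_lim => //; apply/cvgrPdist_lt => e e0.
  have d0 : 0 < (q / 2 / 2)%:C :> R[i] by rewrite ltcR !divr_gt0.
  have M1 : 0 < M + 1 by rewrite ltr_wpDl.
  have eM : 0 < e / (M + 1) by rewrite divr_gt0.
  near=> w; rewrite addr0 /GRing.scale/=.
  have w0 : w != 0 by near: w; exact: nbhs_dnbhs_neq.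
  have wd : `|w| < (q / 2 / 2)%:C.
    by near: w; apply: dnbhs0_lt.
  have we : `|w| < e / (M + 1) by near: w; apply: dnbhs0_lt.
  apply: le_lt_trans (quo _ w0 (ltW wd)) _.
  apply: (@le_lt_trans _ _ ((M + 1) * `|w|)); first by rewrite ler_wpM2r// lerDl.
  by rewrite -ltr_pdivlMl// mulrC.
have dM : complex.Im M = 0 by exact: ger0_Im.
have ME : M = (complex.Re M)%:C by rewrite [LHS]complexE dM mulr0 addr0.
have quoR h : 0 < h -> h <= q / 2 / 2 ->
    `|c 1%N - ((complex.Re (Z h%:C) - complex.Re (Z 0)) / h +i* ((complex.Im (Z h%:C) - complex.Im (Z 0)) / h))| <= (complex.Re M * h)%:C.
  move=> h0 hq.
  have -> : (complex.Re M * h)%:C = M * h%:C by rewrite [in RHS]ME rmorphM.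
  have := quo h%:C; rewrite normc_real (gtr0_norm h0).
  rewrite lecR => /(_ _ hq).
  rewrite eq_complex/= eqxx andbT gt_eqF// => /(_ isT).
  rewrite -fmorphV/=; case: (Z h%:C) => a b; case: (Z 0) => a' b'; simpc.
  by rewrite ![h^-1 * _]mulrC.
have ReD : complex.Re (c 1%N) = D.
  apply: (cvg_unique (@Rhausdorff R) _ ZD) => //.
  apply/cvgrPdist_le => e e0; near=> h.
  have h0 : 0 < h by near: h; exact: nbhs_right_gt.
  have hq : h <= q / 2 / 2 by near: h; apply: nbhs_right_le; rewrite !divr_gt0.
  have := le_trans (normc_Re_le _) (quoR _ h0 hq); rewrite lecR raddfB/= => /le_trans; apply.
  have M1 : 0 < `|complex.Re M| + 1 by rewrite ltr_wpDl.
  apply: (@le_trans _ _ ((`|complex.Re M| + 1) * h)).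
    by rewrite ler_wpM2r ?(ltW h0)// (le_trans (ler_norm _))// lerDl.
  rewrite -ler_pdivlMl//; near: h; apply: nbhs_right_le.
  by rewrite mulr_gt0 ?invr_gt0.
have Z0I : complex.Im (Z 0) = 0 by apply: (ZI 0); rewrite lexx.
(* Z is real on [0, r[, so its difference quotients have no imaginary part there, and |Im (c 1)| <=
   Re M * h for arbitrarily small h. *)
have ImD : complex.Im (c 1%N) = 0.
  apply/eqP; rewrite -normr_le0; apply/ler_addgt0Pr => e e0; rewrite add0r.
  have M1 : 0 < `|complex.Re M| + 1 by rewrite ltr_wpDl.
  pose h := Num.min (r / 2) (Num.min (q / 2 / 2) (e / (`|complex.Re M| + 1))).
  have h0 : 0 < h by rewrite !lt_min !divr_gt0.
  have hr : h < r.
    by rewrite /h gt_min; apply/orP; left; rewrite ltr_pdivrMr// ltr_pMr// ltr1n.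
  have hq : h <= q / 2 / 2 by rewrite !ge_min lexx orbT.
  have he : h <= e / (`|complex.Re M| + 1) by rewrite !ge_min lexx !orbT.
  have := le_trans (normc_Im_le _) (quoR _ h0 hq); rewrite lecR raddfB/= ZI ?(ltW h0)// Z0I subrr mul0r subr0.
  move=> /le_trans; apply.
  apply: (@le_trans _ _ ((`|complex.Re M| + 1) * h)).
    by rewrite ler_wpM2r ?(ltW h0)// (le_trans (ler_norm _))// lerDl.
  by rewrite mulrC -ler_pdivlMr.
by rewrite dZ [LHS]complexE ReD ImD mulr0 addr0.
Unshelve. all: by end_near. Qed.

End ComplexAnalytic.

(** * Mellin transforms *)

Section MellinTransform.
Variable R : realType.
Local Notation mu := (@lebesgue_measure R).
Local Notation pos := (`]0, +oo[%classic : set R).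
Implicit Types (f g h : R -> R) (b c e s t u x y C p q : R).

Let mpos : measurable (pos : set (measurableTypeR R)).
Proof. exact: measurable_itv. Qed.

Lemma measurable_inv_pos : measurable_fun pos (fun u : R => u^-1).
Proof.
apply: (@eq_measurable_fun _ _ _ _ _ (fun u => u `^ (-1))).
  by move=> u; rewrite inE/= in_itv/= andbT => u0; rewrite powR_inv1// ltW.
by apply: measurable_funTS; exact: measurable_powR.
Qed.

Lemma Rintegral_frullani x : 0 < x ->
  mu.-integrable pos (EFin \o (fun t => (expR (- t) - expR (- x * t)) / t)) /\
  \int[mu]_(t in pos) ((expR (- t) - expR (- x * t)) / t) = ln x.
Proof.
pose g x t : R := (expR (- t) - expR (- x * t)) / t.
have mg y : measurable_fun pos (g y).
  apply: measurable_funM; last exact: measurable_inv_pos.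
  apply: measurable_funTS; apply: measurable_funB; last exact: measurable_expRM.
  by apply: measurableT_comp => //; exact: measurable_funN.
have gt1 y : 1 < y -> mu.-integrable pos (EFin \o g y) /\ \int[mu]_(t in pos) g y t = ln y.
  move=> y1; have e : (\int[mu]_(t in pos) (g y t)%:E = (ln y)%:E)%E := frullani_gt1 y1; split; last by rewrite /Rintegral e.
  apply/integrableP; split; first by apply/measurable_EFinP; exact: mg.
  rewrite (_ : (\int[mu]_(t in pos) _)%E = (ln y)%:E) ?ltry// -e.
  apply: eq_integral => t; rewrite inE/= in_itv/= andbT => t0.
  rewrite ger0_norm// divr_ge0 ?(ltW t0)// subr_ge0 ler_expR lerNr mulNr opprK.
  by rewrite ler_peMl ?(ltW t0) ?(ltW y1).
move=> x0; case: (ltgtP x 1) => [x1|x1|->]; first last.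
- have g0 : g 1 = fun=> 0.
    by apply/funext => t; rewrite /g mulN1r subrr mul0r.
  rewrite -[(fun t => _)]/(g 1) g0 ln1; split; first exact: integrable0.
  by rewrite Rintegral_cst// mul0r.
- exact: gt1.
(* The case x < 1 reduces to x^-1 > 1 through the substitution of x t for t. *)
have xV : 1 < x^-1 by rewrite invf_gt1.
have [i e] := gt1 _ xV.
have gE t : g x t = - x * g x^-1 (x * t).
  rewrite /g (_ : - x^-1 * (x * t) = - t) ?mulNr ?mulKf ?gt_eqF//.
  have [->|t0] := eqVneq t 0; first by rewrite mulr0 invr0 !mulr0 oppr0.
  by field; rewrite t0 gt_eqF.
have -> : (fun t => (expR (- t) - expR (- x * t)) / t) = (fun t => - x * g x^-1 (x * t)).
  exact/funext.
have ii := integrable_scale x0 i; split.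
  by have := integrableZl mpos (- x) ii; apply: eq_integrable.
rewrite RintegralZl// (Rintegral_scale x0 i) e lnV ?posrE//.
by rewrite mulNr mulrN mulrN opprK mulVKf// gt_eqF.
Qed.

Lemma integrable_pos_bound h C b c : measurable_fun pos h -> 0 < b -> 0 < c ->
  (forall u, 0 < u <= 1 -> `|h u| <= C * u `^ (b - 1)) ->
  (forall u, 1 <= u -> `|h u| <= C * u `^ (- c - 1)) ->
  mu.-integrable pos (EFin \o h).
Proof.
move=> mh b0 c0 h0 hy; apply/integrableP; split; first exact/measurable_EFinP.
have C0 : 0 <= C.
  by have := hy 1 (lexx _); rewrite powR1 mulr1; apply: le_trans.
have mah : measurable_fun pos (fun u => `|(EFin \o h) u|%E).
  by apply: measurableT_comp => //; exact/measurable_EFinP.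
have E : pos = `]0, 1] `|` `]1, +oo[.
  apply/seteqP; split => x /=; rewrite !in_itv/= !andbT.
    by move=> x0; case: (leP x 1) => x1; [left; rewrite x0|right].
  by case=> [/andP[]//|]; exact: lt_trans.
rewrite E ge0_integral_setU//=; last 2 first.
- by rewrite -E.
- apply/disj_setPS => x [] /=; rewrite !in_itv/= andbT => /andP[_ x1].
  by rewrite ltNge x1.
apply: lte_add_pinfty.
  apply: (@le_lt_trans _ _ (\int[mu]_(u in `]0%R, 1%R]) (C%:E * (u `^ (b - 1))%:E)))%E.
    apply: ge0_le_integral => //.
    - by apply: measurable_funS mah => //; rewrite E; exact: subsetUl.
    - by apply: measurable_funeM; apply/measurable_EFinP/measurable_funTS; exact: measurable_powR.
  rewrite ge0_integralZl//; last 2 first.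
  - by apply/measurable_EFinP/measurable_funTS; exact: measurable_powR.
  - by move=> u _; rewrite lee_fin powR_ge0.
  by rewrite integral_powR_01// -EFinM ltry.
apply: (@le_lt_trans _ _ (\int[mu]_(u in `]1%R, +oo[) (C%:E * (u `^ (- c - 1))%:E)))%E.
  apply: ge0_le_integral => //.
  - by apply: measurable_funS mah => //; rewrite E; exact: subsetUr.
  - by apply: measurable_funeM; apply/measurable_EFinP/measurable_funTS; exact: measurable_powR.
  - by move=> u /=; rewrite in_itv/= andbT => /ltW/hy; rewrite lee_fin.
have mp : measurable_fun (`]1, +oo[%classic : set R) (EFin \o (fun u : R => u `^ (- c - 1))).
  by apply/measurable_EFinP/measurable_funTS; exact: measurable_powR.
rewrite ge0_integralZl//; last first.
  by move=> u _; rewrite lee_fin powR_ge0.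
by rewrite integral_itv_obnd_cbnd// integral_powR_1y// -EFinM ltry.
Qed.

Lemma Rintegral_dominated_cvg (f_ : nat -> R -> R) f g (D : set R) : measurable D ->
  (forall n, measurable_fun D (f_ n)) -> mu.-integrable D (EFin \o g) ->
  (forall n x, D x -> `|f_ n x| <= g x) ->
  (forall x, D x -> f_ ^~ x @ \oo --> f x) ->
  mu.-integrable D (EFin \o f) /\
  (fun n => \int[mu]_(x in D) f_ n x) @ \oo --> \int[mu]_(x in D) f x.
Proof.
move=> mD mf gi fg ff.
have mf' : measurable_fun D f by exact: measurable_fun_cvg mf ff.
have [] := @dominated_convergence _ _ _ mu D mD (fun n => EFin \o f_ n) (EFin \o f) (EFin \o g).
- by move=> n; apply/measurable_EFinP; exact: mf.
- by apply/measurable_EFinP; exact: mf'.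
- by apply: aeW => x Dx /=; apply: cvg_EFin; [exact: nearW|exact: ff].
- exact: gi.
- by apply: aeW => x n Dx /=; rewrite lee_fin fg.
move=> fi _ fl; split => //.
apply: fine_cvg; rewrite fineK; last exact: integrable_fin_num.
exact: fl.
Qed.

Lemma pos_powRD u b c : 0 < u -> u `^ (b + c) = u `^ b * u `^ c.
Proof. by move=> u0; rewrite powRD// (gt_eqF u0) implybT. Qed.

Definition mellin f s := \int[mu]_(u in pos) (f u * u `^ (s - 1)).

Lemma integrable_mellin f C p q s : measurable_fun pos f ->
  (forall u, 0 < u <= 1 -> `|f u| <= C * u `^ p) ->
  (forall u, 1 <= u -> `|f u| <= C * u `^ (- q)) ->
  - p < s < q -> mu.-integrable pos (EFin \o (fun u => f u * u `^ (s - 1))).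
Proof.
move=> mf f0 fy /andP[ps sq].
apply: (@integrable_pos_bound _ C (p + s) (q - s)).
- by apply: measurable_funM => //; apply: measurable_funTS; exact: measurable_powR.
- by rewrite -ltrBlDl sub0r.
- by rewrite subr_gt0.
- move=> u u01; have u0 : 0 < u by case/andP: u01.
  rewrite normrM (ger0_norm (powR_ge0 _ _)) -addrA (pos_powRD p (s - 1))//.
  by rewrite mulrA ler_wpM2r ?powR_ge0// f0.
- move=> u u1; have u0 : 0 < u by exact: lt_le_trans u1.
  rewrite normrM (ger0_norm (powR_ge0 _ _)) (_ : - (q - s) - 1 = - q + (s - 1)); last by ring.
  rewrite (pos_powRD (- q) (s - 1))//.
  by rewrite mulrA ler_wpM2r ?powR_ge0// fy.
Qed.

Lemma exp_series_le x n : `|\sum_(k < n) x ^+ k / k`!%:R| <= expR `|x|.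
Proof.
apply: (@le_trans _ _ (series (exp_coeff `|x|) n)).
  rewrite seriesEord/=; apply: le_trans (ler_norm_sum _ _ _) _; apply: ler_sum => k _.
  by rewrite /exp_coeff/= normrM normrX normfV normr_nat.
apply: nondecreasing_cvgn_le; last exact: is_cvg_series_exp_coeff.
by apply: nondecreasing_series => k _ _; rewrite exp_coeff_ge0.
Qed.

Lemma cvg_exp_series x : (fun n => \sum_(k < n) x ^+ k / k`!%:R) @ \oo --> expR x.
Proof.
have := @is_cvg_series_exp_coeff R x.
by rewrite /expR (_ : series (exp_coeff x) = (fun n => \sum_(k < n) x ^+ k / k`!%:R))//
  ; apply/funext => n; rewrite seriesEord.
Qed.

(** Expand u^h = e^(h ln u) under the integral. The partial sums are dominated by e^(|h| |ln u|),
    that is u^(-|h|) on ]0, 1] and u^|h| beyond, which stays integrable as long as |h| is less than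
    the distance from s to both ends of the strip. *)
Lemma mellin_analytic f C p q : measurable_fun pos f ->
  (forall u, 0 < u <= 1 -> `|f u| <= C * u `^ p) ->
  (forall u, 1 <= u -> `|f u| <= C * u `^ (- q)) ->
  forall s, - p < s < q -> real_analytic_at (mellin f) s.
Proof.
move=> mf f0 fy s /andP[ps sq].
have mpow t : measurable_fun pos (fun u => u `^ t).
  by apply: measurable_funTS; exact: measurable_powR.
have mln : measurable_fun pos (@ln R) by apply: measurable_funTS; exact: measurable_ln.
pose r : R := Num.min (p + s) (q - s).
have r0 : 0 < r by rewrite lt_min -ltrBlDl sub0r ps subr_gt0.
have gi (h : R) : 0 <= h < r ->
    mu.-integrable pos (EFin \o (fun u => `|f u| * u `^ (s - 1) * expR (h * `|ln u|))).
  rewrite lt_min => /and3P[h0 hp hq].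
  apply: (@integrable_pos_bound _ C (p + s - h) (q - s - h)).
  - apply: measurable_funM.
      by apply: measurable_funM => //; exact: measurableT_comp.
    apply: measurableT_comp => //; apply: measurable_funM => //.
    exact: measurableT_comp.
  - by rewrite subr_gt0.
  - by rewrite subr_gt0.
  - move=> u /[dup] /f0 fu /andP[u0 u1].
    rewrite ger0_norm; last by rewrite !mulr_ge0 ?powR_ge0 ?expR_ge0.
    rewrite (ler0_norm (ln_le0 u1)) mulrN -mulNr.
    rewrite (_ : expR _ = u `^ (- h)); last by rewrite /powR gt_eqF.
    apply: le_trans (ler_wpM2r _ (ler_wpM2r _ fu)) _; rewrite ?powR_ge0//.
    rewrite -!mulrA -!pos_powRD//.
    by rewrite le_eqVlt; apply/orP; left; apply/eqP; congr (_ * _ `^ _); ring.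
  - move=> u /[dup] /fy fu u1; have u0 : 0 < u by exact: lt_le_trans u1.
    rewrite ger0_norm; last by rewrite !mulr_ge0 ?powR_ge0 ?expR_ge0.
    rewrite (ger0_norm (ln_ge0 u1)).
    rewrite (_ : expR _ = u `^ h); last by rewrite /powR gt_eqF.
    apply: le_trans (ler_wpM2r _ (ler_wpM2r _ fu)) _; rewrite ?powR_ge0//.
    rewrite -!mulrA -!pos_powRD//.
    by rewrite le_eqVlt; apply/orP; left; apply/eqP; congr (_ * _ `^ _); ring.
have ci k : mu.-integrable pos (EFin \o (fun u => f u * u `^ (s - 1) * (ln u ^+ k / k`!%:R))).
  (* (r/2 |ln u|)^k / k! is one term of the series of e^(r/2 |ln u|), so the integrable bound at r/2
     controls each power of ln u. *)
  have h2 : 0 <= r / 2 < r by rewrite divr_ge0 ?ltW//= ltr_pdivrMr// ltr_pMr// ltr1n.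
  have := integrableZl mpos ((r / 2) ^- k) (gi _ h2).
  apply: le_integrable => //.
    apply/measurable_EFinP; apply: measurable_funM; first by apply: measurable_funM; [exact: mf|exact: mpow].
    by apply: measurable_funM => //; exact: measurable_funX.
  move=> u; rewrite /= in_itv/= andbT => u0; rewrite lee_fin.
  rewrite [leRHS]ger0_norm; last first.
    by rewrite !mulr_ge0 ?powR_ge0 ?expR_ge0// invr_ge0 exprn_ge0// ltW// divr_gt0.
  rewrite 2!normrM (ger0_norm (powR_ge0 _ _)) [leRHS]mulrCA ler_wpM2l ?mulr_ge0 ?powR_ge0//.
  rewrite ler_pdivlMl ?exprn_gt0 ?divr_gt0//.
  have rl : 0 <= r / 2 * `|ln u| by rewrite mulr_ge0// divr_ge0 ?ltW.
  apply: le_trans (_ : (r / 2 * `|ln u|) ^+ k / k`!%:R <= _).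
    by rewrite [X in _ * X]normrM normrX normfV normr_nat mulrA -exprMn lexx.
  have := exp_series_le (r / 2 * `|ln u|) k.+1; rewrite (ger0_norm rl).
  rewrite big_ord_recr/= ger0_norm; last first.
    by rewrite addr_ge0 ?divr_ge0 ?exprn_ge0// sumr_ge0// => i _; rewrite divr_ge0 ?exprn_ge0.
  by apply: le_trans; rewrite lerDr sumr_ge0// => i _; rewrite divr_ge0 ?exprn_ge0.
exists r => //; exists (fun k => \int[mu]_(u in pos) (f u * u `^ (s - 1) * (ln u ^+ k / k`!%:R))) => h hr.
pose F n u := f u * u `^ (s - 1) * \sum_(k < n) (h * ln u) ^+ k / k`!%:R.
have FE n : series (fun k => (\int[mu]_(u in pos) (f u * u `^ (s - 1) * (ln u ^+ k / k`!%:R))) * h ^+ k) n =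
    \int[mu]_(u in pos) F n u.
  rewrite seriesEord/= /F; elim: n => [|n IH].
    rewrite big_ord0; transitivity (\int[mu]_(u in pos) (0 : R)).
      by rewrite Rintegral_cst// mul0r.
    by apply: eq_Rintegral => u _; rewrite big_ord0 mulr0.
  have Fi m : mu.-integrable pos (EFin \o F m).
    pose G (k : 'I_m) u := ((h ^+ k)%:E * (f u * u `^ (s - 1) * (ln u ^+ k / k`!%:R))%:E)%E.
    apply: (@eq_integrable _ _ _ mu pos mpos (fun u => (\sum_(k < m) G k u)%E)).
      move=> u _; rewrite /G /F/=.
      under eq_bigr do rewrite -EFinM.
      rewrite sumEFin; congr EFin.
      by rewrite mulr_sumr; apply: eq_bigr => k _; rewrite exprMn; ring.
    by apply: integrable_sum => // k _; exact: (integrableZl mpos (h ^+ k) (ci k)).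
  rewrite big_ord_recr/= IH -RintegralZr//.
  rewrite -RintegralD//; [|exact: Fi|]; last first.
    by have := integrableZr mpos (h ^+ n) (ci n); apply: eq_integrable.
  apply: eq_Rintegral => u _; rewrite big_ord_recr/= mulrDr; congr (_ + _).
  by rewrite exprMn; ring.
rewrite (eq_cvg _ _ FE) /mellin.
have hr' : 0 <= `|h| < r by rewrite normr_ge0.
have [] := @Rintegral_dominated_cvg F (fun u => f u * u `^ (s + h - 1)) _ pos _ _ (gi _ hr') => //.
- move=> n; apply: measurable_funM; first by apply: measurable_funM; [exact: mf|exact: mpow].
  apply: measurable_sum => k; apply: measurable_funM => //; apply: measurable_funX.
  by apply: measurable_funM.
- move=> n u _; rewrite /F 2!normrM (ger0_norm (powR_ge0 _ _)) ler_wpM2l ?mulr_ge0 ?powR_ge0//.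
  by rewrite -normrM exp_series_le.
- move=> u; rewrite /= in_itv/= andbT => u0; rewrite /F.
  rewrite (_ : f u * u `^ (s + h - 1) = f u * u `^ (s - 1) * expR (h * ln u)).
    by apply: cvgM; [exact: cvg_cst|exact: cvg_exp_series].
  rewrite (_ : expR _ = u `^ h); last by rewrite /powR gt_eqF.
  by rewrite -mulrA -pos_powRD// addrAC.
Qed.

End MellinTransform.

(** * Theta functions of discrete circles *)

Section BinomialWindow.
Local Open Scope nat_scope.

Lemma leq_bin_half N j l : j <= l -> l.*2 <= N -> 'C(N, j) <= 'C(N, l).
Proof.
move=> jl; rewrite -(subnKC jl); elim: (l - j) => [|i IH]; first by rewrite addn0.
rewrite addnS => lN; apply: leq_trans (IH _) _; first by lia.
rewrite -(@leq_pmul2l (j + i).+1)// mul_bin_left leq_mul2r; apply/orP; right; lia.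
Qed.

(* By unimodality each binomial coefficient in the left-hand sum is at most each
   of the next a/4 ones; these windows are disjoint since the N - 2j are distinct
   multiples of a. *)
Lemma binomial_window N a : 0 < a ->
  a * \sum_(j < N.+1 | (j.*2 < N) && (a %| N - j.*2)) 'C(N, j) <=
  4 * \sum_(l < N.+1 | a <= (N - l.*2).*2) 'C(N, l).
Proof.
move=> a0; pose q := (a %/ 4).+1.
have aq : a <= 4 * q by rewrite /q; lia.
rewrite big_distrr/=.
apply: (@leq_trans (4 * \sum_(j < N.+1 | (j.*2 < N) && (a %| N - j.*2))
    \sum_(l < N.+1 | j <= l < j + q) 'C(N, l))).
  rewrite big_distrr/=; apply: leq_sum => j /andP[jN /dvdnP[k kE]].
  have k0 : 0 < k by case: k kE => //; lia.
  have aN : a <= N - j.*2 by rewrite kE leq_pmull.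
  have jqN : j + q <= N.+1 by lia.
  apply: (@leq_trans (4 * q * 'C(N, j))); first by rewrite leq_mul2r aq orbT.
  rewrite -mulnA leq_mul2l/=.
  rewrite -(big_mkord (fun l => j <= l < j + q) (fun l => 'C(N, l))).
  rewrite (_ : \sum_(0 <= l < N.+1 | j <= l < j + q) 'C(N, l) = \sum_(j <= l < j + q) 'C(N, l)).
    rewrite -{1}(addKn j q) -sum_nat_const_nat !big_nat; apply: leq_sum => l /andP[jl lq].
    by apply: leq_bin_half => //; lia.
  rewrite (big_nat_widen j _ N.+1)// [RHS](big_nat_widenl j 0)//.
  by apply: eq_bigl => l; rewrite andbC.
(* The windows stay in the right-hand range: N - 2j >= a and l - j <= a/4 give N - 2l >= a/2. *)
rewrite leq_mul2l/=; rewrite (exchange_big_dep (fun l : 'I_N.+1 => a <= (N - l.*2).*2))/=; last first.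
  move=> j l /andP[jN /dvdnP[k kE]] /andP[jl lq].
  have k0 : 0 < k by case: k kE => //; lia.
  have aN : a <= N - j.*2 by rewrite kE leq_pmull.
  lia.
apply: leq_sum => l _; rewrite sum_nat_const.
rewrite -[leqRHS]mul1n leq_mul2r; apply/orP; right.
apply/card_le1_eqP => i j /andP[/andP[iN ia] /andP[il lq]] /andP[/andP[jN ja] /andP[jl ljq]].
wlog ij : i j iN ia il lq jN ja jl ljq / i <= j.
  move=> H; have [ij|/ltnW ij] := leqP i j; first exact: H.
  by apply/esym; exact: H.
have : a %| (N - i.*2) - (N - j.*2) by rewrite dvdn_sub.
rewrite (_ : _ - _ = (j - i).*2); last by lia.
move=> /dvdnP[k kE]; apply/val_inj => /=.
case: k kE => [|k] kE; first by lia.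
have : a <= (j - i).*2 by rewrite kE mulSn leq_addr.
by rewrite /q in ljq lq; lia.
Qed.

End BinomialWindow.

(** * Power sums of cosines and tails of binomial sums *)

Section TrigSums.
Variable R : realType.
Implicit Types (x y t phi l c : R).

(** Real form of the binomial expansion of (e^(i phi) + e^(- i phi))^N, by induction on N with
    Pascal's rule. *)
Lemma cos_expn N phi : (2 * cos phi) ^+ N =
  \sum_(j < N.+1) 'C(N, j)%:R * cos ((N%:R - 2 * j%:R) * phi).
Proof.
elim: N => [|N IH].
  by rewrite big_ord1 expr0 bin0 mul1r mulr0 subrr mul0r cos0.
have prod m : 2 * cos phi * cos (m * phi) = cos ((m + 1) * phi) + cos ((m - 1) * phi).
  rewrite (_ : (m + 1) * phi = m * phi + phi); last by ring.
  rewrite (_ : (m - 1) * phi = m * phi - phi); last by ring.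
  by rewrite cosD cosB; ring.
rewrite exprS IH mulr_sumr.
transitivity (\sum_(j < N.+1) ('C(N, j)%:R * cos ((N.+1%:R - 2 * j%:R) * phi)) +
    \sum_(j < N.+1) ('C(N, j)%:R * cos ((N.+1%:R - 2 * j.+1%:R) * phi))).
  rewrite -big_split/=; apply: eq_bigr => j _.
  rewrite mulrCA prod mulrDr -!natr1; congr (_ * cos (_ * _) + _ * cos (_ * _)); ring.
rewrite [RHS]big_ord_recl/= bin0 [X in X + _ = _]big_ord_recl/= bin0 -addrA; congr (_ + _).
rewrite [in RHS]big_ord_recr/= [X in _ + X = _]big_ord_recr/= !binn addrA; congr (_ + _).
rewrite -big_split/=; apply: eq_bigr => j _.
by rewrite /bump/= !add1n binS natrD [RHS]mulrDl.
Qed.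

Lemma cos_add_2pin x (n : nat) : cos (x + 2 * pi * n%:R) = cos x.
Proof.
elim: n => [|n IH]; first by rewrite mulr0 addr0.
rewrite -[n.+1%:R]natr1 mulrDr mulr1 addrA -[RHS]IH.
have := @cosD2pi R (x + 2 * pi * n%:R).
by rewrite -(mulr_natl pi 2).
Qed.

Lemma sum_cos_dvd (a : nat) l (m : nat) : (0 < a)%N ->
  `|\sum_(k < a) cos (m%:R * (2 * pi * (k%:R + l) / a%:R))| <= a%:R.
Proof.
move=> _; apply: le_trans (ler_norm_sum _ _ _) _.
apply: (@le_trans _ _ (\sum_(k < a) 1)); last by rewrite sumr_const card_ord.
by apply: ler_sum => k _; rewrite ler_norml cos_geN1 cos_le1.
Qed.

(** With r the remainder of m modulo a, multiplying by sin(pi r / a) makes the sum telescope over a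
    whole number of periods; this sine is positive since 0 < r < a. *)
Lemma sum_cos_ndvd (a : nat) l (m : nat) : (0 < a)%N -> ~~ (a %| m)%N ->
  \sum_(k < a) cos (m%:R * (2 * pi * (k%:R + l) / a%:R)) = 0.
Proof.
move=> a0 am; pose r := (m %% a)%N.
have r0 : (0 < r)%N by rewrite lt0n; apply: contra am => /eqP r0; apply/eqP.
have ra : (r < a)%N by rewrite ltn_mod.
have aR : (a%:R : R) != 0 by rewrite pnatr_eq0 -lt0n.
pose th : R := pi * r%:R / a%:R.
have s0 : 0 < sin th.
  apply: sin_gt0_pi; rewrite /th divr_gt0 ?mulr_gt0 ?pi_gt0 ?ltr0n//=.
  by rewrite ltr_pdivrMr ?ltr0n// ltr_pM2l ?pi_gt0// ltr_nat.
pose c : R := m%:R * (2 * pi * l / a%:R).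
have E (k : nat) : cos (m%:R * (2 * pi * (k%:R + l) / a%:R)) = cos (c + 2 * th * k%:R).
  rewrite -(cos_add_2pin (c + 2 * th * k%:R) ((m %/ a) * k)); congr cos.
  rewrite /c /th natrM {1 2}(divn_eq m a) natrD natrM -/r; field.
  by [].
under eq_bigr do rewrite E.
apply/eqP; rewrite -(mulrI_eq0 _ (lregP (lt0r_neq0 s0)))//; apply/eqP.
have T n : sin th * \sum_(k < n) cos (c + 2 * th * k%:R) =
    (sin (c + 2 * th * n%:R - th) - sin (c - th)) / 2.
  elim: n => [|n IH]; first by rewrite big_ord0 !mulr0 addr0 subrr mul0r.
  rewrite big_ord_recr/= mulrDr IH -[n.+1%:R]natr1.
  rewrite (_ : c + 2 * th * (n%:R + 1) - th = (c + 2 * th * n%:R) + th); last by ring.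
  by rewrite (sinD (c + 2 * th * n%:R) th) (sinB (c + 2 * th * n%:R) th); field.
rewrite T (_ : c + 2 * th * a%:R - th = (c - th) + 2 * pi * r%:R); last first.
  by rewrite /th; field.
have sinP x n : sin (x + 2 * pi * n%:R) = sin x.
  elim: n => [|n IH]; first by rewrite mulr0 addr0.
  rewrite -[n.+1%:R]natr1 mulrDr mulr1 addrA -[RHS]IH.
  by have := @sinD2pi R (x + 2 * pi * n%:R); rewrite -(mulr_natl pi 2).
by rewrite sinP subrr mul0r.
Qed.

(** The mean value of (2 cos phi)^N over a period, i.e. the number of closed N-step walks on the
    integers. *)
Definition central_binomial (N : nat) : R := if odd N then 0 else 'C(N, N./2)%:R.

(** In the expansion by [cos_expn] the mode j = N/2 is the mean value and the modes that are not
    multiples of a sum to zero. The others come in pairs j, N - j, a factor 2, and each half is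
    bounded by [binomial_window], a factor 4. *)
Lemma power_sum_cos_bound (a : nat) l N : (0 < a)%N ->
  `|\sum_(k < a) (2 * cos (2 * pi * (k%:R + l) / a%:R)) ^+ N - a%:R * central_binomial N| <=
  8 * \sum_(j < N.+1 | (a <= (N - j.*2).*2)%N) 'C(N, j)%:R.
Proof.
move=> a0.
pose dist (j : nat) := ((N - j.*2) + (j.*2 - N))%N.
pose S (m : nat) := \sum_(k < a) cos (m%:R * (2 * pi * (k%:R + l) / a%:R)).
have cosE (j : nat) x : cos ((N%:R - 2 * j%:R) * x) = cos ((dist j)%:R * x).
  rewrite /dist natrD; have [jN|/ltnW jN] := leqP j.*2 N.
    rewrite (eqP (_ : j.*2 - N == 0)%N) ?subn_eq0// addr0 natrB// -muln2 natrM.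
    by rewrite [2 * _]mulrC.
  rewrite (eqP (_ : N - j.*2 == 0)%N) ?subn_eq0// add0r natrB// -muln2 natrM.
  by rewrite -cosN -mulNr opprB [2 * _]mulrC.
have -> : \sum_(k < a) (2 * cos (2 * pi * (k%:R + l) / a%:R)) ^+ N =
    \sum_(j < N.+1) 'C(N, j)%:R * S (dist j).
  under eq_bigr do rewrite cos_expn.
  rewrite exchange_big/=; apply: eq_bigr => j _; rewrite /S mulr_sumr.
  by apply: eq_bigr => k _; rewrite cosE.
rewrite (bigID (fun j : 'I_N.+1 => j.*2 == N))/=.
have -> : \sum_(j < N.+1 | j.*2 == N) 'C(N, j)%:R * S (dist j) = a%:R * central_binomial N.
  rewrite /central_binomial; case: ifPn => oN.
    rewrite mulr0 big1// => j /eqP jN; have := odd_double j; by rewrite jN oN.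
  have N2 : (N./2 < N.+1)%N by lia.
  rewrite (bigD1 (Ordinal N2)) /=; last by apply/eqP; lia.
  rewrite big1 ?addr0; last first.
    move=> j /andP[/eqP jN /eqP nj]; exfalso; apply: nj; apply/val_inj => /=; lia.
  rewrite mulrC; congr (_ * _); rewrite /S /dist.
  rewrite (_ : (_ + _)%N = 0%N); last by lia.
  under eq_bigr do rewrite mul0r cos0.
  by rewrite sumr_const card_ord.
rewrite addrAC subrr add0r.
have half : \sum_(j < N.+1 | (j.*2 != N) && (a %| dist j)%N) ('C(N, j)%:R : R) =
    2 * \sum_(j < N.+1 | (j.*2 < N)%N && (a %| N - j.*2)%N) 'C(N, j)%:R.
  rewrite (bigID (fun j : 'I_N.+1 => (j.*2 < N)%N))/= mulr_natl mulr2n; congr (_ + _).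
    apply: eq_bigl => j; rewrite /dist; case: (ltnP j.*2 N) => jN.
      rewrite (_ : (_ + _)%N = (N - j.*2)%N); last by lia.
      by rewrite andbT (ltn_eqF jN).
    by rewrite andbF.
  rewrite (reindex_inj rev_ord_inj)/=; apply: eq_big => [j|j _].
    have jN := ltn_ord j; rewrite /dist subSS.
    have [h|h] := ltnP j.*2 N.
      rewrite (_ : ((N - j).*2 != N) = true); last by apply/eqP; lia.
      rewrite (_ : ((N - j).*2 < N)%N = false); last by apply/negbTE; lia.
      by rewrite andbT/=; congr (_ %| _)%N; lia.
    by apply/negbTE; rewrite negb_and negb_and -!leqNgt !negbK; apply/orP; lia.
  by rewrite subSS bin_sub// -ltnS.
apply: le_trans (ler_norm_sum _ _ _) _.
apply: (@le_trans _ _ (a%:R * \sum_(j < N.+1 | (j.*2 != N) && (a %| dist j)%N) 'C(N, j)%:R)).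
  rewrite mulr_sumr [leRHS]big_mkcondr/=; apply: ler_sum => j _.
  rewrite normrM normr_nat; case: ifPn => [_|aj].
    by rewrite mulrC ler_wpM2r// sum_cos_dvd.
  by rewrite /S sum_cos_ndvd// normr0 mulr0.
rewrite half.
have := binomial_window N a0; rewrite -(ler_nat R) !natrM !natr_sum => h.
rewrite mulrCA (_ : 8 = 2 * 4 :> R); last by ring.
by rewrite -[leRHS]mulrA ler_pM2l.
Qed.

(* Chebyshev's inequality for the function e^(xs) + e^(-xs) - 2 of a simple walk. *)
Lemma binomial_tail (a N : nat) x : (0 < a)%N -> 0 < x ->
  \sum_(j < N.+1 | (a <= (N - j.*2).*2)%N) 'C(N, j)%:R <=
  2 * ((expR x + expR (- x)) ^+ N - 2 ^+ N) /
    (expR (x * a%:R / 2) + expR (- (x * a%:R / 2)) - 2).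
Proof.
move=> a0 x0.
pose psi y : R := expR y + expR (- y) - 2.
(* psi y = (2 sinh (y/2))^2, hence it is non-negative and increasing on the half-line. *)
have psiE y : psi y = (expR (y / 2) - expR (- (y / 2))) ^+ 2.
  have h z : expR (z / 2) ^+ 2 = expR z by rewrite expr2 -expRD; congr expR; field.
  by rewrite /psi sqrrB expRxMexpNx_1 h -mulNr h; ring.
have psi0 y : 0 <= psi y by rewrite psiE sqr_ge0.
have psi_mono y z : 0 <= y -> y <= z -> psi y <= psi z.
  move=> y0 yz; rewrite !psiE ler_sqr ?nnegrE.
  - by apply: lerB; rewrite ler_expR; lra.
  - by rewrite subr_ge0 ler_expR; lra.
  - by rewrite subr_ge0 ler_expR; lra.
have psi_gt0 y : 0 < y -> 0 < psi y.
  by move=> y0; rewrite psiE exprn_gt0// subr_gt0 ltr_expR; lra.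
rewrite -/(psi (x * a%:R / 2)) ler_pdivlMr ?psi_gt0 ?divr_gt0 ?mulr_gt0 ?ltr0n//.
have -> : 2 * ((expR x + expR (- x)) ^+ N - 2 ^+ N) =
    \sum_(j < N.+1) 'C(N, j)%:R * psi (x * (N%:R - 2 * j%:R)).
  have E (j : 'I_N.+1) : expR (x * (N%:R - 2 * j%:R)) = expR x ^+ (N - j) * expR (- x) ^+ j.
    rewrite -!expRM_natl -expRD; congr expR; rewrite natrB -1?ltnS//; ring.
  have E' (j : 'I_N.+1) : expR (- (x * (N%:R - 2 * j%:R))) = expR (- x) ^+ (N - j) * expR x ^+ j.
    rewrite -!expRM_natl -expRD; congr expR; rewrite natrB -1?ltnS//; ring.
  rewrite /psi; under eq_bigr do rewrite E E' mulrBr mulrDr.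
  rewrite sumrB big_split/=.
  have -> : \sum_(j < N.+1) 'C(N, j)%:R * (expR x ^+ (N - j) * expR (- x) ^+ j) =
      (expR x + expR (- x)) ^+ N.
    by rewrite exprDn; apply: eq_bigr => j _; rewrite mulr_natl.
  have -> : \sum_(j < N.+1) 'C(N, j)%:R * (expR (- x) ^+ (N - j) * expR x ^+ j) =
      (expR x + expR (- x)) ^+ N.
    by rewrite addrC exprDn; apply: eq_bigr => j _; rewrite mulr_natl.
  rewrite -mulr_suml (_ : \sum_(j < N.+1) 'C(N, j)%:R = 2 ^+ N :> R); first by ring.
  rewrite -[2 in RHS]/(1 + 1) exprDn; apply: eq_bigr => j _.
  by rewrite !expr1n mulr1.
rewrite mulr_suml [leRHS](bigID (fun j : 'I_N.+1 => (a <= (N - j.*2).*2)%N))/=.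
rewrite ler_wpDr ?sumr_ge0//; first by move=> j _; rewrite mulr_ge0.
apply: ler_sum => j aj; rewrite ler_wpM2l//.
apply: psi_mono; first by rewrite divr_ge0 ?mulr_ge0// ltW.
rewrite -mulrA ler_pM2l// ler_pdivrMr//.
have jN : (j.*2 <= N)%N by lia.
rewrite -(natrM _ 2 j) mul2n -natrB// -natrM muln2 ler_nat//.
Qed.

End TrigSums.

Section FiniteLimits.
Variables (R : realType) (T : Type) (F : set_system T) (FF : Filter F) (I : Type).
Variables (r : seq I) (f : I -> T -> R) (l : I -> R).

Lemma cvg_finite_sum : (forall i, f i @ F --> l i) ->
  (fun x => \sum_(i <- r) f i x) @ F --> \sum_(i <- r) l i.
Proof.
move=> fl; elim: r => [|i s IH].
  by rewrite big_nil; under eq_fun do rewrite big_nil; exact: cvg_cst.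
by rewrite big_cons; under eq_fun do rewrite big_cons; exact: cvgD.
Qed.

Lemma cvg_finite_prod : (forall i, f i @ F --> l i) ->
  (fun x => \prod_(i <- r) f i x) @ F --> \prod_(i <- r) l i.
Proof.
move=> fl; elim: r => [|i s IH].
  by rewrite big_nil; under eq_fun do rewrite big_nil; exact: cvg_cst.
by rewrite big_cons; under eq_fun do rewrite big_cons; exact: cvgM.
Qed.

End FiniteLimits.

(** * Heat traces of discrete circles against their mean value term *)

Section LatticeHeat.
Variable R : realType.
Implicit Types (x y z t l c r : R).

Definition lattice_theta (a : nat) l t : R :=
  \sum_(k < a) expR (- (t * (2 - 2 * cos (2 * pi * (k%:R + l) / a%:R)))).

(** The heat kernel of the integers on the diagonal: the probability that a simple walk jumping at
    rate 1 in each direction is back at its start at time t. *)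
Definition heat0 t : R := expR (- (2 * t)) * besselI 0 (2 * t).

(** t^(2m)/(2m)! C(2m, m) = t^(2m)/m!^2 is the m-th term of I_0(2t), and the odd terms vanish. In
    this form the series can be compared with the heat trace, expanded in powers of t, term by
    term. *)
Lemma cvg_central_series t : 0 <= t ->
  (fun n => \sum_(N < n) t ^+ N / N`!%:R * central_binomial R N) @ \oo --> besselI 0 (2 * t).
Proof.
move=> t0; pose u N := t ^+ N / N`!%:R * central_binomial R N.
have u0 N : 0 <= u N.
  by rewrite /u /central_binomial; case: ifP => _; rewrite ?mulr0// mulr_ge0// divr_ge0// exprn_ge0.
have uc : cvgn (series u).
  apply: nondecreasing_is_cvgn; first by apply: nondecreasing_series => N _ _; exact: u0.
  exists (expR (2 * t)) => _ [n _ <-].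
  apply: (@le_trans _ _ (\sum_(N < n) (2 * t) ^+ N / N`!%:R)).
    rewrite seriesEord/=; apply: ler_sum => N _.
    rewrite /u (_ : (2 * t) ^+ N / N`!%:R = t ^+ N / N`!%:R * 2 ^+ N); last by rewrite exprMn; ring.
    apply: ler_wpM2l; first by rewrite divr_ge0// exprn_ge0.
    rewrite /central_binomial; case: ifP => _; first by rewrite exprn_ge0.
    rewrite -natrX ler_nat -[2%N]/(1 + 1)%N Pascal.
    have N2 : (N./2 < N.+1)%N by lia.
    by rewrite (bigD1 (Ordinal N2))//= !exp1n !muln1 leq_addr.
  apply: le_trans (ler_norm _) _; apply: le_trans (exp_series_le _ _) _.
  by rewrite ger0_norm// mulr_ge0.
have -> : (fun n => \sum_(N < n) t ^+ N / N`!%:R * central_binomial R N) = series u.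
  by apply/funext => n; rewrite seriesEord.
suff <- : limn (series u) = besselI 0 (2 * t) by [].
apply/esym; rewrite /besselI.
(* The partial sums of the Bessel series are those of [u] at even indices. *)
have -> : series (fun m : nat => (2 * t / 2) ^+ (m.*2 + 0) / (m`! * (m + 0)`!)%:R) =
    (series u) \o double.
  apply/funext => m /=; rewrite !seriesEord/=.
  elim: m => [|m IH]; first by rewrite !big_ord0.
  rewrite doubleS !big_ord_recr/= IH -addrA; congr (_ + _).
  rewrite /u /central_binomial /= odd_double/= mulr0 addr0 !addn0 doubleK.
  rewrite [2 * t]mulrC mulfK// -mulrA; congr (_ * _).
  have mm : (m <= m.*2)%N by lia.
  have <- := bin_fact mm; rewrite (_ : (m.*2 - m)%N = m); last by lia.
  rewrite [in RHS]natrM invfM mulrAC mulVf ?mul1r// pnatr_eq0 -lt0n bin_gt0//.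
apply/cvg_lim => //; apply: cvg_comp uc.
by move=> P [N _ NP]; exists N => // n /= Nn; apply: NP; rewrite /= (leq_trans Nn)// -addnn leq_addl.
Qed.

Lemma central_binomial_ge0 N : 0 <= central_binomial R N.
Proof. by rewrite /central_binomial; case: ifP. Qed.

Lemma heat0_ge0 t : 0 <= t -> 0 <= heat0 t.
Proof.
move=> t0; rewrite /heat0 mulr_ge0 ?expR_ge0//.
apply: (cvgr_to_ge (cvg_central_series t0)); apply: nearW => n.
by apply: sumr_ge0 => N _; rewrite mulr_ge0 ?central_binomial_ge0// divr_ge0// exprn_ge0.
Qed.

Lemma measurable_heat0 : measurable_fun (`]0, +oo[%classic : set R) heat0.
Proof.
apply: measurable_funM.
  apply: measurable_funTS; apply: measurableT_comp => //.
  by apply: measurableT_comp => //; exact: measurable_funM.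
apply: (@measurable_fun_cvg _ _ _ _
  (fun n t => \sum_(N < n) t ^+ N / N`!%:R * central_binomial R N)).
  move=> n; apply: measurable_funTS; apply: measurable_sum => N.
  by apply: measurable_funM => //; apply: measurable_funM => //; exact: measurable_funX.
by move=> t; rewrite /= in_itv/= andbT => /ltW; exact: cvg_central_series.
Qed.

Lemma lattice_theta_ge0 a l t : 0 <= lattice_theta a l t.
Proof. by apply: sumr_ge0 => k _; exact: expR_ge0. Qed.

Lemma lattice_theta_le a l t : 0 <= t -> lattice_theta a l t <= a%:R.
Proof.
move=> t0; apply: (@le_trans _ _ (\sum_(k < a) 1)); last by rewrite sumr_const card_ord.
by apply: ler_sum => k _; rewrite -[leRHS]expR0 ler_expR oppr_le0 mulr_ge0.
Qed.

Lemma cvg_lattice_theta (a : nat) l t :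
  (fun n => \sum_(N < n) t ^+ N / N`!%:R *
     \sum_(k < a) (2 * cos (2 * pi * (k%:R + l) / a%:R)) ^+ N) @ \oo -->
  expR (2 * t) * lattice_theta a l t.
Proof.
have -> : expR (2 * t) * lattice_theta a l t =
    \sum_(k < a) expR (t * (2 * cos (2 * pi * (k%:R + l) / a%:R))).
  by rewrite /lattice_theta mulr_sumr; apply: eq_bigr => k _; rewrite -expRD; congr expR; ring.
have -> : (fun n => \sum_(N < n) t ^+ N / N`!%:R *
     \sum_(k < a) (2 * cos (2 * pi * (k%:R + l) / a%:R)) ^+ N) =
   (fun n => \sum_(k < a) \sum_(N < n) (t * (2 * cos (2 * pi * (k%:R + l) / a%:R))) ^+ N / N`!%:R).
  apply/funext => n; rewrite exchange_big/=; apply: eq_bigr => N _.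
  by rewrite mulr_sumr; apply: eq_bigr => k _; rewrite [in RHS]exprMn; ring.
apply: (@cvg_finite_sum _ _ _ _ _ _ (fun k n => \sum_(N < n) _)) => k.
exact: cvg_exp_series.
Qed.

(* The difference between the Riemann sum and the mean value of a periodic
   function only sees the Fourier modes divisible by a. *)
Lemma lattice_theta_heat0 (a : nat) l t x : (0 < a)%N -> 0 <= t -> 0 < x ->
  `|lattice_theta a l t - a%:R * heat0 t| <=
  16 * (expR (t * (expR x + expR (- x) - 2)) - 1) /
    (expR (x * a%:R / 2) + expR (- (x * a%:R / 2)) - 2).
Proof.
move=> a0 t0 x0.
set psi := (X in _ / X).
pose A N := \sum_(k < a) (2 * cos (2 * pi * (k%:R + l) / a%:R)) ^+ N.
rewrite -(ler_pM2l (expR_gt0 (2 * t))) -[X in X * `|_|]ger0_norm ?expR_ge0// -normrM.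
have -> : expR (2 * t) * (lattice_theta a l t - a%:R * heat0 t) =
    expR (2 * t) * lattice_theta a l t - a%:R * besselI 0 (2 * t).
  rewrite /heat0 mulrBr; congr (_ - _).
  by rewrite mulrCA [X in _ * X]mulrA expRxMexpNx_1 mul1r.
have -> : expR (2 * t) * (16 * (expR (t * (expR x + expR (- x) - 2)) - 1) / psi) =
    16 * (expR (t * (expR x + expR (- x))) - expR (t * 2)) / psi.
  rewrite (_ : t * (expR x + expR (- x)) = t * (expR x + expR (- x) - 2) + 2 * t); last by ring.
  by rewrite [t * 2]mulrC expRD; ring.
have c1 : (fun n => `|\sum_(N < n) t ^+ N / N`!%:R * A N -
      a%:R * \sum_(N < n) t ^+ N / N`!%:R * central_binomial R N|) @ \oo -->
    `|expR (2 * t) * lattice_theta a l t - a%:R * besselI 0 (2 * t)|.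
  apply: cvg_norm; apply: cvgB; first exact: cvg_lattice_theta.
  by apply: cvgM; [exact: cvg_cst|exact: cvg_central_series].
have c2 : (fun n => 16 * (\sum_(N < n) (t * (expR x + expR (- x))) ^+ N / N`!%:R -
      \sum_(N < n) (t * 2) ^+ N / N`!%:R) / psi) @ \oo -->
    16 * (expR (t * (expR x + expR (- x))) - expR (t * 2)) / psi.
  apply: cvgM; last exact: cvg_cst.
  apply: cvgM; first exact: cvg_cst.
  by apply: cvgB; exact: cvg_exp_series.
(* Both sides are limits of sums over N with weights t^N/N!, compared term by term; 16 is the 8 of
   [power_sum_cos_bound] times the 2 of [binomial_tail]. *)
apply: (ler_cvg_to c1 c2).
apply: nearW => n; rewrite mulr_sumr -sumrB -sumrB mulr_sumr mulr_suml.
apply: le_trans (ler_norm_sum _ _ _) _; apply: ler_sum => N _.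
have tN : 0 <= t ^+ N / N`!%:R by rewrite divr_ge0// exprn_ge0.
rewrite mulrCA -mulrBr normrM ger0_norm//.
apply: le_trans (ler_wpM2l tN (power_sum_cos_bound l N a0)) _.
apply: le_trans (ler_wpM2l tN (ler_wpM2l _ (binomial_tail N a0 x0))) _ => //.
rewrite -/psi [(t * _) ^+ N]exprMn [(t * 2) ^+ N]exprMn le_eqVlt; apply/orP; left; apply/eqP.
by clearbody psi; ring.
Qed.

(** The left-hand side keeps one term of the series of e^(y/2) in (e^(y/2) - e^(-y/2))^2; any power
    of y can thus be gained from the Chebyshev denominator. *)
Lemma expR_tilt_ge y M : 0 <= y ->
  ((y / 2) ^+ M.+1 / M.+1`!%:R) ^+ 2 <= expR y + expR (- y) - 2.
Proof.
move=> y0.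
have h z : expR (z / 2) ^+ 2 = expR z by rewrite expr2 -expRD; congr expR; field.
have -> : expR y + expR (- y) - 2 = (expR (y / 2) - expR (- (y / 2))) ^+ 2.
  by rewrite sqrrB expRxMexpNx_1 h -mulNr h; ring.
have y2 : 0 <= y / 2 by rewrite divr_ge0.
have e1 := expR_ge1Dxn M y2.
have e2 : expR (- (y / 2)) <= 1 by rewrite -[leRHS]expR0 ler_expR oppr_le0.
have p0 : 0 <= (y / 2) ^+ M.+1 / M.+1`!%:R by rewrite divr_ge0// exprn_ge0.
rewrite ler_sqr ?nnegrE//; lra.
Qed.

Lemma expR_tilt_le y : 0 <= y <= 1 -> expR y + expR (- y) - 2 <= expR 1 * y ^+ 2.
Proof.
move=> /andP[y0 y1].
have -> : expR y + expR (- y) - 2 = expR y * (1 - expR (- y)) ^+ 2.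
  have h := expRxMexpNx_1 y.
  rewrite (_ : expR y * (1 - expR (- y)) ^+ 2 =
    expR y - 2 * (expR y * expR (- y)) + expR (- y) * (expR y * expR (- y))); last by ring.
  by rewrite h; ring.
have := expR_ge1Dx (- y) => h1.
have h2 : expR (- y) <= 1 by rewrite -[leRHS]expR0 ler_expR oppr_le0.
apply: ler_pM; rewrite ?expR_ge0 ?sqr_ge0//; first by rewrite ler_expR.
by rewrite ler_sqr ?nnegrE; lra.
Qed.

(** In [lattice_theta_heat0] the denominator beats any power of x a, whence the free order [M], and
    the tilt x is adapted to t so that the numerator stays bounded for t >= 1 and of order t for t
    <= 1. *)
Lemma lattice_theta_heat0_bound M : exists2 C : R, 0 <= C & forall (a : nat) l t, (0 < a)%N ->
  (1 <= t -> `|lattice_theta a l t - a%:R * heat0 t| <= C * (t / a%:R ^+ 2) ^+ M.+1) /\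
  (0 <= t -> t <= 1 -> `|lattice_theta a l t - a%:R * heat0 t| <= C * t / (a%:R ^+ 2) ^+ M.+1).
Proof.
(* [D] comes from [expR_tilt_ge] at y = x a / 2: the square of (x a / 4)^(M+1) / (M+1)! is (x^2
   a^2)^(M+1) / D. *)
pose e : R := expR 1; pose D : R := (16 ^+ M.+1) * M.+1`!%:R ^+ 2.
have e0 : 0 < e by exact: expR_gt0.
have D0 : 0 < D by rewrite mulr_gt0// ?exprn_gt0// ltr0n fact_gt0.
pose C : R := 16 * (expR e + e * expR e) * D.
exists C; first by rewrite !mulr_ge0 ?addr_ge0 ?expR_ge0 ?mulr_ge0 ?expR_ge0// ltW.
move=> a l t a0; have aR : 0 < a%:R :> R by rewrite ltr0n.
have lb x : 0 < x -> (x ^+ 2 * a%:R ^+ 2) ^+ M.+1 / D <= expR (x * a%:R / 2) + expR (- (x * a%:R / 2)) - 2.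
  move=> x0; apply: le_trans (expR_tilt_ge M _); last by rewrite divr_ge0 ?mulr_ge0// ltW.
  rewrite le_eqVlt; apply/orP; left; apply/eqP; rewrite /D.
  rewrite expr_div_n -exprM mulnC exprM (_ : (x * a%:R / 2 / 2) ^+ 2 = x ^+ 2 * a%:R ^+ 2 / 16); last by field.
  rewrite expr_div_n invfM mulrA; congr (_ / _).
have key x E : 0 < x -> expR (t * (expR x + expR (- x) - 2)) - 1 <= E -> 0 <= t ->
    `|lattice_theta a l t - a%:R * heat0 t| <= 16 * E * D / (x ^+ 2 * a%:R ^+ 2) ^+ M.+1.
  move=> x0 hE t0; apply: le_trans (lattice_theta_heat0 l a0 t0 x0) _.
  have p0 : 0 < (x ^+ 2 * a%:R ^+ 2) ^+ M.+1 / D by rewrite divr_gt0 ?exprn_gt0 ?mulr_gt0 ?exprn_gt0.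
  have q0 := lt_le_trans p0 (lb x x0).
  have E0 : 0 <= expR (t * (expR x + expR (- x) - 2)) - 1.
    rewrite subr_ge0 -[leLHS]expR0 ler_expR mulr_ge0//.
    by apply: le_trans (expR_tilt_ge 0 (ltW x0)); rewrite sqr_ge0.
  rewrite -[leRHS]mulrA -[D / _]invf_div.
  apply: ler_pM.
  - by rewrite mulr_ge0.
  - by rewrite invr_ge0 ltW.
  - exact: ler_wpM2l.
  - by rewrite lef_pV2 ?posrE//; exact: lb.
split => [t1|t0 t1].
  have t0 : 0 < t by exact: lt_le_trans t1.
  (* With x^2 = 1/t the exponent t (e^x + e^-x - 2) is at most e, and the denominator becomes a
     power of a^2/t. *)
  pose x := (Num.sqrt t)^-1.
  have s1 : 1 <= Num.sqrt t by rewrite -[leLHS]sqrtr1 ler_sqrt// ltW.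
  have x0 : 0 < x by rewrite invr_gt0 sqrtr_gt0.
  have x1 : x <= 1 by rewrite invf_le1 ?(lt_le_trans ltr01 s1).
  have x2 : x ^+ 2 = t^-1 by rewrite exprVn sqr_sqrtr// ltW.
  apply: le_trans (key x (expR e) x0 _ (ltW t0)) _.
    rewrite (le_trans (y := expR (t * (expR x + expR (- x) - 2))))// ?gerBl// ler_expR.
    have := @expR_tilt_le x; rewrite (ltW x0) x1 => /(_ isT) h.
    apply: le_trans (ler_wpM2l (ltW t0) h) _.
    by rewrite x2 mulrCA mulfV ?mulr1// gt_eqF.
  rewrite x2 -[(t^-1 * _) ^+ _]invrK -exprVn invfM invrK invrK.
  rewrite ler_wpM2r ?exprn_ge0 ?divr_ge0 ?exprn_ge0 ?(ltW t0) ?(ltW aR)//.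
  rewrite /C ler_wpM2r ?(ltW D0)// ler_wpM2l// lerDl mulr_ge0 ?expR_ge0// ltW.
apply: le_trans (key 1 (t * e * expR e) ltr01 _ t0) _.
  have h1 := @expR_tilt_le 1; rewrite ler01 lexx expr1n mulr1 in h1; move: (h1 isT) => {h1} h1.
  apply: (@le_trans _ _ (expR (t * e) - 1)).
    by rewrite lerD2r ler_expR ler_wpM2l.
  have h2 := expR_ge1Dx (- (t * e)).
  have h3 := expRxMexpNx_1 (t * e).
  apply: (@le_trans _ _ (t * e * expR (t * e))).
    have := expR_ge0 (t * e); nra.
  rewrite ler_wpM2l ?mulr_ge0 ?(ltW e0)// ler_expR.
  by rewrite -[leRHS]mul1r ler_wpM2r// ltW.
rewrite expr1n mul1r ler_wpM2r ?invr_ge0 ?exprn_ge0//.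
rewrite /C (_ : 16 * (t * e * expR e) * D = 16 * (e * expR e) * D * t); last by ring.
rewrite ler_wpM2r// ler_wpM2r ?(ltW D0)// ler_wpM2l// lerDr expR_ge0//.
Qed.

End LatticeHeat.

(** * Elementary bounds for the sine *)

Section SineBounds.
Variable R : realType.
Implicit Types (x y z : R).

Lemma sin_MVT y : 0 < y -> exists2 c, c \in `]0, y[ & sin y - sin 0 = cos c * (y - 0).
Proof.
move=> y0; apply: (@MVT R (@sin R) (@cos R) 0 y y0).
by apply: continuous_subspaceT; exact: continuous_sin.
Qed.

Lemma sin_le_id y : 0 <= y -> sin y <= y.
Proof.
rewrite le_eqVlt => /predU1P[<-|y0]; first by rewrite sin0.
have [c _] := sin_MVT y0.
rewrite sin0 !subr0 => ->.
by rewrite -[leRHS]mul1r ler_wpM2r ?cos_le1// ltW.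
Qed.

Lemma mul_cos_le_sin y : 0 <= y <= pi -> y * cos y <= sin y.
Proof.
move=> /andP[]; rewrite le_eqVlt => /predU1P[<-|y0] ypi; first by rewrite sin0 mul0r.
have [c cy] := sin_MVT y0.
rewrite sin0 !subr0 => ->; rewrite mulrC ler_wpM2r ?(ltW y0)//.
move: cy; rewrite in_itv/= => /andP[c0 cy].
have hc : c \in `[0, pi] by rewrite in_itv/= (ltW c0) (le_trans (ltW cy)).
have hy : y \in `[0, pi] by rewrite in_itv/= (ltW y0).
by rewrite leNgt (ltr_cos hy hc) -leNgt ltW.
Qed.

(** The bound has to pass pi/2: folded frequencies reach (a + 1)/2, and pi (a + 1)/(2a) is at most 3
    pi/4 for a >= 2. Halving the angle brings it back to where the cosine is bounded below. *)
Lemma sin_lower_bound : exists2 c : R, 0 < c &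
  forall y, 0 <= y <= 3 / 4 * pi -> c * y <= sin y.
Proof.
pose b : R := 3 / 8 * pi.
have pi0 := pi_gt0 R.
have cb : 0 < cos b.
  by apply: cos_gt0_pihalf; rewrite /b; apply/andP; split; lra.
exists (cos b ^+ 2); first by rewrite exprn_gt0.
move=> y /andP[y0 yb].
have hb : b \in `[0, pi] by rewrite in_itv/= /b; apply/andP; split; lra.
have hy : y / 2 \in `[0, pi] by rewrite in_itv/=; apply/andP; split; lra.
have cby : cos b <= cos (y / 2).
  by rewrite leNgt (ltr_cos hb hy) -leNgt /b; lra.
have s2 : y / 2 * cos (y / 2) <= sin (y / 2) by apply: mul_cos_le_sin; apply/andP; split; lra.
rewrite (_ : sin y = 2 * (sin (y / 2) * cos (y / 2))); last first.
  by rewrite [in LHS](_ : y = y / 2 + y / 2) ?sinD; [ring|field].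
have y2 : 0 <= y / 2 by lra.
apply: (@le_trans _ _ (2 * ((y / 2 * cos (y / 2)) * cos (y / 2)))); last first.
  rewrite ler_pM2l// ler_wpM2r// (le_trans (ltW cb))//.
rewrite (_ : 2 * _ = cos (y / 2) ^+ 2 * y); last by field.
by rewrite ler_wpM2r// ler_sqr ?nnegrE// ltW// (lt_le_trans cb).
Qed.

End SineBounds.

(** * Gaussian decay of the heat trace of a discrete circle *)

Section ThetaSplit.
Variable R : realType.
Implicit Types (x y z t l c r : R).

Definition lattice_mode (a : nat) t x : R := expR (- (t * (2 - 2 * cos (2 * pi * x / a%:R)))).

Lemma lattice_modeE (a : nat) t x :
  lattice_mode a t x = expR (- (t * (4 * sin (pi * x / a%:R) ^+ 2))).
Proof.
rewrite /lattice_mode; congr (expR (- (t * _))).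
rewrite (_ : 2 * pi * x / a%:R = (pi * x / a%:R) + (pi * x / a%:R)); last by ring.
by rewrite cosD -!expr2 cos2sin2; ring.
Qed.

(* The frequencies k + l above a/2 are folded back to a - (k + l). *)
Lemma lattice_theta_split (a : nat) l t : (0 < a)%N ->
  lattice_theta a l t =
  \sum_(k < uphalf a) lattice_mode a t (k%:R + l) +
  \sum_(k < a./2) lattice_mode a t (k.+1%:R - l).
Proof.
move=> a0; have aE : a = (uphalf a + a./2)%N by rewrite uphalf_half -addnA addnn odd_double_half.
have -> : lattice_theta a l t = \sum_(k < a) lattice_mode a t (k%:R + l) by [].
rewrite -(big_mkord xpredT (fun k => lattice_mode a t (k%:R + l))).
rewrite (big_cat_nat (n := uphalf a))//=; last by rewrite {2}aE leq_addr.
rewrite big_mkord; congr (_ + _).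
rewrite -{1}(add0n (uphalf a)) big_addn (_ : (a - uphalf a)%N = a./2); last by lia.
rewrite big_nat_rev/= add0n big_mkord; apply: eq_bigr => k _.
have ka := ltn_ord k.
rewrite /lattice_mode; congr (expR (- (t * (2 - 2 * _)))).
have -> : (a./2 - k.+1 + uphalf a)%N = (a - k.+1)%N by lia.
rewrite natrB; last by lia.
have aR : (a%:R : R) != 0 by rewrite pnatr_eq0 -lt0n.
rewrite (_ : 2 * pi * (a%:R - k.+1%:R + l) / a%:R = - (2 * pi * (k.+1%:R - l) / a%:R) + 2 * pi * 1%:R).
  by rewrite cos_add_2pin cosN.
by field.
Qed.

Lemma lattice_mode_le : exists2 c : R, 0 < c & forall (a : nat) t x,
  (1 < a)%N -> 0 <= t -> 0 <= x -> x <= (a%:R + 1) / 2 ->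
  lattice_mode a t x <= expR (- (c * (t / a%:R ^+ 2) * x ^+ 2)).
Proof.
have [c c0 hc] := sin_lower_bound R; have pi0 := pi_gt0 R.
exists (4 * (c * pi) ^+ 2); first by rewrite mulr_gt0// exprn_gt0// mulr_gt0.
move=> a t x a1 t0 x0 xa; rewrite lattice_modeE ler_expR lerN2.
have aR : 0 < a%:R :> R by rewrite ltr0n ltnW.
have a2 : 2 <= a%:R :> R by rewrite (ler_nat R 2).
rewrite (_ : _ * x ^+ 2 = t * (4 * (c * (pi * x / a%:R)) ^+ 2)); last first.
  by field; rewrite gt_eqF.
rewrite ler_wpM2l// ler_pM2l//.
have y0 : 0 <= pi * x / a%:R by rewrite divr_ge0 ?mulr_ge0// ltW.
have hy : pi * x / a%:R <= 3 / 4 * pi.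
  rewrite ler_pdivrMr// (_ : 3 / 4 * pi * a%:R = pi * (3 / 4 * a%:R)); last by ring.
  by rewrite ler_pM2l//; lra.
have h : c * (pi * x / a%:R) <= sin (pi * x / a%:R) by apply: hc; rewrite y0.
have h0 : 0 <= c * (pi * x / a%:R) by rewrite mulr_ge0// ltW.
by rewrite ler_sqr ?nnegrE// (le_trans h0).
Qed.

(** The sum of the whole geometric series is 1/(1 - e^-c), and e^c >= 1 + c bounds it by 1 + 1/c. *)
Lemma geometric_expR_le c n : 0 < c -> \sum_(k < n) expR (- (c * k%:R)) <= 1 + c^-1.
Proof.
move=> c0; have q1 : expR (- c) < 1 by rewrite -[ltRHS]expR0 ltr_expR oppr_lt0.
have h : (\sum_(k < n) expR (- (c * k%:R))) * (1 - expR (- c)) = 1 - expR (- (c * n%:R)).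
  elim: n => [|n IH]; first by rewrite big_ord0 mul0r mulr0 oppr0 expR0 subrr.
  rewrite big_ord_recr/= mulrDl IH mulrBr mulr1 -expRD -opprD -[n.+1%:R]natr1 mulrDr mulr1.
  ring.
have ec := expR_ge1Dx c; have ee := expRxMexpNx_1 c.
have e0 := expR_gt0 (- c).
have e1 : expR (- c) * (1 + c) <= 1 by rewrite -[leRHS]ee [leRHS]mulrC ler_pM2l.
rewrite -(@ler_pM2r _ (1 - expR (- c))) ?subr_gt0// h.
apply: (@le_trans _ _ 1); first by rewrite gerBl expR_ge0.
rewrite -(ler_pM2r c0) mul1r mulrAC mulrDl mulVf ?gt_eqF// mul1r.
nra.
Qed.

Lemma half_shift_bounds (a k : nat) l : (1 < a)%N -> 0 <= l <= 1 ->
  ((k < uphalf a)%N -> 0 <= k%:R + l /\ k%:R + l <= (a%:R + 1) / 2) /\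
  ((k < a./2)%N -> 0 <= k.+1%:R - l /\ k.+1%:R - l <= (a%:R + 1) / 2).
Proof.
move=> a1 /andP[l0 l1]; split => ka.
  have : ((k + 1).*2 <= a + 1)%N by lia.
  rewrite -(ler_nat R) -muln2 natrM !natrD => h; have := ler0n R k; lra.
have : (k.+1.*2 <= a)%N by lia.
rewrite -(ler_nat R) -muln2 natrM -[k.+1%:R]natr1 => h; have := ler0n R k; lra.
Qed.

(** For delta > 0 this is exponential decay in t/a^2, for l away from the integers; for delta = 0 it
    is a bound of order 1 + a^2/t valid for every l in [0, 1]. Both uses occur below. *)
Lemma lattice_theta_decay : exists2 c : R, 0 < c & forall (a : nat) l t delta,
  (1 < a)%N -> 0 < t -> 0 <= delta -> delta <= l <= 1 - delta ->
  lattice_theta a l t <= 2 * expR (- (c * (t / a%:R ^+ 2) * delta ^+ 2)) * (1 + (c * (t / a%:R ^+ 2))^-1).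
Proof.
have [c c0 hc] := lattice_mode_le.
exists (c / 2); first by rewrite divr_gt0.
move=> a l t delta a1 t0 d0 /andP[dl ld].
have aR : 0 < a%:R :> R by rewrite ltr0n ltnW.
have l01 : 0 <= l <= 1 by apply/andP; split; lra.
(* Half of the Gaussian rate: 2 x^2 >= delta^2 + k, so one half of the exponent pays for the decay
   and the other one for the summation over k. *)
pose q := c / 2 * (t / a%:R ^+ 2).
have q0 : 0 < q by rewrite mulr_gt0 ?divr_gt0// exprn_gt0.
have step (k : nat) x : k%:R <= x -> delta <= x -> 0 <= x -> x <= (a%:R + 1) / 2 ->
    lattice_mode a t x <= expR (- (q * delta ^+ 2)) * expR (- (q * k%:R)).
  move=> kx dx x0 xa; apply: le_trans (hc a t x a1 (ltW t0) x0 xa) _.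
  rewrite -expRD ler_expR -opprD lerN2 (_ : c * _ * _ = q * (2 * x ^+ 2)); last first.
    by rewrite /q; field; rewrite gt_eqF.
  rewrite -mulrDr ler_pM2l//.
  have h1 : delta ^+ 2 <= x ^+ 2 by rewrite ler_sqr.
  have h2 : k%:R <= x ^+ 2.
    apply: (@le_trans _ _ (k%:R ^+ 2)); last by rewrite ler_sqr ?nnegrE.
    by rewrite -natrX ler_nat -mulnn; case: (k) => // j; rewrite leq_pmull.
  lra.
rewrite (@lattice_theta_split a l t (ltnW a1)).
rewrite [leRHS](_ : _ = expR (- (q * delta ^+ 2)) * (1 + q^-1) + expR (- (q * delta ^+ 2)) * (1 + q^-1)); last by rewrite -/q; ring.
have G n (f : nat -> R) : (forall k, (k < n)%N -> f k <= expR (- (q * delta ^+ 2)) * expR (- (q * k%:R))) ->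
    \sum_(k < n) f k <= expR (- (q * delta ^+ 2)) * (1 + q^-1).
  move=> hf; apply: (@le_trans _ _ (\sum_(k < n) expR (- (q * delta ^+ 2)) * expR (- (q * k%:R)))).
    by apply: ler_sum => k _; apply: hf.
  by rewrite -mulr_sumr ler_wpM2l ?expR_ge0// geometric_expR_le.
apply: lerD.
  apply: (G _ (fun k => lattice_mode a t (k%:R + l))) => k ka.
  have [[//|x0 xa] _] := half_shift_bounds k a1 l01.
  by apply: step => //; [lra|have := ler0n R k; lra].
apply: (G _ (fun k => lattice_mode a t (k.+1%:R - l))) => k ka.
have [_ [//|x0 xa]] := half_shift_bounds k a1 l01.
by apply: step => //; rewrite -[k.+1%:R]natr1; have := ler0n R k; lra.
Qed.

End ThetaSplit.

Section Tannery.
Variables (R : realType) (T : Type) (F : set_system T) (FF : ProperFilter F).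

Lemma tannery (f : T -> nat -> R) (h : T -> nat) (g : nat -> R) (r : R) :
  0 <= r < 1 -> (\forall x \near F, forall k, (k < h x)%N -> `|f x k| <= r ^+ k) ->
  (forall k, f ^~ k @ F --> g k) -> (forall m, \forall x \near F, (m <= h x)%N) ->
  cvgn (series g) /\ (fun x => \sum_(k < h x) f x k) @ F --> limn (series g).
Proof.
move=> /andP[r0 r1] fr fg hinf.
have gr k : `|g k| <= r ^+ k.
  have fgk := cvg_norm (fg k) _; apply: (cvgr_to_le (fgk _)).
  by apply: filterS2 fr (hinf k.+1) => x H kx; exact: H.
have cg : cvgn (series g).
  apply: normed_cvg; apply: (@series_le_cvg _ _ (geometric 1 r)).
  - by move=> n; exact: normr_ge0.
  - by move=> n; rewrite /geometric/= mul1r exprn_ge0.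
  - by move=> n; rewrite /geometric/= mul1r.
  - by apply: is_cvg_geometric_series; rewrite ger0_norm.
split => //; apply/cvgrPdist_le => e e0.
have e3 : 0 < e / 3 by rewrite divr_gt0.
have r1' : 0 < 1 - r by rewrite subr_gt0.
have : (fun n => r ^+ n / (1 - r)) @ \oo --> 0 * (1 - r)^-1.
  by apply: cvgM; [apply: cvg_expr; rewrite ger0_norm|exact: cvg_cst].
rewrite mul0r => /cvgrPdist_le/(_ _ e3)[m1 _ hm1].
have /cvgrPdist_le/(_ _ e3)[m2 _ hm2] := cg.
pose m := maxn m1 m2.
have tail n (u : nat -> R) : (forall k, (k < n)%N -> `|u k| <= r ^+ k) ->
    `|\sum_(m <= k < n) u k| <= e / 3.
  move=> ur; apply: le_trans (ler_norm_sum _ _ _) _.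
  have := hm1 m (leq_maxl _ _); rewrite sub0r normrN ger0_norm ?divr_ge0 ?exprn_ge0 ?(ltW r1')//.
  apply: le_trans; rewrite ler_pdivlMr//.
  apply: (@le_trans _ _ ((\sum_(m <= k < n) r ^+ k) * (1 - r))).
    rewrite ler_pM2r// !big_nat; apply: ler_sum => k /andP[_ kn]; exact: ur.
  have [nm|mn] := leqP n m; first by rewrite big_geq// mul0r exprn_ge0.
  suff -> : (\sum_(m <= k < n) r ^+ k) * (1 - r) = r ^+ m - r ^+ n.
    by rewrite gerBl exprn_ge0.
  rewrite -(subnKC (ltnW mn)); elim: (n - m)%N => [|j IH].
    by rewrite addn0 big_geq// mul0r subrr.
  rewrite addnS big_nat_recr ?leq_addr//= mulrDl IH exprS; ring.
have part : (fun x => \sum_(k < m) f x k) @ F --> \sum_(k < m) g k.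
  by apply: (@cvg_finite_sum _ _ _ _ _ _ (fun (k : 'I_m) x => f x k)) => k; exact: fg.
have tg : `|limn (series g) - \sum_(k < m) g k| <= e / 3.
  by have := hm2 m (leq_maxr _ _); rewrite seriesEord.
have /cvgrPdist_le/(_ _ e3) := part.
apply: filterS3 fr (hinf m) => x xr mx hx.
rewrite -(big_mkord xpredT (f x)) (big_cat_nat (n := m))//= big_mkord.
have tx := tail (h x) (f x) xr.
rewrite (_ : _ - (_ + _) = (limn (series g) - \sum_(k < m) g k) +
  ((\sum_(k < m) g k - \sum_(k < m) f x k) - \sum_(m <= k < h x) f x k)); last by ring.
apply: le_trans (ler_normD _ _) _; have := ler_normB (\sum_(k < m) g k - \sum_(k < m) f x k) (\sum_(m <= k < h x) f x k).
lra.
Qed.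

End Tannery.

(** * Convergence to theta functions and decay of the heat kernel of the integers *)

Section ThetaLimit.
Variable R : realType.
Implicit Types (c q : R).

(** The terms of indices k and - (k + 1) of the two-sided sum of e^(-c (k + l)^2) over the integers,
    grouped as in [lattice_theta_split]. *)
Definition theta_line_term (c l : R) (k : nat) : R :=
  expR (- (c * (k%:R + l) ^+ 2)) + expR (- (c * (k.+1%:R - l) ^+ 2)).

Definition theta_line c (l : R) : R := limn (series (theta_line_term c l)).

Section Filtered.
Context (T : Type) (F : set_system T) {FF : ProperFilter F}.
Variables (a : T -> nat) (t : T -> R) (q : R).
Hypothesis q_gt0 : 0 < q.
Hypothesis a_infty : forall m, \forall x \near F, (m <= a x)%N.
Hypothesis t_cvg : (fun x => t x / (a x)%:R ^+ 2) @ F --> q.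

Lemma cvg_inv_natr : (fun x => (a x)%:R^-1 : R) @ F --> (0 : R).
Proof.
apply/cvgrPdist_le => e e0; apply: filterS (a_infty (Num.truncn e^-1).+1) => x ax.
have ax0 : 0 < (a x)%:R :> R by rewrite ltr0n (leq_ltn_trans _ ax).
rewrite sub0r normrN ger0_norm ?invr_ge0 ?(ltW ax0)// invf_ple ?posrE//.
by apply: ltW; apply: lt_le_trans (truncnS_gt _) _; rewrite ler_nat.
Qed.

(** a sin(pi X / a) tends to pi X, squeezed between pi X cos(pi X / a) and pi X. *)
Lemma lattice_mode_cvg (X : T -> R) (X0 : R) : (\forall x \near F, 0 <= X x) ->
  X @ F --> X0 ->
  (fun x => lattice_mode (a x) (t x) (X x)) @ F --> expR (- (4 * pi ^+ 2 * q * X0 ^+ 2)).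
Proof.
move=> Xge0 XX0; have pi0 := pi_gt0 R.
have y0 : (fun x => pi * X x / (a x)%:R) @ F --> (0 : R).
  rewrite -(mulr0 (pi * X0)); apply: cvgM; last exact: cvg_inv_natr.
  by apply: cvgM => //; exact: cvg_cst.
have sc : (fun x => (a x)%:R * sin (pi * X x / (a x)%:R)) @ F --> pi * X0.
  apply: (@squeeze_cvgr _ _ _ _ (fun x => pi * X x * cos (pi * X x / (a x)%:R)) (fun x => pi * X x)).
  - have /cvgrPdist_le/(_ _ pi0) := y0.
    apply: filterS3 Xge0 (a_infty 1) => x X0x ax ypi.
    have aR : 0 < (a x)%:R :> R by rewrite ltr0n.
    have yx0 : 0 <= pi * X x / (a x)%:R by rewrite divr_ge0 ?mulr_ge0// ltW.
    rewrite sub0r normrN ger0_norm// in ypi.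
    apply/andP; split.
      rewrite -ler_pdivrMl//.
      rewrite (_ : (a x)%:R^-1 * (pi * X x * cos (pi * X x / (a x)%:R)) =
        pi * X x / (a x)%:R * cos (pi * X x / (a x)%:R)); last by ring.
      by apply: mul_cos_le_sin; rewrite yx0.
    by rewrite -ler_pdivlMl// [leRHS]mulrC; exact: sin_le_id.
  - rewrite -[X in _ --> X]mulr1; apply: cvgM; first by apply: cvgM => //; exact: cvg_cst.
    have := @continuous_cos R 0; rewrite /continuous_at cos0 => c0.
    exact: (@cvg_comp _ _ _ (fun x => pi * X x / (a x)%:R) (@cos R) _ _ _ y0 c0).
  - by apply: cvgM => //; exact: cvg_cst.
have -> : expR (- (4 * pi ^+ 2 * q * X0 ^+ 2)) = expR (- (4 * (q * (pi * X0) ^+ 2))).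
  by congr expR; ring.
apply: (@cvg_trans _ ((fun x => expR (- (4 * (t x / (a x)%:R ^+ 2 *
    ((a x)%:R * sin (pi * X x / (a x)%:R)) ^+ 2)))) @ F)).
  apply: near_eq_cvg; apply: filterS (a_infty 1) => x ax.
  have aR : 0 < (a x)%:R :> R by rewrite ltr0n.
  rewrite lattice_modeE; congr (expR (- _)).
  by field; rewrite gt_eqF.
apply: (@cvg_comp _ _ _ (fun x => - (4 * (t x / (a x)%:R ^+ 2 *
    ((a x)%:R * sin (pi * X x / (a x)%:R)) ^+ 2))) (@expR R)); last exact: continuous_expR.
apply: cvgN; apply: cvgM; first exact: cvg_cst.
apply: cvgM => //; rewrite expr2.
have -> : (fun x => ((a x)%:R * sin (pi * X x / (a x)%:R)) ^+ 2) =
  (fun x => ((a x)%:R * sin (pi * X x / (a x)%:R)) * ((a x)%:R * sin (pi * X x / (a x)%:R))).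
  by apply/funext => x; rewrite expr2.
exact: cvgM.
Qed.

(** Tannery's theorem on both halves of [lattice_theta_split]. The filter is arbitrary, as the limit
    is taken along n for the tori and along t -> +oo in [heat0_limit]. *)
Lemma lattice_theta_cvg (l : T -> R) (l0 : R) : (\forall x \near F, 0 <= l x <= 1) ->
  l @ F --> l0 ->
  cvgn (series (theta_line_term (4 * pi ^+ 2 * q) l0)) /\
  (fun x => lattice_theta (a x) (l x) (t x)) @ F --> theta_line (4 * pi ^+ 2 * q) l0.
Proof.
move=> l01 ll0; have [c c0 hc] := lattice_mode_le R.
(* Eventually t/a^2 >= q/2, and X^2 >= k for X >= k: the k-th mode is then at most r^k. *)
pose r := expR (- (c * (q / 2))).
have cq : 0 < c * (q / 2) by rewrite mulr_gt0 ?divr_gt0.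
have r01 : 0 <= r < 1 by rewrite expR_ge0 -[ltRHS]expR0 ltr_expR oppr_lt0.
have q2 : q / 2 < q by rewrite ltr_pdivrMr// ltr_pMr// ltr1n.
have qn : \forall x \near F, q / 2 <= t x / (a x)%:R ^+ 2 by exact: cvgr_ge t_cvg _ q2.
have rk k : r ^+ k = expR (- (c * (q / 2) * k%:R)).
  by rewrite -expRM_natl; congr expR; ring.
have good : \forall x \near F, (0 <= l x <= 1) /\ (forall (k : nat) X, 0 <= X -> k%:R <= X ->
    X <= ((a x)%:R + 1) / 2 -> `|lattice_mode (a x) (t x) X| <= r ^+ k) /\ (1 < a x)%N.
  apply: filterS3 l01 qn (a_infty 2) => x lx qx ax; split => //; split => // k X X0 kX Xa.
  have aR : 0 < (a x)%:R :> R by rewrite ltr0n (leq_ltn_trans _ ax).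
  have t0 : 0 <= t x.
    have : 0 <= t x / (a x)%:R ^+ 2 by apply: le_trans qx; rewrite divr_ge0// ltW.
    by rewrite pmulr_lge0// invr_gt0 exprn_gt0.
  rewrite ger0_norm ?expR_ge0//; apply: le_trans (hc _ _ _ ax t0 X0 Xa) _.
  rewrite rk ler_expR lerN2.
  have kX2 : k%:R <= X ^+ 2.
    apply: (@le_trans _ _ (k%:R ^+ 2)); last by rewrite ler_sqr ?nnegrE.
    by rewrite -natrX ler_nat -mulnn; case: (k) => // j; rewrite leq_pmull.
  apply: ler_pM => //; first exact: ltW.
  by rewrite ler_pM2l.
have lim1 (k : nat) : (fun x => lattice_mode (a x) (t x) (k%:R + l x)) @ F -->
    expR (- (4 * pi ^+ 2 * q * (k%:R + l0) ^+ 2)).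
  apply: lattice_mode_cvg; last by apply: cvgD => //; exact: cvg_cst.
  by apply: filterS l01 => x /andP[lx _]; rewrite addr_ge0.
have lim2 (k : nat) : (fun x => lattice_mode (a x) (t x) (k.+1%:R - l x)) @ F -->
    expR (- (4 * pi ^+ 2 * q * (k.+1%:R - l0) ^+ 2)).
  apply: lattice_mode_cvg; last by apply: cvgB => //; exact: cvg_cst.
  by apply: filterS l01 => x /andP[_ lx]; rewrite subr_ge0 (le_trans lx)// ler1n.
have [c1 t1] : cvgn (series (fun k : nat => expR (- (4 * pi ^+ 2 * q * (k%:R + l0) ^+ 2)))) /\
    (fun x => \sum_(k < uphalf (a x)) lattice_mode (a x) (t x) (k%:R + l x)) @ F -->
    limn (series (fun k : nat => expR (- (4 * pi ^+ 2 * q * (k%:R + l0) ^+ 2)))).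
  apply: (@tannery R T F _ (fun x k => lattice_mode (a x) (t x) (k%:R + l x)) (fun x => uphalf (a x)) _ r) => //.
    apply: filterS good => x [lx [gx ax]] k ka.
    have [[//|x0 xa] _] := half_shift_bounds k ax lx.
    by apply: gx => //; rewrite lerDl; case/andP: lx.
  by move=> m; apply: filterS (a_infty m.*2) => x ax; lia.
have [c2 t2] : cvgn (series (fun k : nat => expR (- (4 * pi ^+ 2 * q * (k.+1%:R - l0) ^+ 2)))) /\
    (fun x => \sum_(k < (a x)./2) lattice_mode (a x) (t x) (k.+1%:R - l x)) @ F -->
    limn (series (fun k : nat => expR (- (4 * pi ^+ 2 * q * (k.+1%:R - l0) ^+ 2)))).
  apply: (@tannery R T F _ (fun x k => lattice_mode (a x) (t x) (k.+1%:R - l x)) (fun x => (a x)./2) _ r) => //.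
    apply: filterS good => x [lx [gx ax]] k ka.
    have [_ [//|x0 xa]] := half_shift_bounds k ax lx.
    apply: gx => //; rewrite -[k.+1%:R]natr1; case/andP: lx => _ lx; lra.
  by move=> m; apply: filterS (a_infty m.*2) => x ax; lia.
have sE : series (theta_line_term (4 * pi ^+ 2 * q) l0) =
    series (fun k : nat => expR (- (4 * pi ^+ 2 * q * (k%:R + l0) ^+ 2))) \+
    series (fun k : nat => expR (- (4 * pi ^+ 2 * q * (k.+1%:R - l0) ^+ 2))).
  by apply/funext => n; rewrite !seriesEord/= -big_split.
rewrite /theta_line sE; split; first exact: is_cvgD.
rewrite limD//; apply: (@cvg_trans _ ((fun x =>
  \sum_(k < uphalf (a x)) lattice_mode (a x) (t x) (k%:R + l x) +
  \sum_(k < (a x)./2) lattice_mode (a x) (t x) (k.+1%:R - l x)) @ F)).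
  by apply: near_eq_cvg; apply: filterS (a_infty 1) => x ax; rewrite lattice_theta_split.
exact: cvgD.
Qed.

End Filtered.

(** Convergence of the theta series is a by-product of [lattice_theta_cvg], applied to the circles
    with n points at time q n^2. *)
Lemma cvg_theta_line c l : 0 < c -> 0 <= l <= 1 ->
  series (theta_line_term c l) @ \oo --> theta_line c l.
Proof.
move=> c0 l01; have pi0 := pi_gt0 R.
pose q := c / (4 * pi ^+ 2).
have p0 : 0 < 4 * pi ^+ 2 :> R by rewrite mulr_gt0// exprn_gt0.
have q0 : 0 < q by rewrite divr_gt0.
have [] := @lattice_theta_cvg nat \oo _ id (fun n => q * n%:R ^+ 2) q q0 _ _ (fun=> l) l.
- by move=> m; exists m.
- apply: cvg_near_cst; exists 1%N => // n /= n0.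
  by rewrite mulfK// expf_neq0// pnatr_eq0 -lt0n.
- exact: nearW.
- exact: cvg_cst.
by rewrite /q mulrC divfK// gt_eqF.
Qed.

Lemma heat0_bounded : exists2 C : R, 0 <= C & forall t, 0 < t -> Num.sqrt t * heat0 t <= C.
Proof.
have [C C0 hC] := @lattice_theta_heat0_bound R 0.
have [c c0 hc] := lattice_theta_decay R.
exists (2 * (1 + 4 / c) + 1 + C).
  by rewrite addr_ge0// addr_ge0// mulr_ge0// addr_ge0// divr_ge0// ltW.
move=> t t0; have h0 := heat0_ge0 (ltW t0).
have [t1|t1] := leP 1 t.
  have s1 : 1 <= Num.sqrt t by rewrite -[leLHS]sqrtr1 ler_sqrt// ltW.
  have s0 : 0 < Num.sqrt t by exact: lt_le_trans s1.
  (* A circle of about sqrt t points: t/a^2 lies in [1/4, 1], so its heat trace is bounded and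
     differs from a heat0(t) by at most C. *)
  pose a := (Num.truncn (Num.sqrt t)).+1.
  have sa : Num.sqrt t <= a%:R by apply: ltW; exact: truncnS_gt.
  have as2 : a%:R <= 2 * Num.sqrt t.
    have : (Num.truncn (Num.sqrt t))%:R <= Num.sqrt t by rewrite truncn_le ltW.
    rewrite /a -[_.+1%:R]natr1; lra.
  have a1 : (1 < a)%N by rewrite /a ltnS truncn_gt0.
  have aR : 0 < a%:R :> R by rewrite ltr0n.
  have tE : t = Num.sqrt t ^+ 2 by rewrite sqr_sqrtr// ltW.
  have ta : t / a%:R ^+ 2 <= 1.
    by rewrite ler_pdivrMr ?exprn_gt0// mul1r {1}tE ler_sqr ?nnegrE// ltW.
  have ta4 : 4^-1 <= t / a%:R ^+ 2.
    rewrite ler_pdivlMr ?exprn_gt0// ler_pdivrMl// {1}tE.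
    rewrite (_ : 4 * _ = (2 * Num.sqrt t) ^+ 2); last by ring.
    by rewrite ler_sqr ?nnegrE// ?mulr_ge0// ltW.
  have [/(_ t1) d1 _] := hC a 0 t isT.
  have := hc a 0 t 0 a1 t0 (lexx _); rewrite lexx subr0 ler01 => /(_ isT).
  rewrite expr0n/= mulr0 oppr0 expR0 mulr1 => th.
  apply: (@le_trans _ _ (a%:R * heat0 t)); first by rewrite ler_wpM2r.
  have : `|lattice_theta a 0 t - a%:R * heat0 t| <= C.
    by apply: le_trans d1 _; rewrite expr1 -[leRHS]mulr1 ler_wpM2l.
  rewrite ler_norml => /andP[_ d2]; have {}d2 := d2.
  have : (c * (t / a%:R ^+ 2))^-1 <= 4 / c.
    rewrite invfM mulrC ler_wpM2r ?invr_ge0 ?(ltW c0)//.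
    by rewrite -[leRHS]invrK lef_pV2 ?posrE ?invr_gt0// divr_gt0// exprn_gt0.
  move: d1; rewrite ler_norml => /andP[d1 _] h4.
  have : C * (t / a%:R ^+ 2) ^+ 1 <= C by rewrite expr1 -[leRHS]mulr1 ler_wpM2l.
  lra.
have [_ /(_ (ltW t0) (ltW t1))] := hC 1%N 0 t isT.
rewrite mul1r expr1n expr1n invr1 mulr1 ler_norml => /andP[d1 _].
have th := lattice_theta_le 1 0 (ltW t0).
have s1 : Num.sqrt t <= 1 by rewrite -[leRHS]sqrtr1 ler_sqrt// ltW.
have : Num.sqrt t * heat0 t <= heat0 t by rewrite -[leRHS]mul1r ler_wpM2r.
have : C * t <= C by rewrite -[leRHS]mulr1 ler_wpM2l// ltW.
have : 0 <= 4 / c by rewrite divr_ge0// ltW.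
lra.
Qed.

(* The value (4 pi)^(-1/2) of the limit is never needed. *)
Lemma heat0_limit : exists kappa : R, (fun t => Num.sqrt t * heat0 t) @ +oo --> kappa.
Proof.
have [C C0 hC] := @lattice_theta_heat0_bound R 0.
pose L : R -> R := fun t => Num.sqrt t * heat0 t.
suff cL : cauchy (L @ +oo%R) by exists (lim (L @ +oo%R)); exact: (@cauchy_cvg R _ _ cL).
apply: (@cauchy_exP R R _ _) => e e0.
(* With a(t) close to sqrt(t/u), t/a^2 tends to u, and the error C t/a^2 is eventually at most 2 C
   u, small compared with e. Then sqrt t heat0(t) eventually stays within e of sqrt u times a theta
   value independent of t. *)
pose u := Num.min 1 (e / (8 * (2 * C + 1))).
have D0 : 0 < 2 * C + 1 by rewrite ltr_wpDl// mulr_ge0.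
have u0 : 0 < u by rewrite lt_min ltr01 divr_gt0// mulr_gt0.
have u1 : u <= 1 by rewrite ge_min lexx.
have ue : u * (2 * C + 1) <= e / 8.
  have : u <= e / (8 * (2 * C + 1)) by rewrite ge_min lexx orbT.
  rewrite -(ler_pM2r D0) => /le_trans; apply.
  by rewrite le_eqVlt; apply/orP; left; apply/eqP; field; rewrite gt_eqF.
pose a t := Num.truncn (Num.sqrt (t / u)).
have ainf (m : nat) : \forall t \near +oo%R, (m <= a t)%N.
  apply: filterS (nbhs_pinfty_ge (num_real (m%:R ^+ 2 * u))) => t mt.
  rewrite /a truncn_ge_nat ?sqrtr_ge0// -[leLHS]ger0_norm// -sqrtr_sqr ler_sqrt.
    by rewrite ler_pdivlMr.
  by rewrite divr_ge0 ?(ltW u0)// (le_trans _ mt)// mulr_ge0 ?sqr_ge0// ltW.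
have pos : \forall t \near +oo%R, (0 : R) < t by exact: nbhs_pinfty_gt (num_real 0).
have ratio : (fun t => Num.sqrt (t / u) / (a t)%:R) @ +oo%R --> (1 : R).
  apply: (@squeeze_cvgr _ _ _ _ (fun=> 1) (fun t => 1 + (a t)%:R^-1)).
  - apply: filterS2 (ainf 1%N) pos => t at1 t0.
    have aR : 0 < (a t)%:R :> R by rewrite ltr0n.
    rewrite ler_pdivlMr// mul1r truncn_le sqrtr_ge0/=.
    by rewrite ler_pdivrMr// mulrDl mul1r mulVf ?gt_eqF// natr1 ltW// truncnS_gt.
  - exact: cvg_cst.
  - rewrite -[X in _ --> X]addr0; apply: cvgD; first exact: cvg_cst.
    exact: cvg_inv_natr.
have sE t : 0 < t -> Num.sqrt t / (a t)%:R = Num.sqrt u * (Num.sqrt (t / u) / (a t)%:R).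
  by move=> t0; rewrite mulrA -sqrtrM ?(ltW u0)// [u * _]mulrC divfK ?gt_eqF.
have s_cvg : (fun t => Num.sqrt t / (a t)%:R) @ +oo%R --> Num.sqrt u.
  rewrite -[X in _ --> X]mulr1; apply: (@cvg_trans _
    ((fun t => Num.sqrt u * (Num.sqrt (t / u) / (a t)%:R)) @ +oo%R)).
    by apply: near_eq_cvg; apply: filterS pos => t t0; rewrite sE.
  by apply: cvgM => //; exact: cvg_cst.
have t_cvg : (fun t => t / (a t)%:R ^+ 2) @ +oo%R --> u.
  rewrite -[u](@sqr_sqrtr R)// ?(ltW u0)// expr2; apply: (@cvg_trans _
    ((fun t => Num.sqrt t / (a t)%:R * (Num.sqrt t / (a t)%:R)) @ +oo%R)).
    apply: near_eq_cvg; apply: filterS pos => t t0.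
    by rewrite mulrACA -expr2 sqr_sqrtr ?(ltW t0)// -invfM -expr2.
  exact: cvgM.
have [_ th_cvg] := @lattice_theta_cvg R +oo%R _ a id u u0 ainf t_cvg (fun=> 0) 0
  (nearW _ (fun _ => introT andP (conj (lexx 0) ler01))) (cvg_cst _).
set th := theta_line _ _ in th_cvg.
exists (Num.sqrt u * th) => /=.
have su1 : Num.sqrt u <= 1 by rewrite -[leRHS]sqrtr1 ler_sqrt.
have e8 : 0 < e / 8 by rewrite divr_gt0.
have th1 : 0 < `|th| + 1 by rewrite ltr_wpDl.
have n1 : \forall t \near +oo%R, `|lattice_theta (a t) 0 t - th| <= e / 8.
  by have /cvgrPdist_le/(_ _ e8) := th_cvg; apply: filterS => t; rewrite distrC.
have n2 : \forall t \near +oo%R, `|Num.sqrt t / (a t)%:R - Num.sqrt u| <= Num.min 1 (e / 8 / (`|th| + 1)).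
  have m0 : 0 < Num.min 1 (e / 8 / (`|th| + 1)) by rewrite lt_min ltr01 divr_gt0.
  by have /cvgrPdist_le/(_ _ m0) := s_cvg; apply: filterS => t; rewrite distrC.
have n3 : \forall t \near +oo%R, t / (a t)%:R ^+ 2 <= 2 * u.
  by apply: cvgr_le t_cvg _ _; rewrite ltr_pMl// ltr1n.
have n4 := nbhs_pinfty_ge (num_real (1 : R)).
apply: filterS2 (filterI n1 n2) (filterI (filterI n3 n4) (ainf 1%N)) => t [h1 h2] [[h3 t1] a1].
have t0 : 0 < t by exact: lt_le_trans t1.
have aR : 0 < (a t)%:R :> R by rewrite ltr0n.
have [/(_ t1) d1 _] := hC (a t) 0 t a1.
have d2 : `|lattice_theta (a t) 0 t - (a t)%:R * heat0 t| <= 2 * C * u.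
  by apply: le_trans d1 _; rewrite expr1 mulrAC -mulrA mulrCA mulrA mulrC mulrA [2 * u]mulrC in h3 *; nra.
have s0 : 0 <= Num.sqrt t / (a t)%:R by rewrite divr_ge0// sqrtr_ge0.
move: h2; rewrite le_min => /andP[h2 h2'].
have s2 : Num.sqrt t / (a t)%:R <= 2.
  by move: h2; rewrite ler_norml => /andP[_]; lra.
rewrite -ball_normE/= distrC.
have -> : Num.sqrt t * heat0 t - Num.sqrt u * th =
    (Num.sqrt t / (a t)%:R) * ((a t)%:R * heat0 t - th) + (Num.sqrt t / (a t)%:R - Num.sqrt u) * th.
  by field; rewrite gt_eqF.
have b1 : `|(a t)%:R * heat0 t - th| <= e / 4.
  rewrite (_ : _ - th = (lattice_theta (a t) 0 t - th) - (lattice_theta (a t) 0 t - (a t)%:R * heat0 t)); last by ring.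
  by apply: le_trans (ler_normB _ _) _; nra.
have b2 : `|(Num.sqrt t / (a t)%:R - Num.sqrt u) * th| <= e / 8.
  rewrite normrM; apply: (@le_trans _ _ (e / 8 / (`|th| + 1) * (`|th| + 1))).
    by apply: ler_pM => //; rewrite lerDl.
  by rewrite divfK// gt_eqF.
apply: le_lt_trans (ler_normD _ _) _; rewrite normrM (ger0_norm s0).
have : Num.sqrt t / (a t)%:R * `|(a t)%:R * heat0 t - th| <= 2 * (e / 4) by apply: ler_pM.
lra.
Qed.

End ThetaLimit.

(** * Heat traces of discrete tori *)

Section ProductComparison.
Variable R : realType.

(** Factors are exchanged one at a time. The X on the left replaces the exponent [size r - 1] on the
    right, which would be awkward for the empty product. *)
Lemma prod_diff_le (I : Type) (r : seq I) (x y : I -> R) (X delta : R) :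
  0 <= X -> 0 <= delta ->
  (forall i, `|x i| <= X) -> (forall i, `|y i| <= X) -> (forall i, `|x i - y i| <= delta) ->
  X * `|\prod_(i <- r) x i - \prod_(i <- r) y i| <= (size r)%:R * delta * X ^+ size r.
Proof.
move=> X0 d0 xX yX xy.
have prodX (z : I -> R) s : (forall i, `|z i| <= X) -> `|\prod_(i <- s) z i| <= X ^+ size s.
  move=> zX; rewrite normr_prod; elim: s => [|i s IH]; first by rewrite big_nil.
  by rewrite big_cons exprS; apply: ler_pM => //; rewrite prodr_ge0.
elim: r => [|i s IH]; first by rewrite !big_nil subrr normr0 mulr0 !mul0r.
rewrite !big_cons /=.
rewrite (_ : _ - _ = (x i - y i) * \prod_(j <- s) x j +
  y i * (\prod_(j <- s) x j - \prod_(j <- s) y j)); last by ring.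
apply: le_trans (ler_wpM2l X0 (ler_normD _ _)) _; rewrite !normrM mulrDr.
have h1 : X * (`|x i - y i| * `|\prod_(j <- s) x j|) <= X * (delta * X ^+ size s).
  by rewrite ler_wpM2l//; apply: ler_pM => //; exact: prodX.
have h2 : X * (`|y i| * `|\prod_(j <- s) x j - \prod_(j <- s) y j|) <=
    X * ((size s)%:R * delta * X ^+ size s).
  by rewrite mulrCA; apply: ler_pM => //; rewrite mulr_ge0.
apply: le_trans (lerD h1 h2) _; rewrite -[(size s).+1%:R]natr1 exprS.
by rewrite le_eqVlt; apply/orP; left; apply/eqP; ring.
Qed.

Lemma inv_sqrt_expn (d : nat) (u : R) : 0 < u ->
  ((Num.sqrt u)^-1) ^+ d = u `^ (- (d%:R / 2)).
Proof.
move=> u0; have s0 : 0 <= Num.sqrt u by exact: sqrtr_ge0.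
rewrite exprVn -powR_mulrn// -powR12_sqrt ?(ltW u0)// -powRrM -powRN.
by congr (_ `^ _); ring.
Qed.

End ProductComparison.

(** * Scaling limit of the heat trace of the torus, and its domination *)

Section HeatLimit.
Variables (R : realType) (d : nat).
Hypothesis d_gt0 : (0 < d)%N.
Variables (a : 'I_d -> nat -> nat) (alpha : 'I_d -> R).
Variables (lambdan : 'I_d -> nat -> R) (lambda : 'I_d -> R).
Hypothesis a_cvg : forall i, (fun n : nat => (a i n)%:R / n%:R : R) @ \oo --> alpha i.
Hypothesis alpha_gt0 : forall i, 0 < alpha i.
Hypothesis lambdan_itv : forall i n, (0 < n)%N -> 0 <= lambdan i n < 1.
Hypothesis lambdan_cvg : forall i, lambdan i n @[n --> \oo] --> lambda i.
Hypothesis lambda_itv : forall i, 0 <= lambda i <= 1.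
Variable i0 : 'I_d.
Hypothesis lambda_neq0 : lambda i0 != 0.
Hypothesis lambda_neq1 : lambda i0 != 1.
Variable kappa : R.
Hypothesis kappa_lim : (fun t => Num.sqrt t * heat0 t) @ +oo --> kappa.

Local Notation mu := (@lebesgue_measure R).
Local Notation pos := (`]0, +oo[%classic : set R).

Definition torus_theta (n : nat) (t : R) : R := \prod_(i < d) lattice_theta (a i n) (lambdan i n) t.

Definition torus_heat (n : nat) (t : R) : R := \prod_(i < d) ((a i n)%:R * heat0 t).

Definition theta_lim (u : R) : R :=
  \prod_(i < d) theta_line (4 * pi ^+ 2 * (u / alpha i ^+ 2)) (lambda i).

(** The constant V of the overview. *)
Definition heat_const : R := \prod_(i < d) (alpha i * kappa).

Lemma near_gt0 : \forall n \near \oo, (0 < n)%N.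
Proof. by exists 1%N. Qed.

Lemma near_lambdan i : \forall n \near \oo, 0 <= lambdan i n <= 1.
Proof.
by apply: filterS near_gt0 => n n0; have /andP[-> /ltW] := lambdan_itv i n0.
Qed.

Lemma a_infty i m : \forall n \near \oo, (m <= a i n)%N.
Proof.
have h : alpha i / 2 < alpha i by rewrite ltr_pdivrMr// ltr_pMr// ltr1n.
have hn : \forall n \near \oo, alpha i / 2 <= (a i n)%:R / n%:R.
  by exact: cvgr_ge (@a_cvg i) _ h.
have h2 : \forall n \near \oo, m%:R / (alpha i / 2) <= n%:R :> R.
  exists (Num.truncn (m%:R / (alpha i / 2))).+1 => // n /= mn.
  by apply: ltW; apply: lt_le_trans (truncnS_gt _) _; rewrite ler_nat.
apply: filterS3 hn h2 near_gt0 => n an mn n0.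
rewrite -(ler_nat R); have nR : 0 < n%:R :> R by rewrite ltr0n.
move: mn; rewrite ler_pdivrMr ?divr_gt0// => /le_trans; apply.
by move: an; rewrite ler_pdivlMr// mulrC.
Qed.

Lemma cvg_scaled_time i u : 0 < u ->
  (fun n : nat => n%:R ^+ 2 * u / (a i n)%:R ^+ 2) @ \oo --> u / alpha i ^+ 2.
Proof.
move=> u0.
have aV : (fun n : nat => ((a i n)%:R / n%:R)^-1 : R) @ \oo --> (alpha i)^-1.
  by apply: cvgV; [exact: lt0r_neq0|exact: a_cvg].
rewrite (_ : u / alpha i ^+ 2 = u * ((alpha i)^-1 * (alpha i)^-1)); last first.
  by rewrite -invfM expr2.
apply: (@cvg_trans _ ((fun n : nat => u * (((a i n)%:R / n%:R)^-1 * ((a i n)%:R / n%:R)^-1)) @ \oo)).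
  apply: near_eq_cvg; apply: filterS near_gt0 => n n0.
  by rewrite invf_div -exprVn; ring.
have aV2 : (fun n : nat => ((a i n)%:R / n%:R)^-1 * ((a i n)%:R / n%:R)^-1 : R) @ \oo -->
    (alpha i)^-1 * (alpha i)^-1 by apply: cvgM; exact: aV.
by apply: cvgM; first exact: cvg_cst.
Qed.

Lemma cvg_torus_theta u : 0 < u ->
  (fun n : nat => torus_theta n (n%:R ^+ 2 * u)) @ \oo --> theta_lim u.
Proof.
move=> u0.
apply: (@cvg_finite_prod _ _ _ _ _ _ (fun i n => lattice_theta (a i n) (lambdan i n) (n%:R ^+ 2 * u))) => i.
have q0 : 0 < u / alpha i ^+ 2 by rewrite divr_gt0// exprn_gt0.
have [_ h] := lattice_theta_cvg q0 (a_infty i) (@cvg_scaled_time i _ u0) (near_lambdan i) (@lambdan_cvg i).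
exact: h.
Qed.

Lemma cvg_torus_heat u : 0 < u ->
  (fun n : nat => torus_heat n (n%:R ^+ 2 * u)) @ \oo --> heat_const * u `^ (- (d%:R / 2)).
Proof.
move=> u0; have su : 0 < Num.sqrt u by rewrite sqrtr_gt0.
rewrite -inv_sqrt_expn// -[X in _ ^+ X]card_ord -prodr_const -big_split/=.
apply: (@cvg_finite_prod _ _ _ _ _ _ (fun i n => (a i n)%:R * heat0 (n%:R ^+ 2 * u))) => i.
apply: (@cvg_trans _ ((fun n : nat => ((a i n)%:R / n%:R) *
   (Num.sqrt (n%:R ^+ 2 * u) * heat0 (n%:R ^+ 2 * u)) * (Num.sqrt u)^-1) @ \oo)).
  apply: near_eq_cvg; apply: filterS near_gt0 => n n0.
  have nR : 0 < n%:R :> R by rewrite ltr0n.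
  rewrite sqrtrM ?sqr_ge0// sqrtr_sqr ger0_norm ?(ltW nR)//.
  by field; rewrite !gt_eqF.
apply: cvgM; last exact: cvg_cst.
apply: cvgM; first exact: a_cvg.
apply: (@cvg_comp _ _ _ (fun n : nat => n%:R ^+ 2 * u) (fun t => Num.sqrt t * heat0 t) _ +oo%R) => //.
apply/cvgryPge => A; exists (Num.truncn (`|A| / u)).+1 => // n /= An.
have n1 : 1 <= n%:R :> R by rewrite ler1n (leq_trans _ An).
rewrite -ler_pdivrMr//; apply: (@le_trans _ _ (`|A| / u)).
  by rewrite ler_pM2r ?invr_gt0// ler_norm.
apply: (@le_trans _ _ n%:R); last by rewrite expr2 ler_pMr// (lt_le_trans ltr01).
by apply: ltW; apply: lt_le_trans (truncnS_gt _) _; rewrite ler_nat.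
Qed.

Lemma a_linear_bounds : exists m M : R, [/\ 0 < m, 0 < M &
  \forall n \near \oo, forall i, m * n%:R <= (a i n)%:R <= M * n%:R].
Proof.
pose M := \sum_(i < d) (2 * alpha i).
pose S := \sum_(i < d) (2 / alpha i).
have aM i : 2 * alpha i <= M.
  rewrite /M (bigD1 i)//= lerDl sumr_ge0// => j _; rewrite mulr_ge0// ltW//.
have aS i : 2 / alpha i <= S.
  rewrite /S (bigD1 i)//= lerDl sumr_ge0// => j _; rewrite divr_ge0// ltW//.
have S0 : 0 < S by apply: lt_le_trans (aS i0); rewrite divr_gt0.
have am i : S^-1 <= alpha i / 2.
  by rewrite -[leRHS]invrK invf_div lef_pV2 ?posrE// divr_gt0.
exists S^-1, M; split; first by rewrite invr_gt0.
  by apply: lt_le_trans (aM i0); rewrite mulr_gt0.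
apply: (@filter_forall _ _ (fun i n => S^-1 * n%:R <= (a i n)%:R <= M * n%:R)) => i.
have h1 : alpha i / 2 < alpha i by rewrite ltr_pdivrMr// ltr_pMr// ltr1n.
have h2 : alpha i < 2 * alpha i by rewrite ltr_pMl// ltr1n.
have n1 : \forall n \near \oo, alpha i / 2 <= (a i n)%:R / n%:R by exact: cvgr_ge (@a_cvg i) _ h1.
have n2 : \forall n \near \oo, (a i n)%:R / n%:R <= 2 * alpha i by exact: cvgr_le (@a_cvg i) _ h2.
apply: filterS3 near_gt0 n1 n2 => n n0 an1 an2.
have nR : 0 < n%:R :> R by rewrite ltr0n.
rewrite -ler_pdivlMr// -[_ <= M * _]ler_pdivrMr// (le_trans (am i) an1)/=.
exact: le_trans an2 (aM i).
Qed.

(** The factor i0 decays exponentially, as lambda i0 is neither 0 nor 1; the other factors are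
    bounded through [lattice_theta_decay] with delta = 0. *)
Lemma torus_theta_decay : exists C c : R, [/\ 0 <= C, 0 < c &
  \forall n \near \oo, forall u, 1 <= u ->
    0 <= torus_theta n (n%:R ^+ 2 * u) <= C * expR (- (c * u))].
Proof.
have [m [M [m0 M0 mM]]] := a_linear_bounds.
have [c c0 hc] := lattice_theta_decay R.
have /andP[l0 l1] := lambda_itv i0.
have l0' : 0 < lambda i0 by rewrite lt0r lambda_neq0.
have l1' : lambda i0 < 1 by rewrite lt_neqAle lambda_neq1.
(* Half the distance from lambda i0 to {0, 1}, so that lambdan i0 n eventually stays in
   [delta, 1 - delta]. *)
pose delta : R := Num.min (lambda i0) (1 - lambda i0) / 2.
have dm : 0 < Num.min (lambda i0) (1 - lambda i0) by rewrite lt_min l0' subr_gt0.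
have d0 : 0 < delta by rewrite divr_gt0.
have dl : 2 * delta <= lambda i0 by rewrite /delta mulrC divfK// ge_min lexx.
have dl' : 2 * delta <= 1 - lambda i0 by rewrite /delta mulrC divfK// ge_min lexx orbT.
pose B : R := 2 * (1 + M ^+ 2 / c).
have B0 : 0 <= B by rewrite mulr_ge0// addr_ge0// divr_ge0 ?sqr_ge0// ltW.
exists (B ^+ d), (c / M ^+ 2 * delta ^+ 2); split; first exact: exprn_ge0.
  by rewrite mulr_gt0 ?divr_gt0 ?exprn_gt0.
have n1 : \forall n \near \oo, delta <= lambdan i0 n.
  by apply: cvgr_ge (@lambdan_cvg i0) _ _; lra.
have n2 : \forall n \near \oo, lambdan i0 n <= 1 - delta.
  by apply: cvgr_le (@lambdan_cvg i0) _ _; lra.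
have n3 : \forall n \near \oo, forall i, (1 < a i n)%N.
  by apply: (@filter_forall _ _ (fun i n => (1 < a i n)%N)) => i; exact: a_infty.
apply: filterS3 (filterI n1 n2) (filterI mM near_gt0) n3 => n [dn nd] [an n0] a1 u u1.
have u0 : 0 < u by exact: lt_le_trans u1.
have nR : 0 < n%:R :> R by rewrite ltr0n.
have t0 : 0 < n%:R ^+ 2 * u by rewrite mulr_gt0// exprn_gt0.
apply/andP; split; first by apply: prodr_ge0 => i _; exact: lattice_theta_ge0.
have fac i del : 0 <= del -> del <= lambdan i n <= 1 - del ->
    lattice_theta (a i n) (lambdan i n) (n%:R ^+ 2 * u) <= B * expR (- (c / M ^+ 2 * del ^+ 2 * u)).
  move=> del0 hdel; have aR : 0 < (a i n)%:R :> R by rewrite ltr0n (ltnW (a1 i)).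
  have /andP[_ aM] := an i.
  have tq : u / M ^+ 2 <= n%:R ^+ 2 * u / (a i n)%:R ^+ 2.
    rewrite ler_pdivlMr ?exprn_gt0// mulrAC ler_pdivrMr ?exprn_gt0//.
    rewrite (_ : n%:R ^+ 2 * u * M ^+ 2 = u * (M * n%:R) ^+ 2); last by ring.
    by rewrite ler_pM2l// ler_sqr ?nnegrE// mulr_ge0// ltW.
  apply: le_trans (hc _ _ _ _ (a1 i) t0 del0 hdel) _.
  rewrite /B -[leLHS]mulrA -[leRHS]mulrA ler_pM2l// [leRHS]mulrC; apply: ler_pM; rewrite ?expR_ge0//.
  - by rewrite addr_ge0// invr_ge0 !mulr_ge0 ?divr_ge0 ?invr_ge0 ?sqr_ge0 ?(ltW nR) ?(ltW u0) ?(ltW c0).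
  - rewrite ler_expR lerN2 (_ : c / M ^+ 2 * del ^+ 2 * u = c * (u / M ^+ 2 * del ^+ 2)); last by ring.
    rewrite [leLHS]mulrA; apply: ler_wpM2r; first exact: sqr_ge0.
    by rewrite ler_pM2l.
  - rewrite lerD2l -[leRHS]invrK lef_pV2 ?posrE ?invr_gt0 ?divr_gt0 ?mulr_gt0 ?divr_gt0 ?invr_gt0 ?exprn_gt0//.
    rewrite invf_div -[c / _]mulr1; apply: le_trans (_ : c * (u / M ^+ 2) <= _).
      by rewrite -mulrA ler_pM2l// [leRHS]mulrC ler_pM2l// invr_gt0 exprn_gt0.
    by rewrite ler_pM2l.
rewrite /torus_theta (bigD1 i0)//= [B ^+ d](_ : _ = B * B ^+ d.-1); last by rewrite -exprS prednK.
rewrite [leRHS]mulrAC; apply: ler_pM.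
- exact: lattice_theta_ge0.
- by apply: prodr_ge0 => i _; exact: lattice_theta_ge0.
- by apply: fac; [exact: ltW|rewrite dn].
apply: (@le_trans _ _ (\prod_(i < d | i != i0) B)); last first.
  by rewrite prodr_const cardC1 card_ord.
apply: ler_prod => i _; rewrite lattice_theta_ge0/=.
have /andP[ln0 ln1] := lambdan_itv i n0.
have := fac i 0 (lexx _); rewrite ln0 subr0 (ltW ln1) expr0n/= mulr0 mul0r oppr0 expR0 mulr1.
exact.
Qed.

(** Each factor is of order u^(-1/2); for u >= 1 a product of d >= 1 of them is at most of that
    order. *)
Lemma torus_heat_decay : exists2 C : R, 0 <= C &
  \forall n \near \oo, forall u, 1 <= u ->
    0 <= torus_heat n (n%:R ^+ 2 * u) <= C * u `^ (- 2^-1).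
Proof.
have [m [M [m0 M0 mM]]] := a_linear_bounds.
have [C C0 hC] := heat0_bounded R.
exists ((M * C) ^+ d); first by rewrite exprn_ge0// mulr_ge0// ltW.
apply: filterS2 mM near_gt0 => n an n0 u u1.
have u0 : 0 < u by exact: lt_le_trans u1.
have nR : 0 < n%:R :> R by rewrite ltr0n.
have t0 : 0 < n%:R ^+ 2 * u by rewrite mulr_gt0// exprn_gt0.
have h0 := heat0_ge0 (ltW t0).
have su1 : 1 <= Num.sqrt u by rewrite -[leLHS]sqrtr1 ler_sqrt// ltW.
have su : 0 < Num.sqrt u by exact: lt_le_trans su1.
apply/andP; split; first by apply: prodr_ge0 => i _; rewrite mulr_ge0.
apply: (@le_trans _ _ (\prod_(i < d) (M * C * (Num.sqrt u)^-1))).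
  apply: ler_prod => i _; rewrite mulr_ge0//=.
  have /andP[_ aM] := an i.
  apply: (@le_trans _ _ (M * n%:R * heat0 (n%:R ^+ 2 * u))); first by rewrite ler_wpM2r.
  rewrite -[leLHS]mulrA -[leRHS]mulrA ler_pM2l// ler_pdivlMr//.
  have := hC _ t0; rewrite sqrtrM ?sqr_ge0// sqrtr_sqr ger0_norm ?(ltW nR)//.
  apply: le_trans; rewrite le_eqVlt; apply/orP; left; apply/eqP. ring.
rewrite prodr_const card_ord exprMn ler_wpM2l ?exprn_ge0 ?mulr_ge0 ?(ltW M0)//.
rewrite powRN powR12_sqrt ?(ltW u0)// -[leRHS]expr1 ler_wiXn2l ?invr_ge0 ?(ltW su)//.
by rewrite invf_le1.
Qed.

(** Exchanging one factor leaves d - 1 others, of size up to B/u, so the one-dimensional error has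
    to be of order u^d: hence the order [d.-1] in [lattice_theta_heat0_bound]. Times n^2 u below 1
    are treated apart, with factors of size n. *)
Lemma torus_difference_small : exists2 C : R, 0 <= C &
  \forall n \near \oo, forall u, 0 < u <= 1 ->
    `|torus_heat n (n%:R ^+ 2 * u) - torus_theta n (n%:R ^+ 2 * u)| <= C * u.
Proof.
have [m [M [m0 M0 mM]]] := a_linear_bounds.
have [C C0 hC] := lattice_theta_heat0_bound R d.-1.
rewrite prednK// in hC.
have [c c0 hc] := lattice_theta_decay R.
have md0 : 0 < (m ^+ 2) ^+ d by rewrite !exprn_gt0.
pose D := C / (m ^+ 2) ^+ d.
have D0 : 0 <= D by rewrite divr_ge0// ltW.
pose B : R := 2 * (1 + M ^+ 2 / c) + D.
have Mc : 0 < M ^+ 2 / c by rewrite divr_gt0// exprn_gt0.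
have B0 : 0 < B by rewrite /B; lra.
pose A := M + D.
have A0 : 0 < A by rewrite ltr_pwDl.
have dD : 0 <= d%:R * D by rewrite mulr_ge0.
have BB : 0 <= B ^+ d / B by rewrite divr_ge0 ?exprn_ge0// ltW.
have AA : 0 <= A ^+ d / A by rewrite divr_ge0 ?exprn_ge0// ltW.
exists (d%:R * D * (B ^+ d / B) + d%:R * D * (A ^+ d / A)).
  by rewrite addr_ge0// mulr_ge0.
have n3 : \forall n \near \oo, forall i, (1 < a i n)%N.
  by apply: (@filter_forall _ _ (fun i n => (1 < a i n)%N)) => i; exact: a_infty.
apply: filterS3 mM near_gt0 n3 => n an n0 a1 u /andP[u0 u1].
have nR : 0 < n%:R :> R by rewrite ltr0n.
have n1 : 1 <= n%:R :> R by rewrite ler1n.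
have t0 : 0 < n%:R ^+ 2 * u by rewrite mulr_gt0// exprn_gt0.
have h0 := heat0_ge0 (ltW t0).
have aR i : 0 < (a i n)%:R :> R by rewrite ltr0n (ltnW (a1 i)).
have pd := @prod_diff_le R _ (index_enum 'I_d)
  (fun i => (a i n)%:R * heat0 (n%:R ^+ 2 * u))
  (fun i => lattice_theta (a i n) (lambdan i n) (n%:R ^+ 2 * u)).
have sz : size (index_enum 'I_d) = d by rewrite /index_enum -enumT size_enum_ord.
rewrite sz in pd.
have finish X delta E : 0 < X -> 0 <= delta ->
   (forall i, `|lattice_theta (a i n) (lambdan i n) (n%:R ^+ 2 * u) - (a i n)%:R * heat0 (n%:R ^+ 2 * u)| <= delta) ->
   (forall i, lattice_theta (a i n) (lambdan i n) (n%:R ^+ 2 * u) + delta <= X) ->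
   d%:R * delta * X ^+ d / X <= E * u ->
   `|torus_heat n (n%:R ^+ 2 * u) - torus_theta n (n%:R ^+ 2 * u)| <= E * u.
  move=> X0 del0 hd hX; apply: le_trans; rewrite ler_pdivlMr// mulrC; apply: pd => //.
  - exact: ltW.
  - move=> i; rewrite ger0_norm; last by rewrite mulr_ge0 ?ler0n ?h0.
    apply: le_trans _ (hX i).
    by have := hd i; rewrite ler_norml => /andP[]; lra.
  - move=> i; rewrite ger0_norm; last exact: lattice_theta_ge0.
    apply: le_trans _ (hX i).
    by rewrite lerDl.
  - by move=> i; rewrite distrC.
have am2 i : (m * n%:R) ^+ 2 <= (a i n)%:R ^+ 2.
  by have /andP[h _] := an i; rewrite ler_sqr ?nnegrE// ?mulr_ge0// ltW.
have [t1|/ltW t1] := leP 1 (n%:R ^+ 2 * u).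
  apply: (@le_trans _ _ (d%:R * D * (B ^+ d / B) * u)); last first.
    by rewrite mulrDl lerDl mulr_ge0 ?(ltW u0)// mulr_ge0.
  have ud1 : u ^+ d <= 1 by rewrite exprn_ile1// ltW.
  (* d D u^d (B/u)^(d-1) is linear in u. *)
  apply: (finish (B / u) (D * u ^+ d)).
  - by rewrite divr_gt0.
  - by rewrite mulr_ge0// exprn_ge0// ltW.
  - move=> i; have [/(_ t1) h _] := hC (a i n) (lambdan i n) (n%:R ^+ 2 * u) (ltnW (a1 i)).
    apply: le_trans h _; rewrite /D [leRHS]mulrAC ler_pdivlMr// -mulrA ler_wpM2l// -exprMn.
    apply: lerXn2r; rewrite ?nnegrE ?mulr_ge0 ?divr_ge0 ?invr_ge0 ?sqr_ge0 ?(ltW u0) ?(ltW t0) ?(ltW m0)//.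
    rewrite mulrAC ler_pdivrMr ?exprn_gt0//.
    rewrite (_ : _ * u * m ^+ 2 = u * (m * n%:R) ^+ 2); last by ring.
    by rewrite ler_pM2l.
  - move=> i; have /andP[ln0 ln1] := lambdan_itv i n0.
    have := hc (a i n) (lambdan i n) _ 0 (a1 i) t0 (lexx _).
    rewrite ln0 subr0 (ltW ln1) expr0n/= mulr0 oppr0 expR0 mulr1 => /(_ isT) h.
    have /andP[_ aM] := an i.
    have h2 : (c * (n%:R ^+ 2 * u / (a i n)%:R ^+ 2))^-1 <= M ^+ 2 / c / u.
      rewrite -[leRHS]invrK lef_pV2 ?posrE ?invr_gt0 ?divr_gt0 ?mulr_gt0 ?divr_gt0 ?invr_gt0 ?exprn_gt0//.
      rewrite invf_div invf_div (_ : u * (c / M ^+ 2) = c * (u / M ^+ 2)); last by ring.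
      rewrite ler_pM2l// ler_pdivlMr ?exprn_gt0// mulrAC ler_pdivrMr ?exprn_gt0//.
      rewrite (_ : n%:R ^+ 2 * u * M ^+ 2 = u * (M * n%:R) ^+ 2); last by ring.
      by rewrite ler_pM2l// ler_sqr ?nnegrE// ?mulr_ge0// ltW.
    rewrite ler_pdivlMr//.
    have h3 : (lattice_theta (a i n) (lambdan i n) (n%:R ^+ 2 * u)) * u <= 2 * (1 + M ^+ 2 / c / u) * u.
      rewrite ler_pM2r//; apply: le_trans h _; rewrite ler_pM2l// lerD2l//.
    have h4 : 2 * (1 + M ^+ 2 / c / u) * u = 2 * u + 2 * (M ^+ 2 / c).
      by field; rewrite !gt_eqF.
    have h5 : D * u ^+ d * u <= D.
      by rewrite -mulrA -[leRHS]mulr1 ler_wpM2l// mulr_ile1 ?exprn_ge0// ltW.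
    rewrite mulrDl /B; lra.
  - rewrite expr_div_n le_eqVlt; apply/orP; left; apply/eqP.
    by field; rewrite !gt_eqF ?exprn_gt0.
apply: (@le_trans _ _ (d%:R * D * (A ^+ d / A) * u)); last first.
  by rewrite [leRHS]mulrDl lerDr mulr_ge0 ?(ltW u0)// mulr_ge0.
have nd0 : 0 < (n%:R ^+ 2) ^+ d :> R by rewrite !exprn_gt0.
have nd1 : n%:R ^+ 2 * u / (n%:R ^+ 2) ^+ d <= 1.
  rewrite ler_pdivrMr// mul1r (le_trans t1)//.
  by rewrite exprn_ege1// exprn_ege1.
(* Each factor is at most of order n and the error is D n^2 u / n^(2d), so the bound is of order u
   n^(1-d), at most u. *)
apply: (finish (A * n%:R) (D * (n%:R ^+ 2 * u / (n%:R ^+ 2) ^+ d))).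
- by rewrite mulr_gt0.
- by rewrite mulr_ge0// divr_ge0 ?(ltW t0) ?(ltW nd0).
- move=> i; have [_ /(_ (ltW t0) t1) h] := hC (a i n) (lambdan i n) (n%:R ^+ 2 * u) (ltnW (a1 i)).
  apply: le_trans h _.
  rewrite (_ : D * _ = C * (n%:R ^+ 2 * u) / ((m ^+ 2) ^+ d * (n%:R ^+ 2) ^+ d)); last first.
    by rewrite invfM /D; ring.
  apply: ler_wpM2l; first by rewrite mulr_ge0// ltW.
  rewrite lef_pV2 ?posrE ?mulr_gt0 ?exprn_gt0// -!exprMn.
  by apply: lerXn2r; rewrite ?nnegrE ?sqr_ge0// -?expr2 -?exprMn.
- move=> i; have /andP[_ aM] := an i.
  have h := lattice_theta_le (a i n) (lambdan i n) (ltW t0).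
  have : D * (n%:R ^+ 2 * u / (n%:R ^+ 2) ^+ d) <= D * n%:R.
    by rewrite ler_wpM2l// (le_trans nd1).
  rewrite /A mulrDl; lra.
rewrite (_ : _ / _ = d%:R * D * (A ^+ d / A) * u * (n%:R * n%:R ^+ d / (n%:R ^+ 2) ^+ d)); last first.
  by rewrite [(A * _) ^+ d]exprMn; field; rewrite !gt_eqF ?exprn_gt0.
rewrite -[leRHS]mulr1 ler_wpM2l//.
  by rewrite mulr_ge0 ?(ltW u0)// mulr_ge0.
rewrite ler_pdivrMr// mul1r expr2 exprMn ler_wpM2r ?exprn_ge0//.
by rewrite -[leLHS]expr1 ler_weXn2l.
Qed.

Lemma theta_lim_decay : exists C c : R, [/\ 0 <= C, 0 < c &
  forall u, 1 <= u -> 0 <= theta_lim u <= C * expR (- (c * u))].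
Proof.
have [C [c [C0 c0 hC]]] := torus_theta_decay; exists C, c; split => // u u1.
have h := cvg_torus_theta (lt_le_trans ltr01 u1).
apply/andP; split.
  by apply: (cvgr_to_ge h); apply: filterS hC => n /(_ _ u1)/andP[].
by apply: (cvgr_to_le h); apply: filterS hC => n /(_ _ u1)/andP[].
Qed.

Lemma theta_lim_small : exists2 C : R, 0 <= C &
  forall u, 0 < u <= 1 -> `|heat_const * u `^ (- (d%:R / 2)) - theta_lim u| <= C * u.
Proof.
have [C C0 hC] := torus_difference_small; exists C => // u u01.
have /andP[u0 _] := u01.
have h : (fun n : nat => torus_heat n (n%:R ^+ 2 * u) - torus_theta n (n%:R ^+ 2 * u)) @ \oo -->
    heat_const * u `^ (- (d%:R / 2)) - theta_lim u.
  by apply: cvgB; [exact: cvg_torus_heat|exact: cvg_torus_theta].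
by apply: (cvgr_to_le (cvg_norm h)); apply: filterS hC => n; apply.
Qed.

Lemma measurable_lattice_theta (k : nat) l : measurable_fun setT (lattice_theta k l : R -> R).
Proof.
apply: measurable_sum => i; apply: measurableT_comp => //.
by apply: measurableT_comp => //; exact: measurable_funM.
Qed.

Lemma measurable_scaled_theta n c :
  measurable_fun pos (fun u => torus_theta n (c * u)).
Proof.
apply: measurable_funTS; apply: measurable_prod => i _.
apply: (measurableT_comp (measurable_lattice_theta (a i n) (lambdan i n))).
exact: measurable_mulr.
Qed.

Lemma measurable_scaled_heat n c : 0 < c ->
  measurable_fun pos (fun u => torus_heat n (c * u)).
Proof.
move=> c0; apply: measurable_prod => i _; apply: measurable_funM => //.
apply: (@measurable_comp _ _ _ _ _ _ pos) => //.
- by move=> _ [x + <-]; rewrite /= !in_itv/= !andbT => x0; rewrite mulr_gt0.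
- exact: measurable_heat0.
Qed.

Lemma measurable_theta_lim : measurable_fun pos theta_lim.
Proof.
apply: (@measurable_fun_cvg _ (measurableTypeR R) R pos
  (fun n (u : R) => torus_theta n (n%:R ^+ 2 * u)) theta_lim).
  by move=> n; exact: measurable_scaled_theta.
by move=> u; rewrite /= in_itv/= andbT => u0; exact: cvg_torus_theta.
Qed.

Lemma cvg_torus_integral :
  let F n u := (torus_heat n (n%:R ^+ 2 * u) - torus_theta n (n%:R ^+ 2 * u)) / u in
  let f u := (heat_const * u `^ (- (d%:R / 2)) - theta_lim u) / u in
  [/\ \forall n \near \oo, mu.-integrable pos (EFin \o F n),
      mu.-integrable pos (EFin \o f) &
      (fun n => \int[mu]_(u in pos) F n u) @ \oo --> \int[mu]_(u in pos) f u].
Proof.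
move=> F f.
have [C1 [c [C10 c0 h1]]] := torus_theta_decay.
have [C2 C20 h2] := torus_heat_decay.
have [C3 C30 h3] := torus_difference_small.
have [C4 C40 h4] : exists2 C : R, 0 <= C & forall u, 1 <= u -> C1 * expR (- (c * u)) <= C * u `^ (- 2^-1).
  exists (C1 / c); first by rewrite divr_ge0// ltW.
  move=> u u1; have u0 : 0 < u by exact: lt_le_trans u1.
  rewrite -mulrA ler_wpM2l// [leRHS]mulrC ler_pdivlMr//.
  have su1 : 1 <= Num.sqrt u by rewrite -[leLHS]sqrtr1 ler_sqrt// ltW.
  have su : 0 < Num.sqrt u by exact: lt_le_trans su1.
  rewrite powRN powR12_sqrt ?(ltW u0)// expRN.
  have cu : 0 < c * u by rewrite mulr_gt0.
  have e1 : c * u <= expR (c * u) by apply: le_trans (expR_ge1Dx _); rewrite lerDr.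
  rewrite mulrC ler_pdivrMr ?expR_gt0// mulrC ler_pdivlMr//.
  apply: le_trans e1; rewrite ler_pM2l//.
  by rewrite -[leRHS](sqr_sqrtr (ltW u0)) expr2 ler_pMl.
pose K := C3 + C2 + C4.
(* The dominating function: constant on ]0, 1], of order u^(-3/2) beyond. *)
pose g u : R := K * (\1_(`]0, 1]%classic : set R) u + \1_(`]1, +oo[%classic : set R) u * u `^ (- 2^-1 - 1)).
have gsmall u : 0 < u <= 1 -> g u = K.
  move=> u01; have /andP[_ u1] := u01.
  rewrite /g !indicE mem_set/=; last by rewrite in_itv.
  by rewrite memNset/= ?in_itv/= ?andbT ?ltNge ?u1//= mul0r addr0 mulr1.
have glarge u : 1 < u -> g u = K * u `^ (- 2^-1 - 1).
  move=> u1; rewrite /g !indicE memNset/=; last first.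
    by rewrite in_itv/= => /andP[_]; rewrite leNgt u1.
  by rewrite mem_set/= ?in_itv/= ?andbT// add0r mul1r.
have K0 : 0 <= K by rewrite !addr_ge0.
have mg : measurable_fun pos g.
  apply: measurable_funTS; apply: measurable_funM => //; apply: measurable_funD.
    by apply: measurable_indic; exact: measurable_itv.
  by apply: measurable_funM; [apply: measurable_indic; exact: measurable_itv|exact: measurable_powR].
have gi : mu.-integrable pos (EFin \o g).
  apply: (@integrable_pos_bound R g K 1 2^-1 mg) => //.
    by move=> u u01; rewrite gsmall// subrr powRr0 mulr1 ger0_norm.
  move=> u; rewrite le_eqVlt => /predU1P[<-|u1]; last first.
    by rewrite glarge// ger0_norm ?mulr_ge0 ?powR_ge0.
  by rewrite gsmall ?ltr01 ?lexx// powR1 mulr1 ger0_norm.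
have [N _ hN] : \forall n \near \oo, (0 < n)%N /\ forall u, 0 < u -> `|F n u| <= g u.
  apply: filterS3 (filterI h1 h2) h3 near_gt0 => n [k1 k2] k3 n0; split=> // u u0.
  rewrite /F normrM normfV (gtr0_norm u0) ler_pdivrMr//.
  have [u1|u1] := leP u 1.
    rewrite gsmall ?u0//; apply: le_trans (k3 u _) _; first by rewrite u0.
    by rewrite ler_pM2r// /K -addrA lerDl addr_ge0.
  have /andP[a1 a2] := k1 u (ltW u1); have /andP[b1 b2] := k2 u (ltW u1).
  have a3 := le_trans a2 (h4 u (ltW u1)).
  rewrite glarge// (pos_powRD _ _ u0) powR_inv1 ?(ltW u0)// mulrA divfK ?gt_eqF//.
  have p0 := powR_ge0 u (- 2^-1).
  have e1 : 0 <= C3 * u `^ (- 2^-1) by rewrite mulr_ge0.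
  have e2 : 0 <= C2 * u `^ (- 2^-1) by rewrite mulr_ge0.
  have e3 : 0 <= C4 * u `^ (- 2^-1) by rewrite mulr_ge0.
  by rewrite ler_norml /K !mulrDl; apply/andP; split; lra.
have mF n : (0 < n)%N -> measurable_fun pos (F n).
  move=> n0; apply: measurable_funM; last exact: measurable_inv_pos.
  apply: measurable_funB; last exact: measurable_scaled_theta.
  by apply: measurable_scaled_heat; rewrite exprn_gt0// ltr0n.
have Fi n : (N <= n)%N -> mu.-integrable pos (EFin \o F n).
  move=> /hN[n0 Fg]; apply: (le_integrable _ _ _ gi) => //=.
    by apply/measurable_EFinP; exact: mF.
  move=> u; rewrite /= in_itv/= andbT => u0; rewrite lee_fin.
  by apply: le_trans (Fg u u0) _; exact: ler_norm.
have hpos u : pos u -> 0 < u by rewrite /= in_itv/= andbT.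
(* The domination only holds from [N] on, so the sequence is shifted by [N]. *)
have [//|n|n u /hpos u0|u /hpos u0|fi fl] :=
    @Rintegral_dominated_cvg R (fun n => F (n + N)%N) f g pos _ _ gi.
- by apply: mF; have [] := hN _ (leq_addl n N).
- by have [_ ->] := hN _ (leq_addl n N).
- rewrite -[X in X --> _]/([sequence F (n + N)%N u]_n @ \oo) (@cvg_shiftn N _ (fun n => F n u)).
  apply: cvgM; last exact: cvg_cst.
  by apply: cvgB; [exact: cvg_torus_heat|exact: cvg_torus_theta].
split => //; first by exists N => // n /= Nn; exact: Fi.
by rewrite -(@cvg_shiftn N _ (fun n => \int[mu]_(u in pos) F n u)).
Qed.

End HeatLimit.

(** * Determinant of the bundle Laplacian *)

Section DependentProducts.
Variable R : comNzRingType.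

(** Distributivity for dependent families: the points of the torus have coordinates in different
    types ['I_(a i)], so the non-dependent law is transported through [fprod]. *)
Lemma sum_dffun_prod (I : finType) (T : I -> finType) (F : forall i, T i -> R) :
  \sum_(x : {dffun forall i, T i}) \prod_i F i (x i) = \prod_i \sum_(j : T i) F i j.
Proof.
rewrite (reindex (@dffun_of_fprod I T)); last exact/onW_bij/dffun_of_fprod_bij.
pose G i : {ffun T i -> R} := [ffun j => F i j].
transitivity (\sum_(t : fprod T) \prod_(i in I) G i (t i)).
  by apply: eq_bigr => t _; apply: eq_bigr => i _; rewrite !ffunE.
rewrite (big_fprod _ _ G).
rewrite -(bigA_distr_big_dep _ (fun i u => untag 0 (G i) u)).
apply: eq_bigr => i _; rewrite -(big_tag (fun i => G i)).
by apply: eq_bigr => j _; rewrite ffunE.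
Qed.

End DependentProducts.

(** * The unit circle *)

Section UnitCircle.
Variable R : realType.
Implicit Types x y : R.

Definition cis x : R[i] := cexp (0 +i* x).

Lemma cisE x : cis x = cos x +i* sin x.
Proof. by rewrite /cis /cexp/= expR0 mul1r. Qed.

Lemma cisD x y : cis (x + y) = cis x * cis y.
Proof.
by rewrite !cisE cosD sinD; apply/eqP; rewrite eq_complex/=; apply/andP; split; apply/eqP; ring.
Qed.

Lemma cis0 : cis 0 = 1.
Proof. by rewrite cisE cos0 sin0. Qed.

Lemma cisMn x n : cis (x * n%:R) = cis x ^+ n.
Proof.
elim: n => [|n IH]; first by rewrite mulr0 cis0.
by rewrite exprS -IH -cisD -[n.+1%:R]natr1 mulrDr mulr1 addrC.
Qed.

Lemma cisN x : cis x * cis (- x) = 1.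
Proof. by rewrite -cisD subrr cis0. Qed.

Lemma cis_neq0 x : cis x != 0.
Proof.
by apply/eqP => x0; have /eqP := cisN x; rewrite x0 mul0r eq_sym oner_eq0.
Qed.

Lemma cisV x : (cis x)^-1 = cis (- x).
Proof. by rewrite -[RHS]mul1r -(mulVf (cis_neq0 x)) -mulrA cisN mulr1. Qed.

Lemma cis_2pin n : cis (2 * pi * n%:R) = 1.
Proof.
rewrite cisMn [X in X ^+ n](_ : _ = 1) ?expr1n// cisE mulr_natl.
have := cosD2pi (0 : R); have := sinD2pi (0 : R).
by rewrite !add0r sin0 cos0 => -> ->.
Qed.

Lemma cos_lt1 x : 0 < x < 2 * pi -> cos x < 1.
Proof.
move=> /andP[x0 x2].
have s0 : 0 < sin (x / 2).
  by apply: sin_gt0_pi; rewrite divr_gt0// ltr_pdivrMr// mulrC.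
have -> : x = (x / 2) *+ 2 by rewrite -mulr_natr divfK.
have := cos2Dsin2 (x / 2); have : 0 < sin (x / 2) ^+ 2 by rewrite exprn_gt0.
rewrite cos_mulr2n -mulr_natr; lra.
Qed.

Lemma cis_neq1 x : 0 < `|x| < 2 * pi -> cis x != 1.
Proof.
move=> x2; have : cos x < 1.
  by move: x2; have [x0|x0] := ger0P x => /cos_lt1; rewrite ?cosN.
by rewrite cisE => h; apply/eqP => -[h1 _]; rewrite h1 ltxx in h.
Qed.

Lemma cis_addN x : cis x + cis (- x) = (2 * cos x)%:C.
Proof.
rewrite !cisE cosN sinN; apply/eqP; rewrite eq_complex/=; apply/andP; split; apply/eqP; ring.
Qed.

Lemma clog_real x : 0 < x -> clog x%:C = (ln x)%:C.
Proof.
move=> x0; rewrite /clog /carg /cnorm normc_def/= expr0n/= addr0 sqrtr_sqr gtr0_norm//.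
by rewrite lexx divff ?gt_eqF// acos1.
Qed.

Lemma ln_prod (I : Type) (r : seq I) (F : I -> R) : (forall i, 0 < F i) ->
  ln (\prod_(i <- r) F i) = \sum_(i <- r) ln (F i).
Proof.
move=> F0; elim: r => [|i r IH]; first by rewrite !big_nil ln1.
by rewrite !big_cons lnM ?posrE ?IH ?prodr_gt0.
Qed.

End UnitCircle.

(** * Diagonalization of the bundle Laplacian *)

Section Determinant.
Variables (R : realType) (d : nat) (a : 'I_d -> nat) (w : 'I_d -> nat -> R[i]) (l : 'I_d -> R).
Hypothesis a_gt0 : forall i, (0 < a i)%N.
Hypothesis w_neq0 : forall i j, (j < a i)%N -> w i j != 0.
Hypothesis l_itv : forall i, 0 <= l i < 1.
Hypothesis w_prod : forall i, \prod_(j < a i) w i j = cis (2 * pi * l i).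

Local Notation T := (torus a).

Definition phase i (k : 'I_(a i)) : R := 2 * pi * ((k%:R + l i) / (a i)%:R).

Definition mode i (k j : 'I_(a i)) : R[i] :=
  (\prod_(m < j) w i m) * cis (- phase k) ^+ j.

Definition torus_mode (K x : T) : R[i] := \prod_i mode (K i) (x i).

Definition torus_eigenvalue (K : T) : R := \sum_i (2 - 2 * cos (phase (K i))).

(** At the last point of the circle the product of the weights closes up to the holonomy e^(2 pi i
    l), which the a-th power of [cis (- phase k)] cancels. *)
Lemma mode_ordS i (k j : 'I_(a i)) : mode k (ordS j) = cis (- phase k) * w i j * mode k j.
Proof.
rewrite /mode /=; have [ja|aj] := ltnP j.+1 (a i).
  by rewrite modn_small// big_ord_recr/= exprS; ring.
have aE : a i = j.+1 by apply/eqP; rewrite eqn_leq aj ltn_ord.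
rewrite -[X in (X %% _)%N]aE modnn big_ord0 expr0 mulr1.
have h : \prod_(m < j) w i m * w i j = cis (2 * pi * l i).
  rewrite -w_prod -(big_mkord xpredT (fun m => w i m)) -[RHS](big_mkord xpredT (fun m => w i m)).
  by rewrite [in RHS]aE big_nat_recr.
transitivity ((\prod_(m < j) w i m * w i j) * cis (- phase k) ^+ (a i)); last first.
  have -> : cis (- phase k) ^+ a i = cis (- phase k) * cis (- phase k) ^+ j.
    by rewrite -exprS; congr (_ ^+ _).
  by ring.
rewrite h -cisMn -cisD /phase.
rewrite (_ : _ + _ = - (2 * pi * k%:R)); first by rewrite -cisV cis_2pin invr1.
by field; rewrite pnatr_eq0 -lt0n.
Qed.

Lemma mode_ord_pred i (k j : 'I_(a i)) :
  w i (ord_pred j) * mode k (ord_pred j) = cis (phase k) * mode k j.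
Proof.
have e := mode_ordS k (ord_pred j); rewrite ord_predK in e; rewrite e.
transitivity (cis (phase k) * cis (- phase k) * (w i (ord_pred j) * mode k (ord_pred j))).
  by rewrite cisN mul1r.
by ring.
Qed.

Lemma mode_neq0 i (k j : 'I_(a i)) : mode k j != 0.
Proof.
rewrite mulf_neq0 ?expf_neq0 ?cis_neq0//.
by apply/prodf_neq0 => m _; apply: w_neq0; exact: ltn_trans (ltn_ord m) (ltn_ord j).
Qed.

Lemma torus_mode_step (K v : T) i b : torus_mode K (step v (i, b)) =
  mode (K i) (if b then ordS (v i) else ord_pred (v i)) * \prod_(j | j != i) mode (K j) (v j).
Proof.
rewrite /torus_mode (bigD1 i)//= ffunE eqxx/=; congr (_ * _).
by apply: eq_bigr => j ji; rewrite ffunE/= (negbTE ji).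
Qed.

Lemma bundle_laplacian_mode (K v : T) :
  bundle_laplacian w (torus_mode K) v = (torus_eigenvalue K)%:C * torus_mode K v.
Proof.
rewrite /bundle_laplacian -(pair_bigA _ (fun i b => torus_mode K v -
  weight w (step v (i, b)) (opp_gen (i, b)) * torus_mode K (step v (i, b))))/=.
rewrite /torus_eigenvalue rmorph_sum/= mulr_suml; apply: eq_bigr => i _.
have wS : weight w (step v (i, true)) (opp_gen (i, true)) = (w i (v i))^-1.
  rewrite /weight/= !ffunE/= !eqxx/=.
  by have := congr1 (@nat_of_ord _) (ordSK (v i)); rewrite /= => ->.
have wP : weight w (step v (i, false)) (opp_gen (i, false)) = w i (ord_pred (v i)).
  by rewrite /weight/= !ffunE/= !eqxx/=.
rewrite big_bool wS wP !torus_mode_step.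
have tE : torus_mode K v = mode (K i) (v i) * \prod_(j | j != i) mode (K j) (v j).
  by rewrite /torus_mode (bigD1 i).
have eig : (2 - 2 * cos (phase (K i)))%:C = 2 - (cis (phase (K i)) + cis (- phase (K i))) :> R[i].
  by rewrite cis_addN rmorphB/= rmorph_nat.
set P := \prod_(j | j != i) _ in tE *; set m := mode (K i) (v i) in tE *.
rewrite eig tE /= mode_ordS -/m.
rewrite -/P.
transitivity (m * P - (w i (v i))^-1 * w i (v i) * cis (- phase (K i)) * m * P +
  (m * P - w i (ord_pred (v i)) * mode (K i) (ord_pred (v i)) * P)); first by ring.
by rewrite mode_ord_pred -/m mulVf ?w_neq0//; ring.
Qed.

(** The gauge factors cancel, leaving a geometric sum of ratio q with q^a = 1, and q != 1 when k and
    k' differ. *)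
Lemma mode_orthogonal i (k k' : 'I_(a i)) :
  \sum_(j < a i) (mode k j)^-1 * mode k' j = (a i)%:R * (k == k')%:R.
Proof.
have [<-|kk'] := eqVneq k k'.
  under eq_bigr do rewrite mulVf ?mode_neq0//.
  by rewrite sumr_const card_ord mulr1.
rewrite mulr0; pose q := cis (phase k - phase k').
have aR : (a i)%:R != 0 :> R by rewrite pnatr_eq0 -lt0n.
transitivity (\sum_(j < a i) q ^+ j).
  apply: eq_bigr => j _; rewrite /mode invfM mulrACA mulVf ?mul1r; last first.
    by apply/prodf_neq0 => m _; apply: w_neq0; exact: ltn_trans (ltn_ord m) (ltn_ord j).
  by rewrite -exprVn cisV opprK -exprMn -cisD.
have q1 : q != 1.
  have p0 := pi_gt0 R; have a0 : 0 < (a i)%:R :> R by rewrite ltr0n.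
  have c0 : 0 < 2 * pi / (a i)%:R :> R by rewrite divr_gt0// mulr_gt0.
  apply: cis_neq1; rewrite (_ : _ - _ = 2 * pi / (a i)%:R * (k%:R - k'%:R)); last first.
    by rewrite /phase; field.
  rewrite normrM (gtr0_norm c0).
  have hd : 0 < `|k%:R - k'%:R : R| < (a i)%:R.
    rewrite normr_gt0 subr_eq0 eqr_nat kk'/= ltr_norml; apply/andP; split.
      rewrite ltrBrDr; apply: le_lt_trans (_ : k'%:R - (a i)%:R < _); first by rewrite addrC.
      by rewrite (@lt_le_trans _ _ 0)// subr_lt0 ltr_nat.
    by rewrite ltrBlDr (@lt_le_trans _ _ (a i)%:R) ?ltr_nat// lerDl.
  have /andP[h1 h2] := hd.
  rewrite mulr_gt0//= -[ltRHS](divfK aR) ltr_pM2l//.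
have /eqP := subrX1 q (a i); rewrite (_ : q ^+ a i = 1) ?subrr; last first.
  rewrite -cisMn /phase (_ : _ * _ = 2 * pi * k%:R + - (2 * pi * k'%:R)); last by field.
  by rewrite cisD -cisV !cis_2pin invr1 mulr1.
by rewrite eq_sym mulf_eq0 subr_eq0 (negbTE q1) => /eqP.
Qed.

Lemma torus_mode_orthogonal (K K' : T) :
  \sum_(x : T) (torus_mode K x)^-1 * torus_mode K' x = (\prod_i (a i)%:R) * (K == K')%:R.
Proof.
transitivity (\sum_(x : T) \prod_i ((mode (K i) (x i))^-1 * mode (K' i) (x i))).
  by apply: eq_bigr => x _; rewrite big_split/= prodfV.
rewrite (sum_dffun_prod (fun i j => (mode (K i) j)^-1 * mode (K' i) j)).
under eq_bigr do rewrite mode_orthogonal.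
rewrite big_split/=; congr (_ * _).
have [->|KK'] := eqVneq K K'; first by rewrite big1// => i _; rewrite eqxx.
have [i Ki] : exists i, K i != K' i.
  apply/existsP; apply: contraNT KK'; rewrite negb_exists => /forallP h.
  by apply/eqP/ffunP => i; apply/eqP; rewrite -[_ == _]negbK.
by rewrite (bigD1 i)//= (negbTE Ki) mul0r.
Qed.

Lemma bundle_laplacianE (f : T -> R[i]) v :
  bundle_laplacian w f v =
  \sum_(x : T) bundle_laplacian w (fun y => (y == x)%:R) v * f x.
Proof.
have delta (y : T) : f y = \sum_x (y == x)%:R * f x.
  rewrite (bigD1 y)//= eqxx mul1r big1 ?addr0// => x xy.
  by rewrite eq_sym (negbTE xy) mul0r.
rewrite /bundle_laplacian; under [RHS]eq_bigr do rewrite mulr_suml.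
rewrite exchange_big/=; apply: eq_bigr => g _.
under eq_bigr do rewrite mulrBl -mulrA.
by rewrite sumrB -mulr_sumr -!delta.
Qed.

(** Orthogonality makes Q a left inverse of the matrix P of modes; the relation M P = P D then gives
    det M = det D after cancelling det P. *)
Lemma det_bundle_laplacianE :
  det_bundle_laplacian a w = \prod_(K : T) (torus_eigenvalue K)%:C.
Proof.
pose P : 'M[R[i]]_#|{: T}| := \matrix_(k, m) torus_mode (enum_val m) (enum_val k).
pose Q : 'M[R[i]]_#|{: T}| :=
  \matrix_(m, k) ((\prod_i (a i)%:R)^-1 * (torus_mode (enum_val m) (enum_val k))^-1).
pose D : 'rV[R[i]]_#|{: T}| := \row_m (torus_eigenvalue (enum_val m))%:C.
have N0 : \prod_i (a i)%:R != 0 :> R[i].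
  by apply/prodf_neq0 => i _; rewrite pnatr_eq0 -lt0n.
have QP : Q *m P = 1%:M.
  apply/matrixP => m k; rewrite !mxE.
  under eq_bigr do rewrite !mxE -mulrA.
  rewrite -mulr_sumr.
  rewrite -(big_enum_val (fun x => (torus_mode (enum_val m) x)^-1 * torus_mode (enum_val k) x)).
  rewrite torus_mode_orthogonal mulKf// (inj_eq enum_val_inj)//.
have MP : bundle_laplacian_mx a w *m P = P *m diag_mx D.
  apply/matrixP => k m; rewrite mul_mx_diag !mxE.
  under eq_bigr do rewrite !mxE.
  rewrite -(big_enum_val (fun x => bundle_laplacian w (fun y => (y == x)%:R) (enum_val k) *
    torus_mode (enum_val m) x)).
  by rewrite -bundle_laplacianE bundle_laplacian_mode mulrC.
have [_ /[!unitmxE]/[!unitfE] P0] := mulmx1_unit QP.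
have := congr1 determinant MP; rewrite !det_mulmx det_diag mulrC => /(mulfI P0).
rewrite /det_bundle_laplacian => ->.
under eq_bigr do rewrite mxE.
by rewrite -(big_enum_val (fun K : T => (torus_eigenvalue K)%:C)).
Qed.

Lemma torus_theta_sum t :
  \prod_i lattice_theta (a i) (l i) t = \sum_(K : T) expR (- (t * torus_eigenvalue K)).
Proof.
rewrite -(sum_dffun_prod (fun i (k : 'I_(a i)) =>
  expR (- (t * (2 - 2 * cos (2 * pi * (k%:R + l i) / (a i)%:R)))))).
apply: eq_bigr => K _; rewrite /torus_eigenvalue mulr_sumr -sumrN expR_sum.
by apply: eq_bigr => i _; rewrite /phase !mulrA.
Qed.

(** The phase in direction i0 lies strictly between 0 and 2 pi, as 0 < l i0 < 1. *)
Lemma torus_eigenvalue_gt0 i0 (K : T) : l i0 != 0 -> 0 < torus_eigenvalue K.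
Proof.
move=> l0; have /andP[lge l1] := l_itv i0.
have lgt : 0 < l i0 by rewrite lt0r l0.
have p0 := pi_gt0 R; have a0 : 0 < (a i0)%:R :> R by rewrite ltr0n.
rewrite /torus_eigenvalue (bigD1 i0)//= ltr_wpDr//.
  by apply: sumr_ge0 => i _; rewrite subr_ge0 ler_piMr// cos_le1.
rewrite subr_gt0 gtr_pMr// cos_lt1//; apply/andP; split.
  by rewrite /phase mulr_gt0 ?divr_gt0 ?mulr_gt0// ltr_wpDl.
rewrite /phase -[ltRHS]mulr1 ltr_pM2l ?mulr_gt0// ltr_pdivrMr// mul1r.
have : (K i0).+1%:R <= (a i0)%:R :> R by rewrite ler_nat.
by rewrite -natr1; lra.
Qed.

Lemma clog_det_bundle_laplacian i0 : l i0 != 0 ->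
  clog (det_bundle_laplacian a w) = (\sum_(K : T) ln (torus_eigenvalue K))%:C.
Proof.
move=> l0; rewrite det_bundle_laplacianE -rmorph_prod/= clog_real.
  by rewrite ln_prod// => K; exact: torus_eigenvalue_gt0 l0.
by apply: prodr_gt0 => K _; exact: torus_eigenvalue_gt0 l0.
Qed.

End Determinant.

(** * The Epstein-Hurwitz zeta function *)

Lemma Rintegral_sum (R : realType) (D : set (measurableTypeR R)) (I : Type) (r : seq I)
    (f : I -> R -> R) : measurable D ->
  (forall i, (@lebesgue_measure R).-integrable D (EFin \o f i)) ->
  (@lebesgue_measure R).-integrable D (EFin \o (fun x => \sum_(i <- r) f i x)) /\
  \int[@lebesgue_measure R]_(x in D) (\sum_(i <- r) f i x) =
  \sum_(i <- r) \int[@lebesgue_measure R]_(x in D) f i x.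
Proof.
move=> mD fi; elim: r => [|i r [IH1 IH2]].
  rewrite big_nil (_ : (fun x => _) = cst 0); last by apply/funext => x; rewrite big_nil.
  by split; [exact: integrable0|rewrite Rintegral_cst ?mul0r].
rewrite big_cons -IH2 -RintegralD//.
rewrite (_ : (fun x => \sum_(j <- i :: r) _) = (fun x => f i x + \sum_(j <- r) f j x)).
  by split => //; have := integrableD mD (fi i) IH1.
by apply/funext => x; rewrite big_cons.
Qed.

(** * Mellin transforms of exponentials *)

Section Gamma.
Variable R : realType.
Implicit Types s x q : R.

Local Notation mu := (@lebesgue_measure R).
Local Notation pos := (`]0, +oo[%classic : set R).

Let mpos : measurable (pos : set (measurableTypeR R)).
Proof. exact: measurable_itv. Qed.

Local Notation I01 := (`]0, 1]%classic : set R).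

Lemma ind01 u : 0 < u <= 1 -> \1_I01 u = 1 :> R.
Proof. by move=> u01; rewrite indicE mem_set//= in_itv. Qed.

Lemma ind1y u : 1 < u -> \1_I01 u = 0 :> R.
Proof.
by move=> u1; rewrite indicE memNset//= in_itv/= => /andP[_]; rewrite leNgt u1.
Qed.

Lemma setI_pos01 : pos `&` I01 = I01.
Proof.
by apply/setIidPr => u /=; rewrite !in_itv/= andbT => /andP[].
Qed.

Lemma Rintegral_powR_ind01 b : 0 < b ->
  mu.-integrable pos (EFin \o (fun u => u `^ (b - 1) * \1_I01 u)) /\
  \int[mu]_(u in pos) (u `^ (b - 1) * \1_I01 u) = b^-1.
Proof.
move=> b0.
have E : (\int[mu]_(u in pos) (u `^ (b - 1) * \1_I01 u)%:E = (b^-1)%:E)%E.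
  rewrite -(integral_powR_01 b0) -[in RHS]setI_pos01 integral_mkcondr.
  apply: eq_integral => u _; rewrite patchE indicE.
  by case: ifPn => _; rewrite ?mulr1 ?mulr0.
have m : measurable_fun pos (EFin \o (fun u : R => u `^ (b - 1) * \1_I01 u)).
  apply/measurable_EFinP; apply: measurable_funTS.
  by apply: measurable_funM; [exact: measurable_powR|apply: measurable_indic; exact: measurable_itv].
split; last by rewrite /Rintegral E.
apply/integrableP; split => //.
under eq_integral do rewrite /= ger0_norm ?mulr_ge0 ?powR_ge0 ?indicE ?ler0n//.
under eq_integral do rewrite -indicE.
by rewrite E ltry.
Qed.

Lemma Rintegral_powR_ind1y b : 0 < b ->
  mu.-integrable pos (EFin \o (fun u => u `^ (- b - 1) * (1 - \1_I01 u))) /\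
  \int[mu]_(u in pos) (u `^ (- b - 1) * (1 - \1_I01 u)) = b^-1.
Proof.
move=> b0.
have E : (\int[mu]_(u in pos) (u `^ (- b - 1) * (1 - \1_I01 u))%:E = (b^-1)%:E)%E.
  rewrite -(integral_powR_1y b0).
  transitivity (\int[mu]_(u in `]1%R, +oo[) (u `^ (- b - 1))%:E)%E.
    have -> : (`]1, +oo[%classic : set R) = pos `&` `]1, +oo[%classic.
      by apply/esym/setIidPr => u /=; rewrite !in_itv/= !andbT; exact: lt_trans.
    rewrite integral_mkcondr; apply: eq_integral => u; rewrite inE/= in_itv/= andbT => u0.
    rewrite patchE; case: ifPn; rewrite ?inE ?notin_setE/= in_itv/= andbT.
      by move=> u1; rewrite ind1y// subr0 mulr1.
    by move=> /negP; rewrite -leNgt => u1; rewrite ind01 ?u0// subrr mulr0.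
  by rewrite integral_itv_obnd_cbnd//; apply: measurable_funTS; apply/measurable_EFinP; exact: measurable_powR.
have i0 u : 0 <= 1 - \1_I01 u :> R by rewrite subr_ge0 indicE lern1 leq_b1.
have m : measurable_fun pos (EFin \o (fun u : R => u `^ (- b - 1) * (1 - \1_I01 u))).
  apply/measurable_EFinP; apply: measurable_funTS; apply: measurable_funM; first exact: measurable_powR.
  by apply: measurable_funB => //; apply: measurable_indic; exact: measurable_itv.
split; last by rewrite /Rintegral E.
apply/integrableP; split => //.
under eq_integral do rewrite /= ger0_norm ?mulr_ge0 ?powR_ge0//.
by rewrite E ltry.
Qed.

Lemma expR_le_powR c q : 0 < c ->
  exists2 C : R, 0 <= C & forall u, 1 <= u -> expR (- (c * u)) <= C * u `^ (- q).
Proof.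
move=> c0; pose N := (Num.truncn `|q|).+1.
have N0 : 0 < N%:R :> R by rewrite ltr0n.
have qN : q <= N%:R by apply: le_trans (ler_norm _) (ltW (truncnS_gt _)).
have C0 : 0 <= (N%:R / c) ^+ N by rewrite exprn_ge0// divr_ge0// ltW.
exists ((N%:R / c) ^+ N) => // u u1; have u0 : 0 < u by exact: lt_le_trans u1.
apply: (@le_trans _ _ ((N%:R / c) ^+ N * u `^ (- N%:R))); last first.
  by rewrite ler_wpM2l// ler_powR// lerN2.
have x0 : 0 < c * u / N%:R by rewrite divr_gt0// mulr_gt0.
have key : (c * u / N%:R) ^+ N <= expR (c * u).
  have -> : expR (c * u) = expR (c * u / N%:R) ^+ N.
    by rewrite -expRM_natl; congr expR; field; rewrite gt_eqF.
  apply: lerXn2r; rewrite ?nnegrE ?expR_ge0 ?(ltW x0)//.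
  by apply: le_trans (expR_ge1Dx _); rewrite lerDr.
rewrite powRN powR_mulrn ?(ltW u0)// -exprVn -exprMn.
rewrite (_ : N%:R / c * u^-1 = (c * u / N%:R)^-1); last by field; rewrite !gt_eqF.
by rewrite exprVn expRN lef_pV2 ?posrE ?expR_gt0 ?exprn_gt0.
Qed.

(** Its Mellin transform is Gamma; the factor 1 makes it the instance q = 1 of [mellin_expR]. *)
Definition gamma_term u : R := expR (- (1 * u)).

(* Its Mellin transform is (1 - 2^-s) Gamma(s), which, unlike Gamma, has no pole
   at 0. *)
Definition beta_term u : R := expR (- u) - expR (- 2 * u).

Lemma measurable_gamma_term : measurable_fun pos gamma_term.
Proof.
apply: measurable_funTS; rewrite (_ : gamma_term = fun u => expR (- 1 * u)).
  exact: measurable_expRM.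
by apply/funext => u; rewrite /gamma_term mulNr.
Qed.

Lemma measurable_beta_term : measurable_fun pos beta_term.
Proof.
apply: measurable_funTS; apply: measurable_funB; last exact: measurable_expRM.
by apply: measurableT_comp.
Qed.

(** e^-u (1 - e^-u) vanishes to first order at 0, which puts s = 0 inside the interval of
    convergence of its Mellin transform. *)
Lemma beta_term_bounds q : exists2 C : R, 0 <= C &
  (forall u, 0 < u <= 1 -> `|beta_term u| <= C * u `^ 1) /\
  (forall u, 1 <= u -> `|beta_term u| <= C * u `^ (- q)).
Proof.
have [C C0 hC] := @expR_le_powR 1 q ltr01.
have bE u : beta_term u = expR (- u) * (1 - expR (- u)).
  by rewrite /beta_term mulrBr mulr1 -expRD; congr (_ - expR _); ring.
exists (C + 1); first by rewrite addr_ge0.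
split=> [u /andP[u0 u1]|u u1].
  rewrite powRr1 ?(ltW u0)// bE normrM ger0_norm ?expR_ge0//.
  have e1 : expR (- u) <= 1 by rewrite -[leRHS]expR0 ler_expR oppr_le0 ltW.
  rewrite ger0_norm ?subr_ge0//.
  apply: (@le_trans _ _ (1 * u)).
    apply: ler_pM; rewrite ?expR_ge0 ?subr_ge0//.
    by have := expR_ge1Dx (- u); lra.
  by rewrite ler_wpM2r ?(ltW u0)// lerDr.
have u0 : 0 < u by exact: lt_le_trans u1.
have e1 : expR (- u) <= 1 by rewrite -[leRHS]expR0 ler_expR oppr_le0 ltW.
have e0 := expR_gt0 (- u).
rewrite bE normrM ger0_norm ?expR_ge0// ger0_norm ?subr_ge0//.
have := hC u u1; rewrite mul1r => h.
apply: (@le_trans _ _ (expR (- u))); first by rewrite ger_pMr// gerBl ltW.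
by apply: le_trans h _; rewrite ler_wpM2r ?powR_ge0// lerDl.
Qed.

Lemma real_analytic_beta s : -1 < s -> real_analytic_at (mellin beta_term) s.
Proof.
move=> s1; have [C _ [b0 b1]] := beta_term_bounds (s + 1).
by apply: (mellin_analytic measurable_beta_term b0 b1); rewrite s1/= ltrDl ltr01.
Qed.

(** The Frullani integral at 2. As it is not zero, [Z_derive1] can divide by it. *)
Lemma beta_0 : mellin beta_term 0 = ln 2.
Proof.
rewrite -(Rintegral_frullani _).2 //; apply: eq_Rintegral => u.
by rewrite inE/= in_itv/= andbT => u0; rewrite sub0r powR_inv1// ltW.
Qed.

Lemma integrable_gamma s : 0 < s ->
  mu.-integrable pos (EFin \o (fun u => gamma_term u * u `^ (s - 1))).
Proof.
move=> s0; have [C C0 hC] := @expR_le_powR 1 (s + 1) ltr01.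
apply: (@integrable_mellin _ _ (C + 1) 0 (s + 1)).
- exact: measurable_gamma_term.
- move=> u /andP[u0 u1]; rewrite powRr0 mulr1 ger0_norm ?expR_ge0//.
  apply: (@le_trans _ _ 1); last by rewrite lerDr.
  by rewrite -[leRHS]expR0 ler_expR oppr_le0 mul1r ltW.
- move=> u u1; rewrite ger0_norm ?expR_ge0//; apply: le_trans (hC u u1) _.
  by rewrite ler_wpM2r ?powR_ge0// lerDl.
- by rewrite oppr0 s0/= ltrDl ltr01.
Qed.

Lemma mellin_expR q s : 0 < q -> 0 < s ->
  mu.-integrable pos (EFin \o (fun u => expR (- (q * u)) * u `^ (s - 1))) /\
  \int[mu]_(u in pos) (expR (- (q * u)) * u `^ (s - 1)) = q `^ (- s) * mellin gamma_term s.
Proof.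
move=> q0 s0; have gi := integrable_gamma s0.
have qs : 0 < q `^ (1 - s) by rewrite powR_gt0.
have E u : 0 < u -> expR (- (q * u)) * u `^ (s - 1) =
    q `^ (1 - s) * (gamma_term (q * u) * (q * u) `^ (s - 1)).
  move=> u0; rewrite /gamma_term mul1r powRM ?(ltW q0) ?(ltW u0)//.
  rewrite [RHS]mulrCA; congr (_ * _); rewrite mulrA -pos_powRD//.
  by rewrite (_ : 1 - s + (s - 1) = 0) ?powRr0 ?mul1r//; ring.
have si := integrable_scale q0 gi; split.
  have := integrableZl mpos (q `^ (1 - s)) si.
  apply: eq_integrable => // u; rewrite inE/= in_itv/= andbT => u0.
  by rewrite (E u u0) EFinM.
transitivity (\int[mu]_(u in pos) (q `^ (1 - s) * (gamma_term (q * u) * (q * u) `^ (s - 1)))).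
  by apply: eq_Rintegral => u; rewrite inE/= in_itv/= andbT => u0; exact: E.
have si' : mu.-integrable pos (EFin \o (fun u => gamma_term (q * u) * (q * u) `^ (s - 1))).
  exact: si.
rewrite (RintegralZl (q `^ (1 - s)) mpos si').
rewrite (Rintegral_scale q0 gi) mulrA; congr (_ * _).
by rewrite -powR_inv1 ?(ltW q0)// -pos_powRD//; congr (_ `^ _); ring.
Qed.

Lemma mellin_gamma_gt0 s : 0 < s -> 0 < mellin gamma_term s.
Proof.
move=> s0; have [i1 e1] := Rintegral_powR_ind01 s0.
apply: (@lt_le_trans _ _ (expR (- 1) * s^-1)); first by rewrite mulr_gt0 ?expR_gt0 ?invr_gt0.
rewrite -e1 -RintegralZl//; apply: le_Rintegral => //.
- exact: (integrableZl mpos (expR (- 1)) i1).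
- exact: integrable_gamma.
- move=> u; rewrite /= in_itv/= andbT => u0; have [u1|u1] := leP u 1; last first.
    by rewrite ind1y// !mulr0 mulr_ge0 ?expR_ge0 ?powR_ge0.
  by rewrite ind01 ?u0// mulr1 ler_wpM2r ?powR_ge0// /gamma_term ler_expR mul1r lerN2.
Qed.

Lemma beta_gamma s : 0 < s -> mellin beta_term s = (1 - 2 `^ (- s)) * mellin gamma_term s.
Proof.
move=> s0; have [i1 e1] := mellin_expR ltr01 s0.
have [i2 e2] := mellin_expR (ltr0n R 2) s0.
rewrite mulrBl mul1r -e2.
rewrite [X in _ = X - _](_ : _ = \int[mu]_(u in pos) (expR (- (1 * u)) * u `^ (s - 1)))//.
rewrite -RintegralB//; apply: eq_Rintegral => u _.
by rewrite /beta_term mul1r mulNr mulrBl.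
Qed.

End Gamma.

Section Exponential.
Variable R : realType.

Lemma real_analytic_expRM (c s : R) : real_analytic_at (fun x => expR (c * x)) s.
Proof.
exists 1 => //; exists (fun k => expR (c * s) * (c ^+ k / k`!%:R)) => h _.
rewrite mulrDr expRD.
rewrite (_ : series _ = fun n => expR (c * s) * \sum_(k < n) (c * h) ^+ k / k`!%:R).
  by apply: cvgM; [exact: cvg_cst|exact: cvg_exp_series].
apply/funext => n; rewrite seriesEord/= mulr_sumr; apply: eq_bigr => k _.
by rewrite exprMn; ring.
Qed.

Lemma expRM_slope (c : R) : (fun h => (expR (c * h) - 1) / h) @ 0^' --> c.
Proof.
have d := is_derive_expRM c (0 : R).
have h := @ex_derive _ _ _ _ _ _ _ d.
have e := @derive_val _ _ _ _ _ _ _ d.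
rewrite mulr0 expR0 mulr1 in e.
rewrite -[X in _ --> X]e.
rewrite /derive.
apply: cvg_trans; last exact: h.
apply: near_eq_cvg; near=> x => /=.
by rewrite mulr0 expR0 addr0 /GRing.scale/= mulr1 mulrC.
Unshelve. all: by end_near.
Qed.

End Exponential.

Lemma cvg_dnbhs_right (R : realType) (f : R -> R) (x l : R) : f @ x^' --> l -> f @ x^'+ --> l.
Proof.
move=> fl A /fl /= h; rewrite /nbhs/= in h *; move: h.
by apply: within_subset => z /= xz; rewrite gt_eqF.
Qed.

(** * Continuation of a Mellin transform below its pole *)

Section Continuation.
Variables (R : realType) (T : R -> R) (V delta : R).

Local Notation mu := (@lebesgue_measure R).
Local Notation pos := (`]0, +oo[%classic : set R).

Let mpos : measurable (pos : set (measurableTypeR R)).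
Proof. exact: measurable_itv. Qed.

Hypothesis delta_gt0 : 0 < delta.
Hypothesis mT : measurable_fun pos T.
Hypothesis T_decay : exists C c : R, [/\ 0 <= C, 0 < c &
  forall u, 1 <= u -> 0 <= T u <= C * expR (- (c * u))].
Hypothesis T_small : exists2 C : R, 0 <= C &
  forall u, 0 < u <= 1 -> `|V * u `^ (- delta) - T u| <= C * u.

Local Notation I01 := (`]0, 1]%classic : set R).

Definition truncated_theta u : R := T u - V * (u `^ (- delta) * \1_I01 u).

Lemma measurable_truncated_theta : measurable_fun pos truncated_theta.
Proof.
apply: measurable_funB => //; apply: measurable_funM => //; apply: measurable_funTS.
by apply: measurable_funM; [exact: measurable_powR|apply: measurable_indic; exact: measurable_itv].
Qed.

Lemma truncated_theta_bounds q : exists2 C : R, 0 <= C &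
  (forall u, 0 < u <= 1 -> `|truncated_theta u| <= C * u `^ 1) /\
  (forall u, 1 <= u -> `|truncated_theta u| <= C * u `^ (- q)).
Proof.
have [C [c [C0 c0 hC]]] := T_decay; have [D D0 hD] := T_small.
have [E E0 hE] := expR_le_powR q c0.
exists (D + C * E); first by rewrite addr_ge0 ?mulr_ge0.
have small u : 0 < u <= 1 -> `|truncated_theta u| <= (D + C * E) * u.
  move=> u01; rewrite /truncated_theta ind01// mulr1 distrC.
  apply: le_trans (hD u u01) _; rewrite ler_wpM2r ?lerDl ?mulr_ge0//.
  by case/andP: u01 => /ltW.
split=> [u u01|u].
  by rewrite powRr1 ?small//; case/andP: u01 => /ltW.
rewrite le_eqVlt => /predU1P[<-|u1].
  by rewrite powR1; apply: small; rewrite ltr01 lexx.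
rewrite /truncated_theta ind1y// mulr0 mulr0 subr0.
have /andP[t0 t1] := hC u (ltW u1).
rewrite ger0_norm//; apply: le_trans t1 _.
apply: (@le_trans _ _ (C * (E * u `^ (- q)))); first by rewrite ler_wpM2l// hE// ltW.
by rewrite mulrA ler_wpM2r ?powR_ge0// lerDr.
Qed.

Lemma real_analytic_truncated s : -1 < s -> real_analytic_at (mellin truncated_theta) s.
Proof.
move=> s1; have [C _ [b0 b1]] := truncated_theta_bounds (s + 1).
by apply: (mellin_analytic measurable_truncated_theta b0 b1); rewrite s1/= ltrDl ltr01.
Qed.

Lemma integrable_truncated s : -1 < s ->
  mu.-integrable pos (EFin \o (fun u => truncated_theta u * u `^ (s - 1))).
Proof.
move=> s1; have [C _ [b0 b1]] := truncated_theta_bounds (s + 1).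
by apply: (integrable_mellin measurable_truncated_theta b0 b1); rewrite s1/= ltrDl ltr01.
Qed.

Lemma mellin_theta s : delta < s ->
  mu.-integrable pos (EFin \o (fun u => T u * u `^ (s - 1))) /\
  mellin T s = mellin truncated_theta s + V / (s - delta).
Proof.
move=> ds; have s1 : -1 < s by move: delta_gt0; lra.
have [i1 e1] := @Rintegral_powR_ind01 R (s - delta) ltac:(by rewrite subr_gt0).
have i2 := integrable_truncated s1.
have i3 := integrableZl mpos V i1.
have E u : 0 < u -> T u * u `^ (s - 1) =
    truncated_theta u * u `^ (s - 1) + V * (u `^ (s - delta - 1) * \1_I01 u).
  move=> u0; rewrite /truncated_theta (_ : s - delta - 1 = - delta + (s - 1)); last by ring.
  by rewrite (pos_powRD (- delta) (s - 1) u0); ring.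
split.
  have := integrableD mpos i2 i3.
  apply: eq_integrable => // u; rewrite inE/= in_itv/= andbT => u0.
  by rewrite (E u u0) EFinD EFinM.
rewrite -e1 -RintegralZl// /mellin -RintegralD//.
by apply: eq_Rintegral => u; rewrite inE/= in_itv/= andbT => u0; exact: E.
Qed.

(** V/delta is the integral of V u^(-delta-1) over u > 1, the part of the singular term that the
    truncation leaves out. *)
Lemma truncated_theta_0 :
  mu.-integrable pos (EFin \o (fun u => (V * u `^ (- delta) - T u) / u)) ->
  mellin truncated_theta 0 - V / delta =
  - \int[mu]_(u in pos) ((V * u `^ (- delta) - T u) / u).
Proof.
move=> i1; have [i2 e2] := Rintegral_powR_ind1y delta_gt0.
have i3 := integrableZl mpos V i2.
rewrite -e2 -RintegralZl//.
have i4 := integrable_truncated (ltrN10 R).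
have -> : mellin truncated_theta 0 =
    \int[mu]_(u in pos) (V * (u `^ (- delta - 1) * (1 - \1_I01 u))) -
    \int[mu]_(u in pos) ((V * u `^ (- delta) - T u) / u).
  rewrite -RintegralB//; apply: eq_Rintegral => u.
  rewrite inE/= in_itv/= andbT => u0.
  by rewrite /truncated_theta sub0r (pos_powRD _ _ u0) powR_inv1 ?(ltW u0)//; ring.
by ring.
Qed.

Section Zeta.
Variable Z : R[i]^o -> R[i]^o.
Hypothesis Z_mellin : forall s, delta < s -> exists2 z : R,
  Z s%:C = z%:C & mellin (@gamma_term R) s * z = mellin T s.
Hypothesis Z_analytic : forall s : R[i], s != delta%:C -> analytic_at Z s.
Hypothesis Z_pole : simple_pole_at Z delta%:C.

(** The simple pole cancels s - delta; at delta the product is given the value of the regular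
    function h. Stated for [part], so as to serve both real and imaginary parts. *)
Lemma real_analytic_pole (part : R[i] -> R) :
  (forall r z, part (r%:C * z) = r * part z) ->
  (forall (f : R[i]^o -> R[i]^o) s, analytic_at f s%:C -> real_analytic_at (fun x => part (f x%:C)) s) ->
  exists H : R -> R, (forall s, real_analytic_at H s) /\
    forall s, s != delta -> H s = (s - delta) * part (Z s%:C).
Proof.
move=> partM partA; have [h [ha _ /near_complex[r r0 hZ]]] := Z_pole.
exists (fun s => if s == delta then part (h delta%:C) else (s - delta) * part (Z s%:C)); split; last first.
  by move=> s /negbTE ->.
move=> s; have [->|sd] := eqVneq s delta.
  apply: near_real_analytic_at (partA _ _ ha).
  apply/nbhs_ballP; exists r => //= x; rewrite /ball/= => xr.
  have [->//|xd] := eqVneq x delta.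
  have xd0 : x - delta != 0 by rewrite subr_eq0.
  rewrite hZ; last 2 first.
  - by rewrite -rmorphB normc_real ltcR distrC.
  - by apply: contraNN xd => /eqP/(congr1 (@complex.Re R))/= ->.
  have xdC : x%:C - delta%:C != 0 :> R[i].
    by apply: contraNN xd0 => /eqP/(congr1 (@complex.Re R))/= ->.
  by rewrite -partM mulrCA rmorphB/= divff// mulr1.
apply: (@near_real_analytic_at _ (fun x => (x + - delta) * part (Z x%:C))).
  have : \forall x \near s, x != delta by exact: open_neq.
  by apply: filterS => x /negbTE ->.
apply: real_analyticM; last first.
  by apply: partA; apply: Z_analytic; apply: contraNN sd => /eqP/(congr1 (@complex.Re R))/= ->.
by apply: real_analyticD; [exact: real_analytic_id|exact: real_analytic_cst].
Qed.

(** The imaginary part of (s - delta) Z(s) is real-analytic and vanishes on the half-line of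
    convergence. *)
Lemma Z_real s : -1 < s -> s != delta -> complex.Im (Z s%:C) = 0.
Proof.
move=> s1 sd.
have [H [Ha HE]] := @real_analytic_pole (@complex.Im R)
  (fun r z => ltac:(by case: z => x y /=; rewrite mul0r addr0)) (@analytic_at_Im R).
have H0 : H s = 0.
  apply: (@real_analytic_identity R H (- 1) delta) s1 => // t dt.
  rewrite HE ?gt_eqF//; have [z -> _] := Z_mellin dt; by rewrite /= mulr0.
move: H0; rewrite HE// => /eqP.
by rewrite mulf_eq0 subr_eq0 (negbTE sd) => /eqP.
Qed.

(* Both sides are analytic on ]-1, +oo[ and agree on the half-line of convergence. *)
Lemma Z_continuation s : -1 < s -> s != delta ->
  mellin (@beta_term R) s * ((s - delta) * complex.Re (Z s%:C)) =
  (1 - expR (- ln 2 * s)) * ((s - delta) * mellin truncated_theta s + V).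
Proof.
move=> s1 sd.
have [H [Ha HE]] := @real_analytic_pole (@complex.Re R)
  (fun r z => ltac:(by case: z => x y /=; rewrite mul0r subr0)) (@analytic_at_Re R).
rewrite -HE//; apply/eqP; rewrite -subr_eq0; apply/eqP.
(* The difference of the two sides, written with sums and products alone so that the closure
   properties of real-analytic functions apply directly. *)
pose D t := mellin (@beta_term R) t * H t +
  (- 1) * ((1 + (- 1) * expR (- ln 2 * t)) * ((t + - delta) * mellin truncated_theta t + V)).
rewrite (_ : _ - _ = D s); last by rewrite /D; ring.
apply: (@real_analytic_identity R D (- 1) delta) s1 => [t t1|t dt].
  apply: real_analyticD; first by apply: real_analyticM => //; exact: real_analytic_beta.
  apply: real_analyticM; first exact: real_analytic_cst.
  apply: real_analyticM.
    apply: real_analyticD; first exact: real_analytic_cst.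
    by apply: real_analyticM; [exact: real_analytic_cst|exact: real_analytic_expRM].
  apply: real_analyticD; last exact: real_analytic_cst.
  apply: real_analyticM; last exact: real_analytic_truncated.
  by apply: real_analyticD; [exact: real_analytic_id|exact: real_analytic_cst].
have t0 : 0 < t by exact: lt_trans dt.
rewrite /D HE ?gt_eqF//; have [z -> /= zE] := Z_mellin dt.
have [_ mT'] := mellin_theta dt.
rewrite beta_gamma// (_ : 2 `^ (- t) = expR (- ln 2 * t)); last first.
  by rewrite /powR pnatr_eq0/=; congr expR; ring.
have td : t - delta != 0 by rewrite subr_eq0 gt_eqF.
have -> : V = (t - delta) * (mellin (@gamma_term R) t * z - mellin truncated_theta t).
  by rewrite zE mT'; field.
ring.
Qed.

(** At s = 0 the factor 1 - 2^-s vanishes whereas beta(0) = ln 2, so Z(0) = 0. The difference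
    quotient of Z is then that of 1 - 2^-s times continuous factors, and its limit ln 2 cancels
    beta(0). *)
Lemma Z_derive1 :
  mu.-integrable pos (EFin \o (fun u => (V * u `^ (- delta) - T u) / u)) ->
  derive1 Z 0 = (- \int[mu]_(u in pos) ((V * u `^ (- delta) - T u) / u))%:C.
Proof.
move=> Fi; rewrite -truncated_theta_0//.
have l2 : 0 < ln 2 :> R by rewrite ln_gt0// ltr1n.
have ReE h : -1 < h -> h < delta -> mellin (@beta_term R) h * complex.Re (Z h%:C) =
    (1 - expR (- ln 2 * h)) * (mellin truncated_theta h - V / (delta - h)).
  move=> h1 hd; have hd0 : h - delta != 0 by rewrite subr_eq0 lt_eqF.
  have dh0 : delta - h != 0 by rewrite subr_eq0 gt_eqF.
  have /(_ _)/(congr1 (fun x => (h - delta)^-1 * x)) := Z_continuation h1.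
  rewrite lt_eqF// => /(_ isT).
  rewrite mulrCA mulKf// => ->; field; rewrite dh0 hd0//.
have Re0 : complex.Re (Z 0) = 0.
  have := ReE 0 (ltrN10 R) delta_gt0; rewrite mulr0 expR0 subrr mul0r beta_0 => /eqP.
  by rewrite mulf_eq0 (gt_eqF l2) => /eqP.
have c0 : analytic_at Z 0.
  by apply: Z_analytic; apply/eqP => /(congr1 (@complex.Re R))/= /esym/eqP; rewrite gt_eqF.
apply: (analytic_at_derive1 c0 delta_gt0).
  move=> h /andP[h0 hd]; apply: Z_real; last by rewrite lt_eqF.
  by apply: lt_le_trans h0; rewrite ltrN10.
have Bc : mellin (@beta_term R) h @[h --> 0^'+] --> ln 2.
  rewrite -beta_0; apply: cvg_at_right_filter.
  by apply: real_analytic_continuous; exact: real_analytic_beta (ltrN10 R).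
have Ac : mellin truncated_theta h @[h --> 0^'+] --> mellin truncated_theta 0.
  apply: cvg_at_right_filter.
  by apply: real_analytic_continuous; exact: real_analytic_truncated (ltrN10 R).
have Sc : (fun h : R => (expR (- ln 2 * h) - 1) / h) @ (0 : R)^'+ --> (- ln 2 : R).
  exact: (cvg_dnbhs_right (@expRM_slope R (- ln 2))).
have Vc : (fun h => V / (delta - h)) @ 0^'+ --> V / delta.
  rewrite -[X in _ --> V / X]subr0; apply: cvgM; first exact: cvg_cst.
  apply: cvgV; first by rewrite subr0 gt_eqF.
  by apply: cvgB; [exact: cvg_cst|exact: cvg_at_right_filter].
have lim : (fun h => - ((expR (- ln 2 * h) - 1) / h) * (mellin truncated_theta h - V / (delta - h)) *
    (mellin (@beta_term R) h)^-1) @ 0^'+ -->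
    - - ln 2 * (mellin truncated_theta 0 - V / delta) * (ln 2)^-1.
  apply: cvgM; last by apply: cvgV => //; rewrite gt_eqF.
  by apply: cvgM; [exact: cvgN|exact: cvgB].
rewrite opprK mulrAC divff ?gt_eqF// mul1r in lim.
apply: cvg_trans lim; apply: near_eq_cvg.
have Bpos : \forall h \near 0^'+, 0 < mellin (@beta_term R) h by exact: cvgr_gt Bc _ l2.
have dn : \forall h \near (0:R)^'+, h < delta by exact: nbhs_right_lt.
apply: filterS3 Bpos dn (nbhs_right_gt (0 : R)) => h B0 hd h0.
have h1 : -1 < h by rewrite (lt_trans _ h0)// ltrN10.
have ReZ : complex.Re (Z h%:C) = (mellin (@beta_term R) h)^-1 *
    ((1 - expR (- ln 2 * h)) * (mellin truncated_theta h - V / (delta - h))).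
  by rewrite -ReE// mulKf ?gt_eqF.
by rewrite Re0 subr0 ReZ; ring.
Qed.

End Zeta.

End Continuation.

(** * Unconditional sums and their exhaustion by boxes *)

Section UnconditionalSums.
Variable R : realType.

Lemma cpow_real (x r : R) : 0 < x -> cpow x r%:C = (x `^ r)%:C.
Proof.
move=> x0; rewrite /cpow -rmorphM/= /cexp/= cos0 sin0 mulr1.
by rewrite /powR gt_eqF.
Qed.

Lemma ler_sum_subset (I : eqType) (s1 s2 : seq I) (f : I -> R) : (forall i, 0 <= f i) ->
  uniq s1 -> uniq s2 -> {subset s1 <= s2} -> \sum_(i <- s1) f i <= \sum_(i <- s2) f i.
Proof.
move=> f0; elim: s1 s2 => [|x s1 IH] s2 /=; first by move=> *; rewrite big_nil sumr_ge0.
move=> /andP[xs1 u1] u2 s12; have xs2 : x \in s2 by rewrite s12// mem_head.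
rewrite big_cons (big_rem x xs2)/= lerD2l; apply: IH => //; first exact: rem_uniq.
move=> y ys1; rewrite mem_rem_uniq// inE s12 ?inE ?ys1 ?orbT// andbT.
by apply: contraNneq xs1 => <-.
Qed.

(** For non-negative terms every finite partial sum is at most L, and some s N comes within e of L;
    so does every finite set containing s N. *)
Lemma sum_totally (I : choiceType) (f : I -> R) (s : nat -> seq I) (L : R) :
  (forall i, 0 <= f i) -> (forall n, uniq (s n)) ->
  (forall A : {fset I}, exists n, forall m, (n <= m)%N -> {subset A <= s m}) ->
  (fun n => \sum_(i <- s n) f i) @ \oo --> L ->
  @summability.sum _ _ R[i]^o (fun i => (f i)%:C) = L%:C.
Proof.
move=> f0 us sA sL; have PF := @totally_filter I.
have le_L (A : {fset I}) : \sum_(i <- A) f i <= L.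
  have [n An] := sA A; apply: (cvgr_to_ge sL); exists n => // m /= nm.
  by apply: ler_sum_subset => //; exact: An.
have cv : (fun A : {fset I} => \sum_(i <- A) f i) @ totally --> L.
  apply/cvgrPdist_le => e e0.
  have Le : L - e < L by rewrite ltrBlDr ltrDl.
  have [N _ /(_ N (leqnn N))/= hN] : \forall n \near \oo, L - e <= \sum_(i <- s n) f i.
    exact: cvgr_ge sL _ Le.
  exists [fset i in s N]%fset => // B /= /fsubsetP NB.
  rewrite ger0_norm ?subr_ge0// lerBlDr -lerBlDl; apply: le_trans hN _.
  by apply: ler_sum_subset => // i iN; apply: NB; rewrite !inE.
rewrite /summability.sum; apply/cvg_lim; first exact: norm_hausdorff.
have -> : (partial_sum (fun i => (f i)%:C) : {fset I} -> R[i]^o) = (fun A => (\sum_(i <- A) f i)%:C).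
  by apply/funext => A; rewrite /partial_sum rmorph_sum/= big_seq_fsetE.
exact: (cvg_real_complex cv).
Qed.

End UnconditionalSums.

Section Box.
Variable d : nat.

(* As Negz k is - k.+1, this is a bijection from 'I_n * bool to [-n, n). *)
Definition signed_int n (k : 'I_n * bool) : int := if k.2 then Negz k.1 else Posz k.1.

Definition box_point n (g : {ffun 'I_d -> 'I_n * bool}) : {ffun 'I_d -> int} :=
  [ffun i => signed_int (g i)].

Definition box n : seq {ffun 'I_d -> int} := [seq box_point g | g <- enum {: {ffun 'I_d -> 'I_n * bool}}].

Lemma box_point_inj n : injective (@box_point n).
Proof.
move=> g h /ffunP gh; apply/ffunP => i; have := gh i; rewrite !ffunE /signed_int.
by case: (g i) (h i) => [k []] [m []] //= [km]; congr (_, _); exact: val_inj.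
Qed.

Lemma box_uniq n : uniq (box n).
Proof. by rewrite map_inj_uniq ?enum_uniq//; exact: box_point_inj. Qed.

Lemma mem_box n (K : {ffun 'I_d -> int}) : (forall i, (absz (K i) < n)%N) -> K \in box n.
Proof.
case: n => [|n] Kn.
  have E : K = @box_point 0 [ffun i => (Ordinal (Kn i), false)].
    by apply/ffunP => i; have := Kn i.
  by rewrite E map_f// mem_enum.
pose g : {ffun 'I_d -> 'I_n.+1 * bool} :=
  [ffun i => match K i with Posz k => (inord k, false) | Negz k => (inord k, true) end].
have -> : K = box_point g.
  apply/ffunP => i; rewrite !ffunE /signed_int; have := Kn i.
  by case: (K i) => k /= kn; rewrite inordK// ltnW.
by rewrite map_f// mem_enum.
Qed.

Lemma box_exhausts (A : {fset {ffun 'I_d -> int}}) :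
  exists n, forall m, (n <= m)%N -> {subset A <= box m}.
Proof.
exists (\sum_(K <- A) \sum_i (absz (K i)).+1)%N => m nm K KA; apply: mem_box => i.
apply: leq_trans nm; rewrite (big_rem K)//= (bigD1 i)//= -addnA.
exact: leq_addr.
Qed.

End Box.

(** * Mellin representation of the Epstein-Hurwitz series *)

Section ZetaMellin.
Variables (R : realType) (d : nat) (alpha lambda : 'I_d -> R).
Hypothesis alpha_gt0 : forall i, 0 < alpha i.
Hypothesis lambda_itv : forall i, 0 <= lambda i <= 1.
Variable i0 : 'I_d.
Hypothesis lambda_neq0 : lambda i0 != 0.
Hypothesis lambda_neq1 : lambda i0 != 1.

Local Notation mu := (@lebesgue_measure R).
Local Notation pos := (`]0, +oo[%classic : set R).
Local Notation T := (theta_lim alpha lambda).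

Let mpos : measurable (pos : set (measurableTypeR R)).
Proof. exact: measurable_itv. Qed.

Definition zeta_form (K : {ffun 'I_d -> int}) : R :=
  \sum_i (((K i)%:~R + lambda i) / alpha i) ^+ 2.

Lemma zeta_form_gt0 K : 0 < zeta_form K.
Proof.
rewrite /zeta_form (bigD1 i0)//= ltr_wpDr ?sumr_ge0// => [i _|]; first exact: sqr_ge0.
rewrite lt0r sqr_ge0 andbT sqrf_eq0 mulf_neq0 ?invr_neq0 ?(lt0r_neq0 (alpha_gt0 i0))//.
have /andP[l0 l1] := lambda_itv i0.
have l0' : 0 < lambda i0 by rewrite lt0r lambda_neq0.
have l1' : lambda i0 < 1 by rewrite lt_neqAle lambda_neq1.
case: (K i0) => k; first by rewrite gt_eqF// ltr_wpDl.
rewrite NegzE mulrNz addrC subr_eq0 lt_eqF// (lt_le_trans l1')//.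
by rewrite -[1]/(1%:~R) ler_int.
Qed.

(** [theta_line_term] k collects the indices k and - (k + 1), so truncating each theta series at n
    is exactly summing over the box [-n, n)^d. *)
Lemma theta_box n u :
  \prod_i series (theta_line_term (4 * pi ^+ 2 * (u / alpha i ^+ 2)) (lambda i)) n =
  \sum_(K <- box d n) expR (- (4 * pi ^+ 2 * zeta_form K * u)).
Proof.
transitivity (\prod_(i < d) \sum_(k : 'I_n * bool)
    expR (- (4 * pi ^+ 2 * (u / alpha i ^+ 2) * ((signed_int k)%:~R + lambda i) ^+ 2))).
  apply: eq_bigr => i _; rewrite seriesEord -(pair_bigA _ (fun k b =>
    expR (- (4 * pi ^+ 2 * (u / alpha i ^+ 2) * ((signed_int (k, b))%:~R + lambda i) ^+ 2))))/=.
  apply: eq_bigr => k _; rewrite big_bool /theta_line_term addrC /signed_int/=; congr (expR (- (_ * _)) + _).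
  by rewrite NegzE mulrNz -[RHS]sqrrN opprD opprK.
rewrite bigA_distr_bigA /box big_map big_enum/=; apply: eq_bigr => g _.
rewrite -expR_sum; congr expR; rewrite sumrN; congr (- _).
rewrite /zeta_form mulr_sumr mulr_suml; apply: eq_bigr => i _.
by rewrite ffunE exprMn exprVn; ring.
Qed.

Hypothesis mT : measurable_fun pos T.
Hypothesis T_decay : exists C c : R, [/\ 0 <= C, 0 < c &
  forall u, 1 <= u -> 0 <= T u <= C * expR (- (c * u))].
Variable V : R.
Hypothesis T_small : exists2 C : R, 0 <= C &
  forall u, 0 < u <= 1 -> `|V * u `^ (- (d%:R / 2)) - T u| <= C * u.
Hypothesis d_gt0 : (0 < d)%N.

(** Termwise integration over boxes. The truncated products increase to T, so T itself, whose Mellin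
    integral converges for s > d/2, dominates them; convergence of the lattice sum is part of the
    result. *)
Lemma cvg_box_mellin s : d%:R / 2 < s ->
  (fun n => \sum_(K <- box d n) (4 * pi ^+ 2 * zeta_form K) `^ (- s)) @ \oo -->
  mellin T s / mellin (@gamma_term R) s.
Proof.
move=> ds; have d0 : 0 < d%:R / 2 :> R by rewrite divr_gt0// ltr0n.
have s0 : 0 < s by exact: lt_trans ds.
have G0 := mellin_gamma_gt0 s0.
have pi2 : 0 < 4 * pi ^+ 2 :> R by rewrite mulr_gt0// exprn_gt0// pi_gt0.
have [Ti _] := mellin_theta d0 mT T_decay T_small ds.
pose f n u := (\prod_i series (theta_line_term (4 * pi ^+ 2 * (u / alpha i ^+ 2)) (lambda i)) n) *
  u `^ (s - 1).
have intK K : mu.-integrable pos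
     (EFin \o (fun u => expR (- (4 * pi ^+ 2 * zeta_form K * u)) * u `^ (s - 1))) /\
   \int[mu]_(u in pos) (expR (- (4 * pi ^+ 2 * zeta_form K * u)) * u `^ (s - 1)) =
   (4 * pi ^+ 2 * zeta_form K) `^ (- s) * mellin (@gamma_term R) s.
  by apply: mellin_expR => //; rewrite mulr_gt0// zeta_form_gt0.
have fE n : mu.-integrable pos (EFin \o f n) /\
    \int[mu]_(u in pos) f n u =
    (\sum_(K <- box d n) (4 * pi ^+ 2 * zeta_form K) `^ (- s)) * mellin (@gamma_term R) s.
  have -> : f n = fun u => \sum_(K <- box d n) (expR (- (4 * pi ^+ 2 * zeta_form K * u)) * u `^ (s - 1)).
    by apply/funext => u; rewrite /f theta_box mulr_suml.
  have [fi ->] := Rintegral_sum (box d n) mpos (fun K => (intK K).1).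
  split => //; rewrite mulr_suml; apply: eq_bigr => K _; exact: (intK K).2.
have cvf u : 0 < u -> f ^~ u @ \oo --> T u * u `^ (s - 1).
  move=> u0; apply: cvgM; last exact: cvg_cst.
  apply: (@cvg_finite_prod _ _ _ _ _ _ (fun i n =>
    series (theta_line_term (4 * pi ^+ 2 * (u / alpha i ^+ 2)) (lambda i)) n)) => i.
  by apply: cvg_theta_line => //; rewrite mulr_gt0// divr_gt0// exprn_gt0.
have [n|n u|u|_ lim] := @Rintegral_dominated_cvg R f (fun u => T u * u `^ (s - 1))
  (fun u => T u * u `^ (s - 1)) pos mpos _ Ti.
- have [fi _] := fE n.
  by move/integrableP: fi => [/measurable_EFinP].
- rewrite /= in_itv/= andbT => u0.
  rewrite ger0_norm; last by rewrite mulr_ge0 ?powR_ge0// theta_box sumr_ge0// => K _; exact: expR_ge0.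
  rewrite ler_wpM2r ?powR_ge0//; apply: ler_prod => i _; apply/andP; split.
    by apply: sumr_ge0 => k _; rewrite addr_ge0 ?expR_ge0.
  have c0 : 0 < 4 * pi ^+ 2 * (u / alpha i ^+ 2) by rewrite mulr_gt0// divr_gt0// exprn_gt0.
  have cv := cvg_theta_line c0 (lambda_itv i).
  rewrite -(cvg_lim (@norm_hausdorff _ _) cv); apply: nondecreasing_cvgn_le; last first.
    by apply/cvg_ex; eexists; exact: cv.
  apply/nondecreasing_seqP => k; rewrite seriesS/= lerDr.
  by rewrite addr_ge0 ?expR_ge0.
- by rewrite /= in_itv/= andbT; exact: cvf.
have -> : (fun n => \sum_(K <- box d n) (4 * pi ^+ 2 * zeta_form K) `^ (- s)) =
    (fun n => (\int[mu]_(u in pos) f n u) / mellin (@gamma_term R) s).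
  by apply/funext => n; rewrite (fE n).2 mulfK// gt_eqF.
by apply: cvgM; [exact: lim|exact: cvg_cst].
Qed.

Lemma zetaEH_series_mellin s : d%:R / 2 < s -> exists2 z : R,
  zetaEH_series alpha lambda s%:C = z%:C & mellin (@gamma_term R) s * z = mellin T s.
Proof.
move=> ds; have s0 : 0 < s by apply: le_lt_trans ds; rewrite divr_ge0.
have G0 := mellin_gamma_gt0 s0; have p0 := pi_gt0 R.
have pi2 : 0 < 4 * pi ^+ 2 :> R by rewrite mulr_gt0// exprn_gt0.
have ps : 0 < (4 * pi ^+ 2) `^ s :> R by rewrite powR_gt0.
(* The prefactor (2 pi)^(-2s) of the zeta series is the factor (4 pi^2)^(-s) that the Mellin
   transform produces. *)
have pE : (2 * pi) `^ (- (2 * s)) = ((4 * pi ^+ 2) `^ s)^-1 :> R.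
  have p2 : 0 <= 2 * pi :> R by rewrite mulr_ge0// ltW.
  have -> : 4 * pi ^+ 2 = (2 * pi) ^+ 2 :> R by ring.
  by rewrite powRN powRrM (powR_mulrn 2 p2).
exists (mellin T s / mellin (@gamma_term R) s); last by rewrite mulrC divfK// gt_eqF.
rewrite /zetaEH_series.
have -> : (fun K : {ffun 'I_d -> int} => cpow (\sum_i (((K i)%:~R + lambda i) / alpha i) ^+ 2) (- s%:C)) =
    (fun K => (zeta_form K `^ (- s))%:C).
  by apply/funext => K; rewrite -rmorphN cpow_real//; exact: zeta_form_gt0.
rewrite (@sum_totally R _ _ (@box d) ((4 * pi ^+ 2) `^ s * (mellin T s / mellin (@gamma_term R) s))).
- have -> : - (2 * s%:C) = (- (2 * s))%:C :> R[i] by rewrite rmorphN rmorphM/= rmorph_nat.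
  by rewrite cpow_real ?mulr_gt0// pE -rmorphM/= mulKf// gt_eqF.
- by move=> K; exact: powR_ge0.
- exact: box_uniq.
- exact: box_exhausts.
have -> : (fun n => \sum_(K <- box d n) zeta_form K `^ (- s)) =
    (fun n => (4 * pi ^+ 2) `^ s * \sum_(K <- box d n) (4 * pi ^+ 2 * zeta_form K) `^ (- s)).
  apply/funext => n; rewrite mulr_sumr; apply: eq_bigr => K _.
  have zK := zeta_form_gt0 K.
  by rewrite (powRM _ (ltW pi2) (ltW zK)) mulrA (powRN (4 * pi ^+ 2)) divff ?mul1r// gt_eqF.
by apply: cvgM; [exact: cvg_cst|exact: cvg_box_mellin].
Qed.

End ZetaMellin.

(** * Asymptotics of the determinant *)

Section LogDeterminant.
Variables (R : realType) (d : nat) (a : 'I_d -> nat) (l : 'I_d -> R).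
Hypothesis a_gt0 : forall i, (0 < a i)%N.
Hypothesis l_itv : forall i, 0 <= l i < 1.
Variable i0 : 'I_d.
Hypothesis l_neq0 : l i0 != 0.

Local Notation mu := (@lebesgue_measure R).
Local Notation pos := (`]0, +oo[%classic : set R).

Let mpos : measurable (pos : set (measurableTypeR R)).
Proof. exact: measurable_itv. Qed.

(** In the sum of the Frullani integrals over the modes, the terms e^-t add up to (prod_i a_i) e^-t
    and cancel those of (prod_i a_i) c_d. The measure dt/t is invariant under scaling, so any c is
    allowed; it is taken to be n^2. *)
Lemma sum_ln_eigenvalue c : 0 < c ->
  let H t := \prod_(i < d) ((a i)%:R * heat0 t) in
  let Th t := \prod_(i < d) lattice_theta (a i) (l i) t in
  mu.-integrable pos (EFin \o (fun u => (H (c * u) - Th (c * u)) / u)) ->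
  \sum_(K : torus a) ln (torus_eigenvalue l K) - (\prod_(i < d) a i)%N%:R * lattice_constant R d =
  \int[mu]_(u in pos) ((H (c * u) - Th (c * u)) / u).
Proof.
move=> c0 H Th gi; pose f t : R := (H t - Th t) / t.
have gE u : (H (c * u) - Th (c * u)) / u = c * f (c * u).
  by rewrite /f invfM [RHS]mulrCA mulVKf// gt_eqF.
have fi : mu.-integrable pos (EFin \o f).
  have cV : 0 < c^-1 by rewrite invr_gt0.
  have := integrableZl mpos c^-1 (integrable_scale cV gi).
  apply: eq_integrable => // t _ /=.
  by rewrite gE mulVKf ?gt_eqF// -EFinM mulKf// gt_eqF.
have fci := integrable_scale c0 fi.
under eq_Rintegral do rewrite gE.
rewrite (@RintegralZl _ _ _ mu pos (fun u => f (c * u)) c mpos fci) (Rintegral_scale c0 fi).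
rewrite mulVKf ?gt_eqF//.
pose N : R := (\prod_(i < d) a i)%N%:R.
have N0 : N != 0 by rewrite pnatr_eq0 -lt0n prodn_gt0.
have NE : N = \sum_(K : torus a) 1.
  rewrite /N natr_prod; transitivity (\prod_(i < d) \sum_(j < a i) (1 : R)).
    by apply: eq_bigr => i _; rewrite sumr_const card_ord.
  rewrite -(sum_dffun_prod (fun i (_ : 'I_(a i)) => 1 : R)); apply: eq_bigr => K _.
  by rewrite big1.
have fr K := @Rintegral_frullani R _ (torus_eigenvalue_gt0 a_gt0 l_itv K l_neq0).
have [Si SE] := Rintegral_sum (index_enum (torus a)) mpos (fun K => (fr K).1).
pose k t : R := (expR (- (2 * d%:R * t)) * besselI 0 (2 * t) ^+ d - expR (- t)) / t.
(* The integrand of c_d is expressed through integrands already known to be integrable, which also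
   makes its own integral converge. *)
have kE t : k t = N^-1 * (f t - \sum_(K : torus a) (expR (- t) - expR (- torus_eigenvalue l K * t)) / t).
  rewrite /f /H /Th torus_theta_sum -mulr_suml -mulrBl mulrA; congr (_ / _).
  have -> : \sum_(K : torus a) (expR (- t) - expR (- torus_eigenvalue l K * t)) =
      \sum_(K : torus a) expR (- t) - \sum_(K : torus a) expR (- (t * torus_eigenvalue l K)).
    by rewrite -sumrB; apply: eq_bigr => K _; rewrite mulNr [t * _]mulrC.
  rewrite big_split/= -natr_prod -/N prodr_const card_ord /heat0 exprMn -expRM_natl.
  have -> : \sum_(K : torus a) expR (- t) = N * expR (- t).
    by rewrite NE mulr_suml; apply: eq_bigr => K _; rewrite mul1r.
  have -> : expR (- (2 * d%:R * t)) = expR (d%:R * - (2 * t)) by congr expR; ring.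
  by field.
have -> : lattice_constant R d = - \int[mu]_(t in pos) k t by [].
under eq_Rintegral do rewrite kE.
rewrite RintegralZl//; last by have := integrableB mpos fi Si.
have SL : \sum_(K : torus a) \int[mu]_(t in pos) ((expR (- t) - expR (- torus_eigenvalue l K * t)) / t) =
    \sum_(K : torus a) ln (torus_eigenvalue l K) by apply: eq_bigr => K _; exact: (fr K).2.
by rewrite RintegralB// SE SL mulrN opprK mulVKf//; ring.
Qed.

End LogDeterminant.

Theorem theorem1p1 (R : realType) (d : nat) (d_gt0 : (0 < d)%N)
    (a : 'I_d -> nat -> nat) (alpha : 'I_d -> R)
    (w : 'I_d -> nat -> nat -> R[i])
    (lambdan : 'I_d -> nat -> R) (lambda : 'I_d -> R)
    (Z : R[i]^o -> R[i]^o)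
    (a_gt0 : forall i n, (0 < n)%N -> (0 < a i n)%N)
    (a_cvg : forall i,
      (fun n : nat => (a i n)%:R / n%:R : R) @ \oo --> alpha i)
    (alpha_gt0 : forall i, 0 < alpha i)
    (w_norm : forall i n j, (0 < n)%N -> (j < a i n)%N -> `|w i n j| = 1)
    (lambdan_itv : forall i n, (0 < n)%N -> 0 <= lambdan i n < 1)
    (lambdan_prod : forall i n, (0 < n)%N ->
      \prod_(j < a i n) w i n j = cexp (0 +i* (2 * pi * lambdan i n)))
    (lambdan_cvg : forall i, lambdan i n @[n --> \oo] --> lambda i)
    (lambda_itv : forall i, 0 <= lambda i <= 1)
    (lambda_nontrivial : exists i : 'I_d,
      [/\ lambda i != 0, lambda i != 1 &
          forall n, (0 < n)%N -> lambdan i n != 0])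
    (Z_zetaEH : is_zetaEH alpha lambda Z) :
  (fun n : nat =>
     clog (det_bundle_laplacian (fun i => a i n) (fun i => w i n))
     - (((\prod_(i < d) a i n)%N%:R * lattice_constant R d)%:C - derive1 Z 0)
     : R[i]^o) @ \oo --> (0 : R[i]^o).
Proof.
have [i0 [li0 li1 lin]] := lambda_nontrivial.
have [kappa kappaE] := heat0_limit R.
have dec := theta_lim_decay d_gt0 a_cvg alpha_gt0 lambdan_itv lambdan_cvg lambda_itv li0 li1.
have small := theta_lim_small d_gt0 a_cvg alpha_gt0 lambdan_itv lambdan_cvg i0 kappaE.
have mT := measurable_theta_lim a_cvg alpha_gt0 lambdan_itv lambdan_cvg.
have [Fi fi lim] := cvg_torus_integral d_gt0 a_cvg alpha_gt0 lambdan_itv lambdan_cvg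
  lambda_itv li0 li1 kappaE.
have [Z1 Z2 Z3] := Z_zetaEH.
have d2 : d%:R / 2 = (d%:R / 2 : R)%:C :> R[i].
  by rewrite rmorphM/= fmorphV/= !rmorph_nat.
have d20 : 0 < d%:R / 2 :> R by rewrite divr_gt0// ltr0n.
rewrite d2 in Z1 Z2 Z3.
have Zm s : d%:R / 2 < s -> exists2 z : R, Z s%:C = z%:C &
    mellin (@gamma_term R) s * z = mellin (theta_lim alpha lambda) s.
  move=> ds; rewrite Z1//.
  exact: (zetaEH_series_mellin alpha_gt0 lambda_itv li0 li1 mT dec small d_gt0 ds).
rewrite (Z_derive1 d20 mT dec small Zm Z2 Z3 fi).
pose F (n : nat) (u : R) : R :=
  (torus_heat a n (n%:R ^+ 2 * u) - torus_theta a lambdan n (n%:R ^+ 2 * u)) / u.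
set I := \int[_]_(u in _) _ in lim *.
(* For large n the error term of the theorem is exactly a difference of real integrals, so the
   complex limit reduces to a real one. *)
have logdet : \forall n \near \oo, (\int[lebesgue_measure]_(u in `]0, +oo[) F n u - I)%:C =
    clog (det_bundle_laplacian (fun i => a i n) (fun i => w i n)) -
    (((\prod_(i < d) a i n)%N%:R * lattice_constant R d)%:C - (- I)%:C).
  apply: filterS2 near_gt0 Fi => n n0 Fin.
  have an i : (0 < a i n)%N by exact: a_gt0.
  have ln01 i : 0 <= lambdan i n < 1 by exact: lambdan_itv.
  have nn : 0 < n%:R ^+ 2 :> R by rewrite exprn_gt0// ltr0n.
  rewrite (@clog_det_bundle_laplacian R d _ _ (fun i => lambdan i n) an _ ln01 _ i0 (lin n n0)); last 2 first.
  - move=> i j ja; rewrite -normr_eq0 w_norm// oner_eq0//.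
  - by move=> i; rewrite lambdan_prod.
  rewrite -(sum_ln_eigenvalue an ln01 (lin n n0) nn Fin).
  by rewrite -!rmorphB; congr (_%:C); ring.
apply: cvg_trans (near_eq_cvg logdet) _.
have E0 : (0 : R[i]^o) = (I - I)%:C by rewrite subrr.
rewrite [X in cvg_to _ (nbhs X)]E0.
by apply: cvg_real_complex; apply: cvgB; [exact: lim|exact: cvg_cst].
Qed.
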